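(* The property ''$(z_0,\theta,R)$ is stable'' is algorithmically undecidable (non-computable). Namely, there does not exist an algorithm which, given an arbitrary input consisting of a dimension $d$, a vector $z_0\in\mathbb{R}^d_+$, a vector $\theta\in\mathbb{R}^d$ and a completely-$\mathcal{S}$ matrix $R\in\mathbb{R}^{d\times d}$, outputs YES if the fluid model $(z_0,\theta,R)$ is stable and NO otherwise.
   Context: The dimension $d$ is arbitrary (part of the input, not fixed). ''Algorithm'' means Turing machine; inputs are finitely encoded, i.e. the entries of $z_0,\theta,R$ supplied to the algorithm are rational numbers. Completely-$\mathcal{S}$: a square matrix $M$ is an $\mathcal{S}$-matrix if there is a vector $w\ge 0$ (coordinatewise) with $Mw>0$ coordinatewise. A square matrix $R$ is completely-$\mathcal{S}$ if every principal submatrix of $R$ (same set of row and column indices) is an $\mathcal{S}$-matrix. Skorokhod problem: given a $d\times d$ matrix $R$ and a continuous $x:[0,\infty)\to\mathbb{R}^d$ with $x(0)\ge 0$, a solution is a pair $(y,z)$ of continuous functions $[0,\infty)\to\mathbb{R}^d_+$ such that $z(t)=x(t)+Ry(t)$ for all $t\ge0$; $y(0)=0$ and every $y_j$ is non-decreasing; and $\int_0^\infty z_j(s)\,dy_j(s)=0$ (Stieltjes integral) for every $j=1,\dots,d$. Fluid model and stability: the fluid model $(z_0,\theta,R)$ is the Skorokhod problem with matrix $R$ and input $x(t)=z_0+\theta t$. It is stable if every solution $(y,z)$ of this Skorokhod problem satisfies $\lim_{t\to\infty}z(t)=0$. *)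

(* Defs.v *)
From HB Require Import structures.
From mathcomp Require Import all_boot all_order all_algebra.
From mathcomp Require Import all_classical all_reals all_analysis.

Set Implicit Arguments.
Unset Strict Implicit.
Unset Printing Implicit Defensive.

Import Order.TTheory GRing.Theory Num.Theory.
Import numFieldNormedType.Exports.

Local Open Scope classical_set_scope.
Local Open Scope ring_scope.

Section FluidModel.
Variable R : realType.

Definition S_matrix (n : nat) (M : 'M[R]_n) : Prop :=
  exists w : 'cV[R]_n,
    (forall i, 0 <= w i 0) /\ (forall i, 0 < (M *m w) i 0).

(* [enum_val] lists the elements of [A] in increasing order, so the [mxsub]
   below is the principal submatrix with row and column set [A].  For
   [A = set0] it is the 0 x 0 matrix, which is trivially an S-matrix. *)
Definition completely_S (d : nat) (M : 'M[R]_d) : Prop :=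
  forall A : {set 'I_d},
    S_matrix (mxsub (fun i : 'I_#|A| => enum_val i)
                    (fun j : 'I_#|A| => enum_val j) M).

(* [v] is the Stieltjes integral of [g] with respect to [f] over [0, +oo[.
   Only the values of [f] on [0, +oo[ matter: [f] is extended to the whole line
   by [f 0] on the left, so its Lebesgue-Stieltjes measure exists as soon as [f]
   is non-decreasing and right-continuous on [0, +oo[.  The extended function,
   hence the value [v], is uniquely determined. *)
Definition is_stieltjes_integral (g f : R -> R) (v : \bar R) : Prop :=
  exists2 F : cumulative R R,
    forall t : R, F t = f (Num.max 0 t) &
    (\int[lebesgue_stieltjes_measure F]_(t in `[0%R, +oo[) (g t)%:E)%E = v.

(* Functions on [0, +oo[ are represented by functions on the whole line, of which
   only the values on [0, +oo[ are constrained and used. *)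
Record skorokhod_solution (d : nat) (M : 'M[R]_d) (x y z : R -> 'cV[R]_d)
    : Prop := SkorokhodSolution {
  sk_y_continuous : {within `[0, +oo[, continuous y};
  sk_z_continuous : {within `[0, +oo[, continuous z};
  sk_y_ge0 : forall t : R, 0 <= t -> forall j, 0 <= y t j 0;
  sk_z_ge0 : forall t : R, 0 <= t -> forall j, 0 <= z t j 0;
  sk_equation : forall t : R, 0 <= t -> z t = x t + M *m y t;
  sk_y_init : y 0 = 0;
  sk_y_nondecreasing :
    forall j (s t : R), 0 <= s -> s <= t -> y s j 0 <= y t j 0;
  sk_complementarity :
    forall j,
      is_stieltjes_integral (fun t => z t j 0) (fun t => y t j 0) 0%E
}.

Definition stable (d : nat) (z0 theta : 'cV[R]_d) (M : 'M[R]_d) : Prop :=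
  forall y z : R -> 'cV[R]_d,
    skorokhod_solution M (fun t => z0 + t *: theta) y z ->
    z t @[t --> +oo] --> (0 : 'cV[R]_d).

End FluidModel.

Variant direction := MoveLeft | Stay | MoveRight.

(* Deterministic machines with one two-way infinite tape and input alphabet
   [Sigma]. *)
Record turing_machine (Sigma : Type) := TuringMachine {
  tm_state : finType;
  tm_symbol : finType;
  tm_blank : tm_symbol;
  tm_input : Sigma -> tm_symbol;
  tm_input_inj : injective tm_input;
  tm_input_nonblank : forall a, tm_input a != tm_blank;
  tm_start : tm_state;
  tm_yes : tm_state;
  tm_no : tm_state;
  tm_yes_neq_no : tm_yes != tm_no;
  tm_trans : tm_state -> tm_symbol -> tm_state * tm_symbol * direction
}.

(* The two sequences list the cells to the left and to the right of the head,
   nearest first; the cells beyond them are blank. *)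
Record config (Sigma : Type) (M : turing_machine Sigma) := Config {
  cf_state : tm_state M;
  cf_left : seq (tm_symbol M);
  cf_head : tm_symbol M;
  cf_right : seq (tm_symbol M)
}.

Section Run.
Variables (Sigma : Type) (M : turing_machine Sigma).

Definition initial (w : seq Sigma) : config M :=
  let s := map (@tm_input _ M) w in
  Config (tm_start M) [::] (head (tm_blank M) s) (behead s).

Definition halted (c : config M) : bool :=
  (cf_state c == tm_yes M) || (cf_state c == tm_no M).

Definition step (c : config M) : config M :=
  if halted c then c else
  let: Config q l h r := c in
  let: (q', a, m) := tm_trans q h in
  match m with
  | MoveLeft => Config q' (behead l) (head (tm_blank M) l) (a :: r)
  | Stay => Config q' l a r
  | MoveRight => Config q' (a :: l) (head (tm_blank M) r) (behead r)
  end.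

Definition outputs_yes (w : seq Sigma) : Prop :=
  exists n, cf_state (iter n step (initial w)) = tm_yes M.

Definition outputs_no (w : seq Sigma) : Prop :=
  exists n, cf_state (iter n step (initial w)) = tm_no M.

End Run.

Variant letter := Zero | One | Minus | Slash | Comma.

(* Binary notation, most significant digit first. *)
Fixpoint encode_positive (p : BinNums.positive) : seq letter :=
  match p with
  | BinNums.xH => [:: One]
  | BinNums.xO q => rcons (encode_positive q) Zero
  | BinNums.xI q => rcons (encode_positive q) One
  end.

Definition encode_nat (n : nat) : seq letter :=
  match bin_of_nat n with
  | BinNums.N0 => [:: Zero]
  | BinNums.Npos p => encode_positive p
  end.

Definition encode_int (m : int) : seq letter :=
  match m with
  | Posz n => encode_nat n
  | Negz n => Minus :: encode_nat n.+1
  end.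

Definition encode_rat (q : rat) : seq letter :=
  encode_int (numq q) ++ Slash :: encode_int (denq q).

(* The word  d , z0_1 , .. , z0_d , theta_1 , .. , theta_d , A_11 , A_12 , .. ,
   A_dd ,  with the entries of the matrix in row-major order. *)
Definition encode_input (d : nat) (z0 theta : 'cV[rat]_d) (A : 'M[rat]_d)
    : seq letter :=
  encode_nat d ++ Comma ::
  flatten [seq rcons (encode_rat q) Comma
          | q <- [seq z0 i 0 | i <- enum 'I_d] ++
                 [seq theta i 0 | i <- enum 'I_d] ++
                 [seq A i j | i <- enum 'I_d, j <- enum 'I_d]].

(* Main.v *)
(* Let [M] decide stability.  We build one fluid network whose drift and
   reflection matrix depend on [M] only and whose initial state depends on a
   word through a single entry, the load; it runs [M] on its own encoding, it
   is stable if [M] says NO and unstable if [M] says YES.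

   A cyclic clock turns in legs whose lengths form a geometric series, so that
   infinitely many turns fit into finite time while the state contracts to 0.
   One turn at scale [h] replaces data [x] by [Q min(x, 1)], up to the
   contraction factor: the saturation is the regulator of a node that reaches 0
   during a leg.  Such saturated linear networks simulate stack machines, the
   stacks being stored as fractions in a base with only odd digits.  When the
   output coordinate is 1 instead of 0, a fuse burns down before the clock does
   and then balances the drift of the clock forever, so the state remains
   nonzero.  If the output is never 1, the state reaches 0 at the end of the
   geometric series, and it stays there because 0 is absorbing.

   The load is the fraction of a stack that holds the part of the encoding
   before the load and the part after it; the numerator and the denominator of
   this fraction are spelled directly from the stack, so three copies of it
   suffice to write the whole encoding, load included, on a tape. *)

From HB Require Import structures.
From mathcomp Require Import all_boot all_order all_algebra.
From mathcomp Require Import all_classical all_reals all_analysis measurable_realfun.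
From mathcomp Require Import ring lra zify.
Require Import Defs.
Set Implicit Arguments.
Unset Strict Implicit.
Unset Printing Implicit Defensive.
Import Order.TTheory GRing.Theory Num.Theory.
Import numFieldNormedType.Exports.
Local Open Scope classical_set_scope.
Local Open Scope ring_scope.

(** * Complementarity as a pointwise condition *)

(** Running [M] on the encoding of its own instance replaces a reduction from the halting problem,
    so no transformation of instances has to be shown computable. The circularity is only apparent:
    the letters [pre] and [post] around the load do not depend on the load. They are fixed
    beforehand, and the load is then chosen as the value of a stack that contains them.

    Stability speaks of all solutions, and a completely-S matrix does not make solutions unique.
    Instability needs one explicit solution, but stability needs every solution to follow the
    computation. Therefore each leg carries a triangular order of its vanishing coordinates, which
    forces uniqueness up to the time where the turns accumulate. At the state 0 all coordinates
    vanish together and the three clocks depend on each other cyclically, so no such order exists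
    there; the constants are tuned so that a priori estimates still keep every solution at 0. *)

Section Stieltjes.
Variable R : realType.
Implicit Types (f z : R -> R) (F : cumulative R R).

Lemma clamp_continuous f :
  {within `[0, +oo[, continuous f} -> continuous (fun t : R => f (Num.max 0 t)).
Proof.
move=> /subspace_continuousP cf t; apply/cvgrPdist_lt => e e0.
have m0 (s : R) : Num.max 0 s \in `[0, +oo[ by rewrite in_itv/= andbT le_max lexx.
have /cvgrPdist_lt/(_ e e0) := cf _ (m0 t).
rewrite near_withinE => /nbhs_ballP[d /= d0 fd].
near=> s; apply: (fd (Num.max 0 s) _ (m0 s)); rewrite /ball/=.
apply: (@le_lt_trans _ _ `|t - s|); last first.
  by near: s; apply/nbhs_ballP; exists d.
by rewrite ler_norml; have := ler_norm (t - s); have := ler_norm (s - t); rewrite distrC;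
  case: (leP 0 t) => ?; case: (leP 0 s) => ? ? ?; apply/andP; split; lra.
Unshelve. all: by end_near. Qed.

Lemma lebesgue_stieltjes_oc F (a b : R) : a <= b ->
  lebesgue_stieltjes_measure F `]a, b]%classic = (F b - F a)%:E.
Proof.
move=> ab; rewrite /lebesgue_stieltjes_measure/= /measure_extension/=.
by rewrite measurable_mu_extE/= ?wlength_itv_bnd// ; exact: is_ocitv.
Qed.

Lemma stieltjes_integral_eq0 F z :
  measurable_fun (`[0, +oo[ : set R) z -> (forall t : R, 0 <= t -> 0 <= z t) ->
  (\int[lebesgue_stieltjes_measure F]_(t in `[0%R, +oo[) (z t)%:E = 0)%E <->
  (lebesgue_stieltjes_measure F).-negligible [set t : R | 0 <= t /\ 0 < z t].
Proof.
move=> mz z0; set mu := lebesgue_stieltjes_measure F.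
have mI : measurable (`[0%R, +oo[ : set R) by exact: measurable_itv.
have mz' : measurable_fun (`[0, +oo[ : set R) (EFin \o z) by exact/measurable_EFinP.
have -> : (\int[mu]_(t in `[0%R, +oo[) (z t)%:E = \int[mu]_(t in `[0%R, +oo[) `|(z t)%:E|)%E.
  apply: eq_integral => t /[!inE]/= /[!in_itv]/= /andP[t0 _].
  by rewrite ger0_norm// z0.
rewrite (ae_eq_integral_abs mu mI mz'); split => h.
  apply: negligibleS h => t/= [t0 zt] /(_ _)/=.
  rewrite in_itv/= t0 => /(_ isT) [] zt0.
  by rewrite zt0 ltxx in zt.
apply: negligibleS h => t/= /not_implyP[].
rewrite in_itv/= andbT => t0 /eqP zt; split=> //.
by rewrite lt0r z0// andbT; move: zt; apply: contra => /eqP ->.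
Qed.

(** An interval on which [z] is positive is null for the Stieltjes measure, so [f] does not grow on
    it. Conversely the set where [z] is positive is covered by countably many null intervals with
    rational endpoints. Measures do not occur in the dynamics after this. *)
Lemma stieltjes_complementarityP f z :
  {within `[0, +oo[, continuous f} -> {within `[0, +oo[, continuous z} ->
  (forall s t : R, 0 <= s -> s <= t -> f s <= f t) -> (forall t : R, 0 <= t -> 0 <= z t) ->
  is_stieltjes_integral z f 0%E <->
  (forall s t : R, 0 <= s -> s <= t -> (forall r, s <= r -> r <= t -> 0 < z r) -> f s = f t).
Proof.
move=> cf cz ndf z0.
have mz : measurable_fun (`[0, +oo[ : set R) z.
  by apply: subspace_continuous_measurable_fun => //; exact: measurable_itv.
split=> [[F Ff /(stieltjes_integral_eq0 F mz z0) neg0] s t s0 st zst|compl].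
  have : (lebesgue_stieltjes_measure F).-negligible `]s, t].
    apply: negligibleS neg0 => r/=; rewrite in_itv/= => /andP[sr rt].
    by split; [exact: le_trans s0 (ltW sr)|exact: zst (ltW sr) rt].
  move=> negst; have h : lebesgue_stieltjes_measure F `]s, t] = 0%E.
    by apply: measure_negligible negst; exact: measurable_itv.
  have := lebesgue_stieltjes_oc F st; rewrite h => -[]; rewrite !Ff !max_r//; last exact: le_trans st.
  by move/esym/eqP; rewrite subr_eq0 => /eqP.
have ndF : {homo (fun t : R => f (Num.max 0 t)) : x y / x <= y}.
  by move=> x y xy; apply: ndf; [rewrite le_max lexx|rewrite ge_max !le_max lexx xy orbT].
have cF := clamp_continuous cf.
pose F : cumulative R R := HB.pack (fun t : R => f (Num.max 0 t))
  (isCumulative.Build R _ R _ ndF (right_continuousW cF)).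
exists F => //; apply/(stieltjes_integral_eq0 F mz z0).
(* Clamping allows the rational interval around a point near 0 to start to the left of 0. *)
pose zc := fun t : R => z (Num.max 0 t).
pose B (p : rat * rat) : set R := if pselect (ratr p.1 <= ratr p.2 :> R /\
    forall r : R, ratr p.1 <= r -> r <= ratr p.2 -> 0 < zc r)
  then `](ratr p.1), (ratr p.2)]%classic else set0.
pose C n := if unpickle n is Some p then B p else set0.
have Cneg n : (lebesgue_stieltjes_measure F).-negligible (C n).
  rewrite /C; case: unpickle => [[p q]|]; last exact: negligible_set0.
  rewrite /B/=; case: pselect => [[pq pos]|?] /=; last exact: negligible_set0.
  exists `](ratr p), (ratr q)]%classic; split => //.
  rewrite lebesgue_stieltjes_oc//=; congr EFin; apply/eqP; rewrite subr_eq0 eq_sym.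
  apply/eqP; apply: compl => [||r h1 h2]; first by rewrite le_max lexx.
    by rewrite ge_max !le_max lexx pq orbT.
  have r0 : 0 <= r by move: h1; rewrite ge_max => /andP[].
  have pr : ratr p <= r by move: h1; rewrite ge_max => /andP[].
  have [rq|qr] := leP r (ratr q).
    by have := pos r pr rq; rewrite /zc max_r.
  (* This happens only for an interval to the left of 0, which clamping shrinks to the point 0. *)
  have q0 : ratr q <= 0 :> R.
    by rewrite leNgt; apply/negP => q0; have := lt_le_trans qr h2; rewrite (max_r (ltW q0)) ltxx.
  have -> : r = Num.max 0 (ratr q).
    by apply/eqP; rewrite eq_le h2 max_l.
  exact: pos.
apply: negligibleS (negligible_bigcup Cneg) => t/= [t0 zt].
have zct : 0 < zc t by rewrite /zc max_r.
have : \forall s \near t, 0 < zc s.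
  have ct : zc @ t --> zc t by exact: clamp_continuous.
  exact: (@cvgr_gt R R (nbhs t) _ zc (zc t) ct 0 zct).
move=> /nbhs_ballP[d /= d0 dpos].
have [p] := @rat_in_itvoo R (t - d) t ltac:(by rewrite ltrBlDr ltrDl).
have [q] := @rat_in_itvoo R t (t + d) ltac:(by rewrite ltrDl).
rewrite !in_itv/= => /andP[tq qd] /andP[dp pt].
exists (pickle (p, q)); first exact: I.
rewrite /C pickleK /B; case: pselect => [?|[]] /=; first by rewrite in_itv/= pt ltW.
split; first by rewrite ltW// (lt_trans pt).
move=> r pr rq; apply: dpos; rewrite /ball/= ltr_norml.
by apply/andP; split; clear -pr rq dp qd; lra.
Qed.
End Stieltjes.

(** * Extremal points where a continuous function is nonpositive, and monotonicity from local
    bounds *)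

Section RealFunctions.
Variable R : realType.
Implicit Types (f : R -> R) (a b t : R).

Lemma continuous_gt0_near f t : continuous f -> 0 < f t ->
  exists2 d, 0 < d & forall r, `|r - t| < d -> 0 < f r.
Proof.
move=> cf ft; have : \forall s \near t, 0 < f s.
  exact: (@cvgr_gt R R (nbhs t) _ f (f t) (cf t) 0 ft).
move=> /nbhs_ballP[d /= d0 dpos]; exists d => // r rd.
by apply: dpos; rewrite /ball/= distrC.
Qed.

Lemma last_le0 f a b : continuous f -> a <= b -> f a <= 0 ->
  exists s, [/\ a <= s, s <= b, f s <= 0 & forall r, s < r -> r <= b -> 0 < f r].
Proof.
move=> cf ab fa; pose E := [set r : R | [/\ a <= r, r <= b & f r <= 0]].
have Ea : E a by split.
have uE : ubound E b by move=> r [].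
have hE : has_sup E by split; [exists a|exists b].
have ubE : forall r, E r -> r <= sup E by move=> r Er; exact: ub_le_sup (hE.2) _ Er.
exists (sup E); split.
- exact: ubE.
- by apply: ge_sup uE; exists a.
- rewrite leNgt; apply/negP => /(continuous_gt0_near cf)[d d0 dpos].
  have [e [ae eb fe] se] := sup_adherent d0 hE.
  have es : e <= sup E by apply: ubE.
  suff : 0 < f e by rewrite ltNge fe.
  by apply: dpos; rewrite ler0_norm ?subr_le0// opprB ltrBlDl -ltrBlDr.
- move=> r sr rb; rewrite ltNge; apply/negP => fr.
  have : E r by split => //; apply: le_trans (ltW sr); exact: ubE.
  by move=> /ubE; rewrite leNgt sr.
Qed.

Lemma first_le0 f a b : continuous f -> a <= b -> f b <= 0 ->
  exists s, [/\ a <= s, s <= b, f s <= 0 & forall r, a <= r -> r < s -> 0 < f r].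
Proof.
move=> cf ab fb.
have cfN : continuous (f \o -%R).
  by move=> t; apply: continuous_comp; [exact: opp_continuous|exact: cf].
have [||s [bs sa fs pos]] := @last_le0 (f \o -%R) (- b) (- a) cfN.
- by rewrite lerN2.
- by rewrite /= opprK.
exists (- s); split => //; [by rewrite lerNr|by rewrite lerNl|].
move=> r ar rs; have := pos (- r); rewrite /= opprK; apply; last by rewrite lerN2.
by rewrite ltrNr.
Qed.

(** Complementarity is stated on closed intervals; this transfers it to intervals open on the left,
    at whose left end the node may be 0. *)
Lemma eq_left_limit f r t : continuous f -> r < t ->
  (forall s, r < s -> s <= t -> f s = f t) -> f r = f t.
Proof.
move=> cf rt ft; apply/eqP; case: eqP => // /eqP ne.
have cg : continuous (fun s => `|f s - f t|).
  by move=> s; apply: cvg_norm; apply: cvgB; [exact: cf|exact: cvg_cst].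
have [|d d0 dpos] := @continuous_gt0_near _ r cg; first by rewrite normr_gt0 subr_eq0.
pose s := Num.min t (r + d / 2).
have rs : r < s by rewrite lt_min rt ltrDl divr_gt0.
have st : s <= t by rewrite ge_min lexx.
have : 0 < `|f s - f t|.
  apply: dpos; rewrite gtr0_norm ?subr_gt0// ltrBlDl.
  by rewrite (@le_lt_trans _ _ (r + d / 2)) ?ge_min ?lexx ?orbT// ltrD2l; lra.
by rewrite ft// subrr normr0 ltxx.
Qed.

(** If [f b] exceeded [f a], consider the last point where [f] is at most [f a]: the local bound
    there keeps [f] below this value a little longer. *)
Lemma right_locally_nonincreasing f a b : continuous f -> a <= b ->
  (forall s, a <= s -> s < b -> exists2 d, 0 < d &
     forall r, s <= r -> r <= s + d -> r <= b -> f r <= f s) ->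
  f b <= f a.
Proof.
move=> cf ab loc; rewrite leNgt; apply/negP => fab.
have cg : continuous (fun s => f s - f a).
  by move=> s; apply: cvgB; [exact: cf|exact: cvg_cst].
have [|s [as_ sb fs pos]] := @last_le0 _ a b cg ab; first by rewrite subrr.
have {}sb : s < b.
  rewrite lt_neqAle sb andbT; apply/eqP => sb'.
  by move: fs; rewrite sb' subr_le0 leNgt fab.
have [d d0 dl] := loc s as_ sb.
pose r := Num.min b (s + d).
have sr : s < r by rewrite lt_min sb ltrDl.
have rb : r <= b by rewrite ge_min lexx.
have rd : r <= s + d by rewrite ge_min lexx orbT.
have := pos r sr rb; rewrite subr_gt0 ltNge; apply/negP; rewrite negbK.
by apply: le_trans (dl r (ltW sr) rd rb) _; rewrite -subr_le0.
Qed.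

Lemma continuous_sum_mul (I : finType) (c : I -> R) (f : I -> R -> R) :
  (forall i, continuous (f i)) -> continuous (fun t => \sum_i c i * f i t).
Proof.
move=> cf t; apply: cvg_big => [|i _]; first exact: add_continuous.
by apply: cvgM; [exact: cvg_cst|exact: cf].
Qed.
End RealFunctions.

(** * Explicit pieces of solutions *)

Section Dynamics.
Variables (R : realType) (N : finType) (th : N -> R) (M : N -> N -> R).
Implicit Types (x : N -> R) (y z : N -> R -> R).

(** The Skorokhod problem for the input [x0 + th t], with coordinates in a finite type, functions
    continuous on the whole line, and complementarity in the interval form of
    [stieltjes_complementarityP]. *)
Record solution (x0 : N -> R) y z : Prop := Solution {
  sol_yc : forall j, continuous (y j);
  sol_zc : forall j, continuous (z j);
  sol_z_ge0 : forall j t, 0 <= t -> 0 <= z j t;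
  sol_eq : forall j t, 0 <= t -> z j t = x0 j + th j * t + \sum_k M j k * y k t;
  sol_y0 : forall j, y j 0 = 0;
  sol_nd : forall j s t, 0 <= s -> s <= t -> y j s <= y j t;
  sol_cp : forall j s t, 0 <= s -> s <= t ->
    (forall r, s <= r -> r <= t -> 0 < z j r) -> y j s = y j t }.

Arguments sol_yc {x0 y z} _ j.
Arguments sol_zc {x0 y z} _ j.

Definition free_path (x0 : N -> R) (y : N -> R -> R) (j : N) (t : R) : R :=
  x0 j + th j * t + \sum_k M j k * y k t.

(* The last field says that the coordinates that vanish can be ordered so that the
   regulator of each is determined by those of lower rank; it makes the solution
   unique. *)
Record leg (tau : R) (x0 x1 : N -> R) (y : N -> R -> R) : Prop := Leg {
  leg_tau : 0 < tau;
  leg_yc : forall j, continuous (y j);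
  leg_y0 : forall j, y j 0 = 0;
  leg_nd : forall j s t, 0 <= s -> s <= t -> t <= tau -> y j s <= y j t;
  leg_ge0 : forall j t, 0 <= t -> t <= tau -> 0 <= free_path x0 y j t;
  leg_cp : forall j t, 0 <= t -> t <= tau -> free_path x0 y j t * y j t = 0;
  leg_end : forall j, free_path x0 y j tau = x1 j;
  leg_rank : forall t, 0 <= t -> t < tau -> exists rk : N -> nat,
    forall j, free_path x0 y j t = 0 -> forall u : N -> R,
      (forall k, free_path x0 y k t = 0 -> (rk k < rk j)%N -> u k = 0) ->
      (forall k, free_path x0 y k t != 0 -> u k = 0) ->
      \sum_k M j k * u k = u j }.

Lemma free_path_continuous x0 y j :
  (forall j, continuous (y j)) -> continuous (free_path x0 y j).
Proof.
move=> yc t; apply: cvgD; last exact: continuous_sum_mul.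
apply: cvgD; first exact: cvg_cst.
by apply: cvgM; [exact: cvg_cst|exact: cvg_id].
Qed.

Lemma sol_cp_open x0 y z j s t : solution x0 y z -> 0 <= s -> s <= t ->
  (forall r, s < r -> r <= t -> 0 < z j r) -> y j s = y j t.
Proof.
move=> S s0; rewrite le_eqVlt => /predU1P[->//|st] pos.
apply: (@eq_left_limit _ (y j) s t _ st) => [|r sr rt]; first exact: sol_yc S j.
apply: (sol_cp S) => // [|q rq qt]; first exact: le_trans s0 (ltW sr).
by apply: pos => //; exact: lt_le_trans rq.
Qed.

Lemma sol_y_ge0 x0 y z j t : solution x0 y z -> 0 <= t -> 0 <= y j t.
Proof. by move=> S t0; rewrite -(sol_y0 S j); exact: (sol_nd S). Qed.

(** Let [s] be the last time of agreement. Shortly after [s] the nodes that were positive at [s]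
    remain so in both solutions and their regulators rest. For the others, by induction on the rank,
    [leg_rank] reduces the row to its own regulator, so the difference of the nodes equals the
    difference of the regulators, and complementarity excludes both signs. *)
Lemma leg_unique x0 x1 y z tau yl : solution x0 y z -> leg tau x0 x1 yl ->
  forall t, 0 <= t -> t <= tau -> forall j, y j t = yl j t.
Proof.
move=> S Lg t t0 tt j; set zl := free_path x0 yl.
have zlc k : continuous (zl k) by apply: free_path_continuous; exact: leg_yc Lg.
pose f r := \sum_k `|y k r - yl k r|.
have f0P r : reflect (forall k, y k r = yl k r) (f r <= 0).
  have fge : 0 <= f r by exact: sumr_ge0.
  apply: (iffP idP) => [fr k|h]; last first.
    by rewrite /f big1// => k _; rewrite h subrr normr0.
  have /eqP : f r = 0 by apply/eqP; rewrite eq_le fr fge.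
  rewrite psumr_eq0// => /allP/(_ k (mem_index_enum _)).
  by rewrite normr_eq0 subr_eq0 => /eqP.
have fc : continuous f.
  move=> r; apply: cvg_big => [|k _]; first exact: add_continuous.
  apply: cvg_norm; apply: cvgB; [exact: (sol_yc S)|exact: (leg_yc Lg)].
suff /f0P : f t <= 0 by exact.
rewrite leNgt; apply/negP => ft.
have [|s [s0 st /f0P ys pos]] := last_le0 fc t0.
  by apply/f0P => k; rewrite (sol_y0 S) (leg_y0 Lg).
have {}st : s < t.
  rewrite lt_neqAle st andbT; apply/eqP => sE.
  by move: ft; rewrite ltNge -sE; move/f0P: ys => ->.
have zs k : z k s = zl k s.
  by rewrite (sol_eq S)//; congr (_ + _); apply: eq_bigr => i _; rewrite ys.
have [d d0 dpos] : exists2 d, 0 < d & forall k r, 0 < zl k s -> `|r - s| < d ->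
    0 < zl k r /\ 0 < z k r.
  have : \forall r \near s, forall k, 0 < zl k s -> 0 < zl k r /\ 0 < z k r.
    suff : forall k, \forall r \near s, 0 < zl k s -> 0 < zl k r /\ 0 < z k r.
      by move=> h; apply: filterS (@filter_forall _ _ _ (nbhs s) _ h) => r hr k; exact: hr.
    move=> k; have [zlp|_] := ltP 0 (zl k s); last first.
      by near=> r.
    have zp : 0 < z k s by rewrite zs.
    have zck : z k @ s --> z k s by exact: sol_zc S k s.
    have h1 : \forall r \near s, 0 < zl k r.
      exact: (@cvgr_gt R R (nbhs s) _ (zl k) (zl k s) (zlc k s) 0 zlp).
    have h2 : \forall r \near s, 0 < z k r.
      exact: (@cvgr_gt R R (nbhs s) _ (z k) (z k s) zck 0 zp).
    by apply: filterS2 h1 h2 => r.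
  move=> /nbhs_ballP[d /= d0 dpos]; exists d => // k r zk rd.
  by apply: dpos zk; rewrite /ball/= distrC.
have [rk rkP] := leg_rank Lg s0 (lt_le_trans st tt).
pose e := Num.min t (s + d / 2).
have se : s < e by rewrite lt_min st ltrDl divr_gt0.
have et : e <= t by rewrite ge_min lexx.
have ed r : s <= r -> r <= e -> `|r - s| < d.
  move=> sr re; rewrite ger0_norm ?subr_ge0//.
  have : e <= s + d / 2 by rewrite ge_min lexx orbT.
  by move=> ?; lra.
suff agree : forall n k r, (rk k < n)%N \/ zl k s != 0 -> s <= r -> r <= e -> y k r = yl k r.
  have := pos e se et; rewrite ltNge => /negP; apply; apply/f0P => k.
  by apply: (agree (rk k).+1) => //; [left|exact: ltW].
have nz k r : zl k s != 0 -> s <= r -> r <= e -> y k r = yl k r.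
  move=> zk sr re.
  have zk0 : 0 < zl k s.
    by rewrite lt_neqAle eq_sym zk (leg_ge0 Lg)// ltW// (lt_le_trans st).
  (* By [leg_cp] the regulator of a node that is positive is still 0. *)
  have ylr q : s <= q -> q <= e -> yl k q = 0.
    move=> sq qe; have [/lt0r_neq0 h _] := dpos k q zk0 (ed q sq qe).
    have /eqP := leg_cp Lg k (le_trans s0 sq) (le_trans qe (le_trans et tt)).
    by rewrite mulf_eq0 (negbTE h) => /eqP.
  rewrite ylr// -(@sol_cp _ _ _ S k s r)// => [|q sq qr].
    by rewrite ys ylr// ltW.
  by apply: (dpos k q zk0 _).2; apply: ed => //; exact: le_trans re.
elim=> [k r [//|zk]|n IH k r]; first exact: nz.
have [zk|/nz h _] := eqVneq (zl k s) 0; last exact: h.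
move=> rkn sr re; have r0 := le_trans s0 sr.
have rtau : r <= tau := le_trans re (le_trans et tt).
have diff q : s <= q -> q <= e -> z k q - zl k q = y k q - yl k q.
  move=> sq qe; rewrite (sol_eq S) ?(le_trans s0)// /zl /free_path opprD addrACA subrr add0r.
  rewrite -sumrB -(rkP k zk (fun i => y i q - yl i q)).
  - by apply: eq_bigr => i _; rewrite mulrBr.
  - move=> i _ ik; rewrite IH ?subrr//; left; case: rkn => [|]; last by [].
    by move/(leq_trans ik).
  - by move=> i zi; rewrite nz ?subrr.
(* If [y] is behind, the node of the leg is positive, so [yl] is 0 and [y] cannot be smaller. If [y]
   is ahead, [z] has been positive since the last time where [y] was not ahead, so [y] has been
   constant while [yl] did not decrease. *)
case: (ltgtP (y k r) (yl k r)) => cmp; last by [].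
- have zlp : 0 < zl k r.
    by have := sol_z_ge0 S k r0; have := diff r sr re; lra.
  have /eqP := leg_cp Lg k r0 rtau; rewrite mulf_eq0 -/(zl k r) (gt_eqF zlp)/= => /eqP yl0.
  by have := sol_y_ge0 k S r0; rewrite leNgt -yl0 cmp.
- have cD : continuous (fun q => y k q - yl k q).
    by move=> q; apply: cvgB; [exact: (sol_yc S)|exact: (leg_yc Lg)].
  have [|q [sq qr Dq Dpos]] := last_le0 cD sr; first by rewrite ys subrr.
  have yqr : y k q = y k r.
    apply: (sol_cp_open S (le_trans s0 sq) qr) => p qp pr.
    have sp := le_trans sq (ltW qp); have pe := le_trans pr re.
    have p0 := le_trans s0 sp; have ptau := le_trans pr rtau.
    by have := Dpos p qp pr; have := diff p sp pe; have := leg_ge0 Lg k p0 ptau; rewrite -/(zl k p); lra.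
  have := leg_nd Lg k (le_trans s0 sq) qr rtau.
  by move: Dq; rewrite yqr; lra.
Unshelve. all: by end_near. Qed.

Lemma leg_final x0 x1 y z tau yl j :
  solution x0 y z -> leg tau x0 x1 yl -> z j tau = x1 j.
Proof.
move=> S Lg; have tau0 := ltW (leg_tau Lg).
rewrite (sol_eq S)// -(leg_end Lg) /free_path; congr (_ + _).
by apply: eq_bigr => k _; rewrite (leg_unique S Lg).
Qed.

Lemma solution_shift x0 y z tau : solution x0 y z -> 0 <= tau ->
  solution (z^~ tau) (fun j t => y j (tau + t) - y j tau) (fun j t => z j (tau + t)).
Proof.
move=> S tau0.
have cs (f : R -> R) : continuous f -> continuous (fun t => f (tau + t)).
  move=> fc t; apply: continuous_comp; last exact: fc.
  by apply: cvgD; [exact: cvg_cst|exact: cvg_id].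
split=> [j|j|j t t0|j t t0|j|j s t s0 st|j s t s0 st pos].
- by move=> t; apply: cvgB; [exact: (cs (y j) (sol_yc S j) t)|exact: cvg_cst].
- exact: (cs (z j) (sol_zc S j)).
- by rewrite (sol_z_ge0 S)// addr_ge0.
- rewrite !(sol_eq S)// ?addr_ge0//.
  under [X in _ = _ + X]eq_bigr do rewrite mulrBr.
  by rewrite sumrB; ring.
- by rewrite addr0 subrr.
- by rewrite lerD2r (sol_nd S) ?addr_ge0// lerD2l.
- congr (_ - _); apply: (sol_cp S); rewrite ?addr_ge0 ?lerD2l// => r tsr rtt.
  have := pos (r - tau); rewrite [tau + _]addrC subrK; apply; first by rewrite lerBrDl.
  by rewrite lerBlDl.
Qed.

Lemma sol_init x0 y z j : solution x0 y z -> z j 0 = x0 j.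
Proof.
move=> S; rewrite (sol_eq S)// mulr0 addr0 big1 ?addr0// => k _.
by rewrite (sol_y0 S) mulr0.
Qed.

Lemma solution_ext x0 x1 y z : (forall j, x0 j = x1 j) ->
  solution x0 y z -> solution x1 y z.
Proof. by move=> e [? ? ? h *]; split => // j t t0; rewrite h// e. Qed.

Definition dies x0 := forall y z, solution x0 y z ->
  exists T : R, forall j t, T <= t -> z j t = 0.

Definition escapes x0 := exists y z, solution x0 y z /\
  exists j v T, v != 0 /\ forall t : R, T <= t -> z j t = v.

Lemma dies_shift x0 : (forall y z, solution x0 y z -> exists tau : R,
  0 <= tau /\ dies (z^~ tau)) -> dies x0.
Proof.
move=> h y z S; have [tau [tau0 d]] := h y z S.
have [T zT] := d _ _ (solution_shift S tau0).
exists (tau + T) => j t Tt; rewrite -(zT j (t - tau)) ?lerBrDl//.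
by congr (z j _); ring.
Qed.

Definition passes (tau : R) (x0 x1 : N -> R) := 0 < tau /\
  forall y z, solution x0 y z -> forall j, z j tau = x1 j.

Lemma leg_passes tau x0 x1 yl : leg tau x0 x1 yl -> passes tau x0 x1.
Proof.
by move=> Lg; split=> [|y z S j]; [exact: leg_tau Lg|exact: leg_final S Lg].
Qed.

Lemma passes_trans tau1 tau2 x0 x1 x2 :
  passes tau1 x0 x1 -> passes tau2 x1 x2 -> passes (tau1 + tau2) x0 x2.
Proof.
move=> [t1 p1] [t2 p2]; split=> [|y z S j]; first exact: addr_gt0.
exact: (p2 _ _ (solution_ext (p1 _ _ S) (solution_shift S (ltW t1)))).
Qed.

(* Infinitely many legs take the finite time [T], and the state is 0 at [T] by
   continuity. *)
Lemma zeno_dies (tau : nat -> R) (s : nat -> N -> R) (T : R) :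
  (forall n, passes (tau n) (s n) (s n.+1)) ->
  (fun n => \sum_(i < n) tau i) @ \oo --> T ->
  (forall j, (fun n => s n j) @ \oo --> (0 : R)) ->
  dies (fun=> 0) -> dies (s 0%N).
Proof.
move=> Ps cT cs d; apply: dies_shift => y z S.
pose t n := \sum_(i < n) tau i.
have t0 n : 0 <= t n by apply: sumr_ge0 => i _; exact: ltW (Ps i).1.
have zt n j : z j (t n) = s n j.
  elim: n j => [|n IH] j; first by rewrite /t big_ord0 (sol_init _ S).
  have := (Ps n).2 _ _ (solution_ext IH (solution_shift S (t0 n))) j.
  by rewrite /t big_ord_recr.
have T0 : 0 <= T.
  by rewrite -(cvg_lim _ cT)//; apply: limr_ge; [exact: cvgP cT|near=> n; exact: t0].
exists T; split => //.
have zT j : z j T = 0.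
  have h : (fun n => z j (t n)) @ \oo --> z j T.
    exact: (cvg_comp _ _ cT (sol_zc S j T)).
  have h2 : (fun n => z j (t n)) @ \oo --> (0 : R).
    by under eq_fun do rewrite zt; exact: cs.
  exact: (cvg_unique _ h h2).
by move=> y' z' /(solution_ext zT); exact: d.
Unshelve. all: by end_near. Qed.

(** The leg is glued in front of the escaping solution: the regulators add up, the first stopped at
    [tau] and the second started there. An interval of positivity that contains [tau] is split at
    [tau]. *)
Lemma leg_escapes tau x0 x1 yl : leg tau x0 x1 yl -> escapes x1 -> escapes x0.
Proof.
move=> Lg [y [z [S [j0 [v [T [v0 zv]]]]]]].
have tau0 := leg_tau Lg.
pose Y j t := yl j (Num.min t tau) + y j (Num.max 0 (t - tau)).
have Ylt j t : t <= tau -> Y j t = yl j t.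
  by move=> tt; rewrite /Y min_l// max_l ?subr_le0// (sol_y0 S) addr0.
have Ygt j t : tau <= t -> Y j t = yl j tau + y j (t - tau).
  by move=> tt; rewrite /Y min_r// max_r ?subr_ge0.
pose Z := free_path x0 Y.
have Zlt j t : t <= tau -> Z j t = free_path x0 yl j t.
  by move=> tt; congr (_ + _); apply: eq_bigr => k _; rewrite Ylt.
have Zgt j t : tau <= t -> Z j t = z j (t - tau).
  move=> tt; rewrite (sol_eq S) ?subr_ge0// -(leg_end Lg) /Z /free_path.
  under eq_bigr do rewrite Ygt// mulrDr.
  by rewrite big_split/=; ring.
have Yc j : continuous (Y j).
  move=> t; apply: cvgD.
    apply: (continuous_comp (f := fun t => Num.min t tau)); last exact: (leg_yc Lg).
    by apply: continuous_min; [exact: cvg_id|exact: cvg_cst].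
  apply: (continuous_comp (f := fun t => Num.max 0 (t - tau))); last exact: (sol_yc S).
  apply: continuous_max; first exact: cvg_cst.
  by apply: cvgB; [exact: cvg_id|exact: cvg_cst].
exists Y, Z; split; last first.
  exists j0, v, (Num.max tau (T + tau)); split => // t; rewrite ge_max => /andP[h1 h2].
  by rewrite Zgt// zv// lerBrDr.
have cpl j s t : 0 <= s -> s <= t -> t <= tau ->
    (forall r, s <= r -> r <= t -> 0 < Z j r) -> Y j s = Y j t.
  move=> s0 st tt pos; have ss := le_trans st tt.
  have zero r : s <= r -> r <= t -> Y j r = 0.
    move=> sr rt; have rr := le_trans rt tt.
    have := leg_cp Lg j (le_trans s0 sr) rr; rewrite Ylt// -Zlt// => /eqP.
    by rewrite mulf_eq0 gt_eqF ?pos//= => /eqP.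
  by rewrite !zero.
have cpr j s t : tau <= s -> s <= t ->
    (forall r, s <= r -> r <= t -> 0 < Z j r) -> Y j s = Y j t.
  move=> ss st pos; rewrite !Ygt ?(le_trans ss)//; congr (_ + _).
  apply: (sol_cp S); rewrite ?subr_ge0 ?lerB// => r; rewrite lerBlDr lerBrDr => h1 h2.
  by rewrite -[r](addrK tau) -Zgt ?pos// (le_trans ss).
split=> //.
- by move=> j; exact: free_path_continuous.
- move=> j t t0; have [tt|tt] := leP t tau.
    by rewrite Zlt// (leg_ge0 Lg).
  by rewrite (Zgt _ _ (ltW tt)); apply: (sol_z_ge0 S); rewrite subr_ge0 ltW.
- by move=> j; rewrite Ylt ?ltW// (leg_y0 Lg).
- move=> j s t s0 st; apply: lerD.
    apply: (leg_nd Lg); first by rewrite le_min s0 ltW.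
      by rewrite le_min !ge_min st lexx orbT.
    by rewrite ge_min lexx orbT.
  apply: (sol_nd S); first by rewrite le_max lexx.
  by rewrite ge_max !le_max lexx /= lerD2r st orbT.
- move=> j s t s0 st pos; have [tt|tt] := leP t tau; first exact: cpl.
  have [ss|ss] := leP tau s; first exact: cpr.
  rewrite (cpl j s tau)// ?(ltW ss)// => [|r sr rt].
    by apply: cpr; rewrite ?lexx// ?(ltW tt)// => r tr rt; apply: pos => //; exact: le_trans (ltW ss) tr.
  by apply: pos => //; exact: le_trans rt (ltW tt).
Qed.
End Dynamics.

Arguments sol_yc {R N th M x0 y z} _ j.
Arguments sol_zc {R N th M x0 y z} _ j.

(** * The network *)

Section LinearRows.
Variables (F : fieldType) (N : finType).

Definition unit_vec (k i : N) : F := (i == k)%:R.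

Lemma row_linearE (f : (N -> F) -> F) :
  (forall a u v, f (fun i => a * u i + v i) = a * f u + f v) ->
  forall u, \sum_k f (unit_vec k) * u k = f u.
Proof.
move=> lin u; have f0 : f (fun=> 0) = 0.
  have /eqP := lin 1 (fun=> 0) (fun=> 0).
  have -> : (fun i : N => 1 * 0 + 0 : F) = (fun=> 0) by apply: funext => i; ring.
  by rewrite mul1r -subr_eq subrr eq_sym => /eqP.
have h (s : seq N) : f (fun i => \sum_(k <- s) u k * unit_vec k i) =
    \sum_(k <- s) f (unit_vec k) * u k.
  elim: s => [|k s IH].
    by rewrite big_nil -[RHS]f0; congr f; apply: funext => i; rewrite big_nil.
  rewrite big_cons -IH [f _ * _]mulrC -lin; congr f.
  by apply: funext => i; rewrite big_cons.
rewrite -h; congr f; apply: funext => i; rewrite (bigD1 i)//= /unit_vec eqxx mulr1.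
by rewrite big1 ?addr0// => k ki; rewrite eq_sym (negbTE ki) mulr0.
Qed.
End LinearRows.

Section Network.
Variable (J : finType).

(* A three-phase clock, a fuse, and for every coordinate a gate, its shadow and
   an output buffer.  During leg [k] of a turn [clock k] is pinned at 0 and the
   next clock drains at unit rate. *)
Definition node : finType := (option (option bool) + (J + (J + J)))%type.
Definition clock1 : node := inl (Some None).
Definition clock2 : node := inl (Some (Some false)).
Definition clock3 : node := inl (Some (Some true)).
Definition fuse : node := inl None.
Definition gate (j : J) : node := inr (inl j).
Definition shadow (j : J) : node := inr (inr (inl j)).
Definition buffer (j : J) : node := inr (inr (inr j)).

(** [kal] is the contraction from one leg to the next. [kth] is the rate at which gates drain in leg
    1 and buffers in leg 3, [kg] that of the shadows in leg 2. [ka] and [ka'] add an inflow to the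
    buffers in leg 1 and remove it in leg 2, which keeps them positive for entries of [Q] of either
    sign. [kr] feeds the regulator of the output gate to the fuse, and [kp] refills the fuse in leg
    2. *)
Record constants (F : Type) := Constants {
  kal : F; kth : F; kg : F; kc : F; kmu : F; ka : F; ka' : J -> F;
  kp : F; kr : F }.

Variables (F : realFieldType) (jy : J) (Q : J -> J -> F) (C : constants F).
Local Notation al := (kal C).
Local Notation th := (kth C).
Local Notation g := (kg C).
Local Notation c := (kc C).
Local Notation mu := (kmu C).
Local Notation a := (ka C).
Local Notation a' := (ka' C).

Definition bias (j : node) : F := if j is inl _ then -1 else 0.

(** In leg [k] the regulator of [clock k] runs at unit rate and the other two clock regulators rest.
    Its coefficient in a row, plus the bias, is thus the drift of the node during that leg. *)
Definition row (u : node -> F) (j : node) : F :=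
  match j with
  | inl (Some None) => u clock1 + (1 + al) * u clock2 + u fuse
  | inl (Some (Some false)) => u clock2 + (1 + al) * u clock3 + u fuse
  | inl (Some (Some true)) => u clock3 + (1 + al) * u clock1 + u fuse
  | inl None => u fuse + (1 + kp C) * u clock2 + u clock3 + kr C * u (gate jy)
  | inr (inl j) => u (gate j) + u (shadow j) - u (buffer j)
      - th * u clock1 + (c - g) * u clock2 + th * u clock3
  | inr (inr (inl j)) => u (shadow j) + u (gate j) - u (buffer j)
      - (mu + th) * u clock1 - g * u clock2 + (c + mu + th) * u clock3
  | inr (inr (inr i)) => u (buffer i) - al ^+ 3 * \sum_j Q i j * u (gate j)
      + (al ^+ 3 * th * \sum_j Q i j + a) * u clock1 - a' i * u clock2
      - th * u clock3
  end.

Definition reflection (j k : node) : F := row (unit_vec F k) j.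

Lemma row_linear b u v j : row (fun i => b * u i + v i) j = b * row u j + row v j.
Proof.
case: j => [[[[]|]|]|[j|[j|i]]] /=; try ring.
under eq_bigr do rewrite mulrDr mulrCA.
by rewrite big_split/= -mulr_sumr; ring.
Qed.

Lemma reflectionE u j : \sum_k reflection j k * u k = row u j.
Proof. by rewrite -(row_linearE (fun b u v => row_linear b u v j)). Qed.
End Network.

Lemma weighted_sum_bound (R : realFieldType) (J : finType) (Q : J -> J -> R) (q : R)
    (Qq : forall i, \sum_j `|Q i j| <= q) i (b : J -> R) (B : R) :
  (forall j, 0 <= b j) -> (forall j, b j <= B) ->
  0 <= B -> `|\sum_j Q i j * b j| <= q * B.
Proof.
move=> b0 bB B0; apply: le_trans (ler_norm_sum _ _ _) _.
apply: (@le_trans _ _ (\sum_j `|Q i j| * B)).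
  by apply: ler_sum => j _; rewrite normrM ler_wpM2l// ger0_norm.
by rewrite -mulr_suml ler_wpM2r.
Qed.

Definition update (F : realFieldType) (J : finType) (Q : J -> J -> F) (x : J -> F) (i : J) : F :=
  \sum_j Q i j * Num.min (x j) 1.

(** * The three legs of a turn *)

Section Legs.
Variables (R : realType) (J : finType) (jy : J) (Q : J -> J -> R) (C : constants J R).
Local Notation al := (kal C).
Local Notation th := (kth C).
Local Notation g := (kg C).
Local Notation c := (kc C).
Local Notation mu := (kmu C).
Local Notation a := (ka C).
Local Notation a' := (ka' C).
Local Notation kp := (kp C).
Local Notation kr := (kr C).
Local Notation M := (reflection jy Q C).
Local Notation bs := (bias (J := J) R).
Local Notation leg := (leg bs M).
Local Notation update := (update Q).

(** [q] bounds the absolute row sums of [Q], and [X] the data. After leg 2 all gates stand at [gp]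
    times the scale; [gam] is the same level in units of the next scale. Since [th = gam + 1], a
    gate that holds [gam + x] with [x <= 1] runs short by exactly [1 - x] in leg 1. *)
Record regime (q X gam gp : R) : Prop := Regime {
  rg_al_gt0 : 0 < al;
  rg_al_lt1 : al < 1;
  rg_q_ge0 : 0 <= q;
  rg_Qq : forall i, \sum_j `|Q i j| <= q;
  rg_X_ge1 : 1 <= X;
  rg_gp_gt0 : 0 < gp;
  rg_gamE : gam * al ^+ 3 = gp;
  rg_thE : th = gam + 1;
  rg_gE : g * al = X;
  rg_cE : c * al = gp + 1;
  rg_gc : g < c;
  rg_mu_gt0 : 0 < mu;
  rg_muE : (c + mu) * al ^+ 2 = gp + al ^+ 3 * (1 + mu);
  rg_aE : a = al ^+ 3 * th * (q + 1);
  rg_a'E : forall i, a' i * al = a + gp * \sum_j Q i j;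
  rg_alX : al * X <= th;
  rg_kr_gt0 : 0 < kr;
  rg_krth : kr * th < 1;
  rg_kp_ge0 : 0 <= kp;
  rg_kpE : kp * al = al ^+ 3 - kr / 2 * (1 + al ^+ 3) }.

Variables (q X gam gp : R).
Hypothesis HC : regime q X gam gp.
Let al_gt0 := rg_al_gt0 HC.
Let al_lt1 := rg_al_lt1 HC.
Let q_ge0 := rg_q_ge0 HC.
Let Qq := rg_Qq HC.
Let X_ge1 := rg_X_ge1 HC.
Let gp_gt0 := rg_gp_gt0 HC.
Let gamE := rg_gamE HC.
Let thE := rg_thE HC.
Let gE := rg_gE HC.
Let cE := rg_cE HC.
Let gc := rg_gc HC.
Let mu_gt0 := rg_mu_gt0 HC.
Let muE := rg_muE HC.
Let aE := rg_aE HC.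
Let a'E := rg_a'E HC.
Let alX := rg_alX HC.
Let kr_gt0 := rg_kr_gt0 HC.
Let krth := rg_krth HC.
Let kp_ge0 := rg_kp_ge0 HC.
Let kpE := rg_kpE HC.

Definition excess (x : R) : R := Num.max 0 (x - 1).

(* The state before each leg of a turn, at scale [h].  In leg 1, of length [h],
   gate [j] is pinned after time [h * (gam + x j) / th], so that its regulator
   ends at [h * (1 - min(x j, 1))]; the buffers collect these linearly.  In leg 2,
   of length [al * h], the shadows bring all gates to the same level.  In leg 3,
   of length [al ^+ 2 * h], the buffers are emptied into the gates. *)
Definition state1 (h : R) (x : J -> R) (j : node J) : R :=
  match j with
  | inl (Some None) => 0
  | inl (Some (Some false)) => h
  | inl (Some (Some true)) => 0
  | inl None => (1 - kr / 2) * h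
  | inr (inl j) => h * (gam + x j)
  | inr (inr (inl j)) => h * (gam + x j + 1 + mu)
  | inr (inr (inr _)) => 0
  end.

Definition state2 (h : R) (x : J -> R) (j : node J) : R :=
  match j with
  | inl (Some None) => 0
  | inl (Some (Some false)) => 0
  | inl (Some (Some true)) => al * h
  | inl None => kr / 2 * h
  | inr (inl j) => h * excess (x j)
  | inr (inr (inl j)) => h * (excess (x j) + 1)
  | inr (inr (inr i)) => h * (al ^+ 3 * (gam * \sum_j Q i j + update x i) + a)
  end.

Definition state3 (h : R) (x' : J -> R) (j : node J) : R :=
  match j with
  | inl (Some None) => al ^+ 2 * h
  | inl (Some (Some false)) => 0
  | inl (Some (Some true)) => 0
  | inl None => (1 - kr / 2) * al ^+ 3 * h
  | inr (inl _) => h * gp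
  | inr (inr (inl _)) => 0
  | inr (inr (inr i)) => h * al ^+ 3 * x' i
  end.

Lemma free_pathE x0 y j t :
  free_path bs M x0 y j t = x0 j + bs j * t + row jy Q C (y^~ t) j.
Proof. by rewrite /free_path reflectionE. Qed.

Lemma ramp_continuous (b d : R) : continuous (fun t : R => Num.max 0 (b * t - d)).
Proof.
move=> t; apply: (@continuous_max R R (cst 0) (fun t => b * t - d) t).
  exact: cvg_cst.
apply: cvgB; last exact: cvg_cst.
by apply: cvgM; [exact: cvg_cst|exact: cvg_id].
Qed.

Lemma ramp_nd (b d s t : R) : 0 <= b -> s <= t ->
  Num.max 0 (b * s - d) <= Num.max 0 (b * t - d).
Proof.
move=> b0 st; rewrite ge_max !le_max lexx /= lerD2r ler_wpM2l//.
by rewrite orbT.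
Qed.

Lemma sumQ0 i : \sum_j Q i j * 0 = 0.
Proof. by rewrite big1// => j _; rewrite mulr0. Qed.

Definition reg1 (h : R) (x : J -> R) (j : node J) (t : R) : R :=
  match j with
  | inl (Some None) => t
  | inr (inl j) => Num.max 0 (th * t - h * (gam + x j))
  | _ => 0
  end.

Definition reg2 (h : R) (x : J -> R) (j : node J) (t : R) : R :=
  match j with
  | inl (Some (Some false)) => t
  | inr (inr (inl j)) => Num.max 0 (g * t - h * (excess (x j) + 1))
  | _ => 0
  end.

Definition reg3 (h : R) (x' : J -> R) (j : node J) (t : R) : R :=
  match j with
  | inl (Some (Some true)) => t
  | inr (inr (inr i)) => Num.max 0 (th * t - h * al ^+ 3 * x' i)
  | _ => 0
  end.

Lemma gam_gt0 : 0 < gam.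
Proof. by rewrite -(pmulr_lgt0 _ (exprn_gt0 3 al_gt0)) gamE. Qed.

Lemma th_gt0 : 0 < th. Proof. by rewrite thE; have := gam_gt0; lra. Qed.

Lemma g_gt0 : 0 < g.
Proof. by rewrite -(pmulr_lgt0 g al_gt0) gE (lt_le_trans ltr01). Qed.

(** The duration [tau] is left open because the leg runs in full when the output is 0 and is stopped
    at the exhaustion of the fuse when the output is 1. *)
Lemma leg1 (h tau : R) (x : J -> R) : 0 < tau -> tau <= h ->
  (forall j, 0 <= x j) ->
  (forall t : R, 0 <= t -> t < tau -> 0 < (1 - kr / 2) * h - t + kr * reg1 h x (gate jy) t) ->
  0 <= (1 - kr / 2) * h - tau + kr * reg1 h x (gate jy) tau ->
  leg tau (state1 h x) (free_path bs M (state1 h x) (reg1 h x) ^~ tau) (reg1 h x).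
Proof.
move=> tau0 tauh x0 fuse_gt0 fuse_end; have th0 := th_gt0; have g0 := g_gt0.
have gam0 := gam_gt0; have h0 : 0 < h := lt_le_trans tau0 tauh.
have th0' := ltW th0; have al0' := ltW al_gt0.
have hg j : 0 < h * (gam + x j) by rewrite mulr_gt0// ltr_wpDr.
have hg' j := ltW (hg j).
set fp := free_path bs M (state1 h x) (reg1 h x).
have f1 t : fp (clock1 J) t = 0 by rewrite /fp free_pathE /=; ring.
have f2 t : fp (clock2 J) t = h - t by rewrite /fp free_pathE /=; ring.
have f3 t : fp (clock3 J) t = al * t by rewrite /fp free_pathE /=; ring.
have fY t : fp (fuse J) t = (1 - kr / 2) * h - t + kr * reg1 h x (gate jy) t.
  by rewrite /fp free_pathE /=; ring.
have ft j t : fp (gate j) t = h * (gam + x j) - th * t + reg1 h x (gate j) t.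
  by rewrite /fp free_pathE /=; ring.
have fk j t : fp (shadow j) t = h * (gam + x j + 1 + mu) - (mu + th) * t + reg1 h x (gate j) t.
  by rewrite /fp free_pathE /=; ring.
have fo i t : fp (buffer i) t =
    al ^+ 3 * \sum_j Q i j * (th * t - reg1 h x (gate j) t) + a * t.
  rewrite /fp free_pathE /=; under [in RHS]eq_bigr do rewrite mulrBr.
  by rewrite sumrB -mulr_suml; ring.
have gate_cases j t : (fp (gate j) t = 0 /\ h * (gam + x j) <= th * t) \/
    (reg1 h x (gate j) t = 0 /\ 0 < fp (gate j) t).
  by rewrite ft /=; case: (leP 0 (th * t - h * (gam + x j))) => hh; [left|right]; split; lra.
have gate_ge0 j t : 0 <= reg1 h x (gate j) t by rewrite /= le_max lexx.
have gate_le j t : 0 <= t -> reg1 h x (gate j) t <= th * t.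
  by move=> t0; rewrite /= ge_max mulr_ge0//= gerBl.
have fo_gt0 i t : 0 < t -> 0 < fp (buffer i) t.
  move=> t0; rewrite fo.
  have a3 : 0 < al ^+ 3 by rewrite exprn_gt0.
  have tt : 0 < th * t by rewrite mulr_gt0.
  (* The net outflow of a gate lies between 0 and [th t]; up to the factor [al ^+ 3], negative
     entries of [Q] cost at most [q th t], which [a] outweighs. *)
  have : `|\sum_j Q i j * (th * t - reg1 h x (gate j) t)| <= q * (th * t).
    apply: (weighted_sum_bound Qq) => [j|j|]; [|by rewrite gerBl|exact: ltW].
    by rewrite subr_ge0 gate_le// ltW.
  rewrite ler_norml => /andP[+ _]; set s := \sum_j _ => hs.
  have -> : al ^+ 3 * s + a * t = al ^+ 3 * (s + q * (th * t) + th * t).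
    by rewrite aE; ring.
  by rewrite mulr_gt0//; lra.
have fk_gt0 j t : 0 <= t -> t <= h -> 0 < fp (shadow j) t.
  move=> t0 tt; rewrite fk.
  have : th * t - h * (gam + x j) <= reg1 h x (gate j) t by rewrite /= le_max lexx orbT.
  have : mu * t <= mu * h by rewrite ler_wpM2l// ltW.
  by move=> *; lra.
split => //.
- move=> [[[[]|]|]|[j|[j|i]]] /=; try exact: cst_continuous.
    by move=> t; exact: cvg_id.
  exact: ramp_continuous.
- move=> [[[[]|]|]|[j|[j|i]]] //=.
  by rewrite mulr0 sub0r max_l// oppr_le0.
- by move=> [[[[]|]|]|[j|[j|i]]] s t s0 st tt //=; apply: ramp_nd => //; exact: ltW.
- move=> [[[[]|]|]|[j|[j|i]]] t t0 tt; rewrite -/(fp _ t).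
  + by rewrite -/(clock3 J) f3 mulr_ge0.
  + by rewrite -/(clock2 J) f2; lra.
  + by rewrite -/(clock1 J) f1.
  + rewrite -/(fuse J) fY; move: tt; rewrite le_eqVlt => /predU1P[->//|tt].
    exact/ltW/fuse_gt0.
  + by have [[-> _]|[_ /ltW]] := gate_cases j t.
  + by apply/ltW/fk_gt0 => //; exact: le_trans tauh.
  + move: t0; rewrite le_eqVlt => /predU1P[<-|/(fo_gt0 i)/ltW//].
    rewrite -/(buffer i) fo big1 ?mulr0 ?addr0// => j _.
    have -> : reg1 h x (gate j) 0 = 0 by rewrite /= mulr0 sub0r max_l// oppr_le0.
    by rewrite subrr mulr0.
- move=> [[[[]|]|]|[j|[j|i]]] t t0 tt; rewrite -/(fp _ t); try exact: mulr0.
    by rewrite -/(clock1 J) f1 mul0r.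
  by have [[-> _]|[-> _]] := gate_cases j t; rewrite ?mul0r ?mulr0.
- move=> t t0 tt.
  exists (fun j => match j with inl (Some None) => 0 | inl _ => 1 |
    inr (inl _) => 4 | inr (inr (inl _)) => 3 | _ => 2 end)%N.
  move=> j zj u low nz; rewrite reflectionE.
  have nY : u (fuse J) = 0 by apply: nz; rewrite -/(fp _ _) fY gt_eqF ?fuse_gt0.
  have n2 : u (clock2 J) = 0.
    by apply: nz; rewrite -/(fp _ _) f2 gt_eqF// subr_gt0; exact: lt_le_trans tauh.
  have low' k : (match k with inl (Some None) => 0 | inl _ => 1 |
    inr (inl _) => 4 | inr (inr (inl _)) => 3 | _ => 2 end <
    match j with inl (Some None) => 0 | inl _ => 1 |
    inr (inl _) => 4 | inr (inr (inl _)) => 3 | _ => 2 end)%N -> u k = 0.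
    by move=> kj; have [zk|zk] := eqVneq (fp k t) 0; [exact: low|exact: nz].
  move: j zj low' {low} => [[[[]|]|]|[j|[j|i]]] zj low' /=.
  + by rewrite nY (low' (clock1 J))//; ring.
  + by move: zj; rewrite -/(fp _ _) -/(clock2 J) f2 => ?; exfalso; lra.
  + by rewrite n2 nY; ring.
  + by move: zj; rewrite -/(fp _ _) -/(fuse J) fY => zj; have := fuse_gt0 t t0 tt; rewrite zj ltxx.
  + rewrite n2 (low' (clock1 J))// (low' (clock3 J))// (low' (shadow j))//.
    by rewrite (low' (buffer j))//; ring.
  + by have := fk_gt0 j t t0 (le_trans (ltW tt) tauh); rewrite /fp zj ltxx.
  (* A buffer vanishes only at time 0, when all gates are positive, so the gates of higher rank drop
     out of its row. *)
  + rewrite n2 (low' (clock1 J))// (low' (clock3 J))// big1 ?mulr0; first by ring.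
    move=> j _; rewrite nz ?mulr0// -/(fp _ _) gt_eqF//.
    have [[z1 z2]|[]//] := gate_cases j t; exfalso.
    move: t0 zj; rewrite le_eqVlt => /predU1P[t0|/(fo_gt0 i)]; last first.
      by rewrite /fp => + zj; rewrite zj ltxx.
    by move: z2; rewrite -t0 mulr0 leNgt hg.
Qed.

Lemma leg_ext tau x0 x1 x0' x1' y : leg tau x0 x1 y -> x0 =1 x0' -> x1 =1 x1' ->
  leg tau x0' x1' y.
Proof. by move=> Lg /funext <- /funext <-. Qed.

(** The regulator of the output gate is at least [th t - gam h = h - th (h - t)]. The fuse is
    therefore at least [(1 - kr th) (h - t) + kr h / 2], which is positive because [kr th < 1]. *)
Lemma leg1_low (h : R) (x : J -> R) : 0 < h -> (forall j, 0 <= x j) -> x jy = 0 ->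
  leg h (state1 h x) (state2 h x) (reg1 h x).
Proof.
move=> h0 x0 xjy; have gam0 := gam_gt0; have th0 := th_gt0.
have fuse_pos t : t <= h -> 0 < (1 - kr / 2) * h - t + kr * reg1 h x (gate jy) t.
  move=> th'.
  have h1 : 0 <= (h - t) * (1 - kr * th) by rewrite mulr_ge0// subr_ge0// ltW.
  have h2 : 0 < kr * h by rewrite mulr_gt0.
  have : kr * (th * t - h * (gam + x jy)) <= kr * reg1 h x (gate jy) t.
    by rewrite ler_wpM2l ?(ltW kr_gt0)//= le_max lexx orbT.
  by move: h1; rewrite xjy thE; lra.
have regh j : reg1 h x (gate j) h = h * (1 - Num.min (x j) 1).
  rewrite /= thE; have -> : (gam + 1) * h - h * (gam + x j) = h * (1 - x j) by ring.
  rewrite -[X in Num.max X _](mulr0 h) -maxr_pMr ?(ltW h0)//; congr (_ * _).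
  by case: (leP (x j) 1) => ?; [rewrite max_r// subr_ge0|rewrite subrr max_l// subr_le0 ltW].
have exE j : excess (x j) = x j - Num.min (x j) 1.
  by rewrite /excess; case: (leP (x j) 1) => ?; [rewrite max_l ?subrr// subr_le0|rewrite max_r// subr_ge0 ltW].
apply: (leg_ext (leg1 h0 (lexx h) x0 _ _)) => //.
- by move=> t _ /ltW; exact: fuse_pos.
- exact/ltW/fuse_pos.
- move=> [[[[]|]|]|[j|[j|i]]] /=; rewrite free_pathE; [rewrite /=; ring|rewrite /=; ring|rewrite /=; ring|..].
  + have := regh jy; rewrite /= => ->; rewrite xjy min_l//; by field.
  + have := regh j; rewrite /= => ->; rewrite exE thE; ring.
  + have := regh j; rewrite /= => ->; rewrite exE thE; ring.
  + rewrite /=; under eq_bigr => j _ do rewrite [Num.max _ _](regh j) mulrCA mulrBr mulr1.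
    by rewrite -mulr_sumr sumrB /update thE; ring.
Qed.

(** A gate and its shadow receive the same regulator, so their difference evolves freely, from [- h]
    at rate [c]. Once the shadow is pinned at 0 the gate equals this difference and ends at [gp h]
    whatever [x] was; [x <= X] ensures that every shadow reaches 0 in time. *)
Lemma leg2 (h : R) (x : J -> R) : 0 < h -> (forall j, 0 <= x j) ->
  (forall j, x j <= X) -> (forall i, 0 <= update x i) ->
  leg (al * h) (state2 h x) (state3 h (update x)) (reg2 h x).
Proof.
move=> h0 x0 xX x'0; have th0 := th_gt0; have g0 := g_gt0; have gam0 := gam_gt0.
have al0' := ltW al_gt0.
set fp := free_path bs M (state2 h x) (reg2 h x).
have ex0 j : 0 <= excess (x j) by rewrite /excess le_max lexx.
have exX j : excess (x j) + 1 <= X.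
  by rewrite -lerBrDr /excess ge_max subr_ge0 X_ge1 lerD2r xX.
have hX j : 0 < h * (excess (x j) + 1) by rewrite mulr_gt0// ltr_wpDl.
have hx0 j : 0 <= h * excess (x j) by rewrite mulr_ge0// ltW.
have f1 t : fp (clock1 J) t = al * t by rewrite /fp free_pathE /=; ring.
have f2 t : fp (clock2 J) t = 0 by rewrite /fp free_pathE /=; ring.
have f3 t : fp (clock3 J) t = al * h - t by rewrite /fp free_pathE /=; ring.
have fY t : fp (fuse J) t = kr / 2 * h + kp * t by rewrite /fp free_pathE /=; ring.
have ft j t : fp (gate j) t = h * excess (x j) + (c - g) * t + reg2 h x (shadow j) t.
  by rewrite /fp free_pathE /=; ring.
have fk j t : fp (shadow j) t = h * (excess (x j) + 1) - g * t + reg2 h x (shadow j) t.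
  by rewrite /fp free_pathE /=; ring.
have fo i t : fp (buffer i) t = h * al ^+ 3 * update x i + a' i * (al * h - t).
  have -> : a' i * (al * h - t) = a' i * al * h - a' i * t by ring.
  by rewrite /fp free_pathE /= sumQ0 a'E -gamE; ring.
have a'0 i : 0 < a' i.
  rewrite -(pmulr_lgt0 _ al_gt0) a'E aE.
  have : `|\sum_j Q i j * 1| <= q * 1 by apply: (weighted_sum_bound Qq).
  have -> : \sum_j Q i j * 1 = \sum_j Q i j by apply: eq_bigr => j _; rewrite mulr1.
  rewrite mulr1 ler_norml => /andP[hQ _].
  have a3 : 0 < al ^+ 3 by rewrite exprn_gt0.
  have -> : al ^+ 3 * th * (q + 1) + gp * \sum_j Q i j =
    al ^+ 3 * (q + 1) + gp * (q + \sum_j Q i j) + gp by rewrite -gamE thE; ring.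
  have h1 : 0 <= gp * (q + \sum_j Q i j) by rewrite mulr_ge0 ?(ltW gp_gt0)// -lerBlDl sub0r.
  have h2 : 0 <= al ^+ 3 * (q + 1) by rewrite mulr_ge0 ?(ltW a3)// addr_ge0.
  by move: gp_gt0; lra.
have reg0 j t : 0 <= reg2 h x (shadow j) t by rewrite /= le_max lexx.
have sh_cases j t : (fp (shadow j) t = 0 /\ h * (excess (x j) + 1) <= g * t) \/
    (reg2 h x (shadow j) t = 0 /\ 0 < fp (shadow j) t).
  by rewrite fk /=; case: (leP 0 (g * t - h * (excess (x j) + 1))) => ?; [left|right]; split; lra.
have cg0 t : 0 <= t -> 0 <= (c - g) * t by move=> t0; rewrite mulr_ge0// subr_ge0 ltW.
have fY_gt0 t : 0 <= t -> 0 < fp (fuse J) t.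
  by move=> t0; rewrite fY ltr_wpDr ?mulr_ge0// mulr_gt0// divr_gt0.
have fo_ge0 i t : t <= al * h -> 0 <= fp (buffer i) t.
  move=> tt; rewrite fo addr_ge0// ?mulr_ge0// ?subr_ge0 ?(ltW (a'0 i))// ?exprn_ge0//.
  exact: ltW.
have fo_gt0 i t : t < al * h -> 0 < fp (buffer i) t.
  move=> tt; rewrite fo ltr_wpDl ?mulr_gt0 ?subr_gt0//.
  by rewrite !mulr_ge0// ?exprn_ge0// ltW.
have f_end j : fp j (al * h) = state3 h (update x) j.
  move: j => [[[[]|]|]|[j|[j|i]]] /=.
  - by rewrite f3 subrr.
  - by rewrite f2.
  - by rewrite f1; ring.
  - rewrite fY mulrA kpE; ring.
  - rewrite ft /= max_r; last first.
      by rewrite subr_ge0 mulrA gE mulrC ler_wpM2r// ltW.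
    have -> : (c - g) * (al * h) = (gp + 1 - X) * h by rewrite -cE -gE; ring.
    by rewrite mulrA gE; ring.
  - rewrite fk /= max_r; last first.
      by rewrite subr_ge0 mulrA gE mulrC ler_wpM2r// ltW.
    ring.
  - by rewrite fo subrr; ring.
split => //.
- by rewrite mulr_gt0.
- move=> [[[[]|]|]|[j|[j|i]]] /=; try exact: cst_continuous.
    by move=> t; exact: cvg_id.
  exact: ramp_continuous.
- move=> [[[[]|]|]|[j|[j|i]]] //=.
  by rewrite mulr0 sub0r max_l// oppr_le0 ltW.
- by move=> [[[[]|]|]|[j|[j|i]]] s t s0 st tt //=; apply: ramp_nd => //; exact: ltW.
- move=> [[[[]|]|]|[j|[j|i]]] t t0 tt; rewrite -/(fp _ t).
  + by rewrite -/(clock3 J) f3 subr_ge0.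
  + by rewrite -/(clock2 J) f2.
  + by rewrite -/(clock1 J) f1 mulr_ge0.
  + exact/ltW/fY_gt0.
  + by rewrite -/(gate j) ft !addr_ge0// cg0.
  + by have [[-> _]|[_ /ltW]] := sh_cases j t.
  + exact: fo_ge0.
- move=> [[[[]|]|]|[j|[j|i]]] t t0 tt; rewrite -/(fp _ t); try exact: mulr0.
    by rewrite -/(clock2 J) f2 mul0r.
  by have [[-> _]|[-> _]] := sh_cases j t; rewrite ?mul0r ?mulr0.
- move=> t t0 tt.
  exists (fun j => match j with inl (Some (Some false)) => 0 | inl _ => 1 |
    inr (inl _) => 4 | inr (inr (inl _)) => 3 | _ => 2 end)%N.
  move=> j zj u low nz; rewrite reflectionE.
  have nY : u (fuse J) = 0 by apply: nz; rewrite -/(fp _ _) gt_eqF ?fY_gt0.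
  have n3 : u (clock3 J) = 0 by apply: nz; rewrite -/(fp _ _) f3 gt_eqF// subr_gt0.
  have nb i : u (buffer i) = 0 by apply: nz; rewrite -/(fp _ _) gt_eqF// fo_gt0.
  have low' k : (match k with inl (Some (Some false)) => 0 | inl _ => 1 |
    inr (inl _) => 4 | inr (inr (inl _)) => 3 | _ => 2 end <
    match j with inl (Some (Some false)) => 0 | inl _ => 1 |
    inr (inl _) => 4 | inr (inr (inl _)) => 3 | _ => 2 end)%N -> u k = 0.
    by move=> kj; have [zk|zk] := eqVneq (fp k t) 0; [exact: low|exact: nz].
  move: j zj low' {low} => [[[[]|]|]|[j|[j|i]]] zj low' /=.
  + by move: zj; rewrite -/(fp _ _) -/(clock3 J) f3 => ?; exfalso; lra.
  + by rewrite n3 nY; ring.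
  + by rewrite nY (low' (clock2 J))//; ring.
  + by have := fY_gt0 t t0; rewrite /fp zj ltxx.
  + rewrite n3 nb (low' (clock1 J))// (low' (clock2 J))// (low' (shadow j))//; ring.
  + rewrite n3 nb (low' (clock1 J))// (low' (clock2 J))//.
    (* A shadow is pinned only at a positive time, when its gate has already risen because
       [c > g]. *)
    rewrite (nz (gate j)); first by ring.
    rewrite -/(fp _ _) gt_eqF// ft; have [[_ h1]|[_]] := sh_cases j t; last by rewrite /fp zj ltxx.
    have t1 : 0 < t.
      rewrite lt_neqAle t0 andbT eq_sym; apply/eqP => t0'; move: h1.
      by rewrite t0' mulr0 leNgt hX.
    have : 0 < (c - g) * t by rewrite mulr_gt0// subr_gt0.
    by have := hx0 j; have := reg0 j t; lra.
  + by have := fo_gt0 i t tt; rewrite /fp zj ltxx.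
Qed.

(** The buffer regulator enters its gate and shadow with coefficient -1, so beyond their other
    drifts both gain exactly what leaves the buffer. The bound [al X <= th] leaves enough time to
    empty it. *)
Lemma leg3 (h : R) (x : J -> R) : 0 < h -> (forall j, 0 <= x j) -> (forall j, x j <= X) ->
  leg (al ^+ 2 * h) (state3 h x) (state1 (al ^+ 3 * h) x) (reg3 h x).
Proof.
move=> h0 x0 xX; have th0 := th_gt0; have g0 := g_gt0; have gam0 := gam_gt0.
have al0' := ltW al_gt0; have h0' := ltW h0.
have a2 : 0 < al ^+ 2 by rewrite exprn_gt0.
have a3 : 0 < al ^+ 3 by rewrite exprn_gt0.
have a2h : 0 < al ^+ 2 * h by rewrite mulr_gt0.
set fp := free_path bs M (state3 h x) (reg3 h x).
have hx i : 0 <= h * al ^+ 3 * x i by rewrite !mulr_ge0// ltW.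
have f1 t : fp (clock1 J) t = al ^+ 2 * h - t by rewrite /fp free_pathE /=; ring.
have f2 t : fp (clock2 J) t = al * t by rewrite /fp free_pathE /=; ring.
have f3 t : fp (clock3 J) t = 0 by rewrite /fp free_pathE /=; ring.
have fY t : fp (fuse J) t = (1 - kr / 2) * al ^+ 3 * h by rewrite /fp free_pathE /=; ring.
have ft j t : fp (gate j) t = h * gp + (th * t - reg3 h x (buffer j) t).
  by rewrite /fp free_pathE /=; ring.
have fk j t : fp (shadow j) t = (c + mu) * t + (th * t - reg3 h x (buffer j) t).
  by rewrite /fp free_pathE /=; ring.
have fo i t : fp (buffer i) t = h * al ^+ 3 * x i - th * t + reg3 h x (buffer i) t.
  by rewrite /fp free_pathE /= sumQ0; ring.
have reg_le j t : 0 <= t -> reg3 h x (buffer j) t <= th * t.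
  by move=> t0; rewrite /= ge_max gerBl hx mulr_ge0// ltW.
have o_cases i t : fp (buffer i) t = 0 \/
    (reg3 h x (buffer i) t = 0 /\ 0 < fp (buffer i) t).
  by rewrite fo /=; case: (leP 0 (th * t - h * al ^+ 3 * x i)) => ?; [left|right; split]; lra.
have kr2 : 0 < 1 - kr / 2.
  have : kr * 1 <= kr * th by rewrite ler_pM2l// thE; lra.
  by move: krth; lra.
have fY_gt0 t : 0 < fp (fuse J) t by rewrite fY !mulr_gt0.
have ft_gt0 j t : 0 <= t -> 0 < fp (gate j) t.
  by move=> t0; rewrite ft ltr_wpDr ?subr_ge0 ?reg_le// mulr_gt0.
have cmu : 0 < c + mu by rewrite addr_gt0// (lt_trans g0).
have f_end j : fp j (al ^+ 2 * h) = state1 (al ^+ 3 * h) x j.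
  have regE i : reg3 h x (buffer i) (al ^+ 2 * h) = th * (al ^+ 2 * h) - h * al ^+ 3 * x i.
    rewrite /= max_r// subr_ge0.
    have -> : h * al ^+ 3 * x i = al * x i * (al ^+ 2 * h) by ring.
    by rewrite ler_pM2r// (le_trans _ alX)// ler_wpM2l.
  move: j => [[[[]|]|]|[j|[j|i]]] /=.
  - by rewrite f3.
  - by rewrite f2; ring.
  - by rewrite f1 subrr.
  - by rewrite fY; ring.
  - by rewrite ft regE -gamE; ring.
  - by rewrite fk regE mulrA muE -gamE; ring.
  - by rewrite fo regE; ring.
split => //.
- move=> [[[[]|]|]|[j|[j|i]]] /=; try exact: cst_continuous.
    by move=> t; exact: cvg_id.
  exact: ramp_continuous.
- move=> [[[[]|]|]|[j|[j|i]]] //=.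
  by rewrite mulr0 sub0r max_l// oppr_le0.
- by move=> [[[[]|]|]|[j|[j|i]]] s t s0 st tt //=; apply: ramp_nd => //; exact: ltW.
- move=> [[[[]|]|]|[j|[j|i]]] t t0 tt; rewrite -/(fp _ t).
  + by rewrite -/(clock3 J) f3.
  + by rewrite -/(clock2 J) f2 mulr_ge0.
  + by rewrite -/(clock1 J) f1 subr_ge0.
  + exact/ltW/fY_gt0.
  + exact/ltW/ft_gt0.
  + by rewrite -/(shadow j) fk addr_ge0 ?mulr_ge0 ?subr_ge0 ?reg_le// ltW.
  + by have [->|[_ /ltW]] := o_cases i t.
- move=> [[[[]|]|]|[j|[j|i]]] t t0 tt; rewrite -/(fp _ t); try exact: mulr0.
    by rewrite -/(clock3 J) f3 mul0r.
  by have [->|[-> _]] := o_cases i t; rewrite ?mul0r ?mulr0.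
- move=> t t0 tt.
  exists (fun j => match j with inl (Some (Some true)) => 0 | inl _ => 1 |
    inr (inl _) => 4 | inr (inr (inl _)) => 3 | _ => 2 end)%N.
  move=> j zj u low nz; rewrite reflectionE.
  have nY : u (fuse J) = 0 by apply: nz; rewrite -/(fp _ _) gt_eqF ?fY_gt0.
  have n1 : u (clock1 J) = 0 by apply: nz; rewrite -/(fp _ _) f1 gt_eqF// subr_gt0.
  have nt j' : u (gate j') = 0 by apply: nz; rewrite -/(fp _ _) gt_eqF// ft_gt0.
  have low' k : (match k with inl (Some (Some true)) => 0 | inl _ => 1 |
    inr (inl _) => 4 | inr (inr (inl _)) => 3 | _ => 2 end <
    match j with inl (Some (Some true)) => 0 | inl _ => 1 |
    inr (inl _) => 4 | inr (inr (inl _)) => 3 | _ => 2 end)%N -> u k = 0.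
    by move=> kj; have [zk|zk] := eqVneq (fp k t) 0; [exact: low|exact: nz].
  move: j zj low' {low} => [[[[]|]|]|[j|[j|i]]] zj low' /=.
  + by rewrite n1 nY; ring.
  + by rewrite nY (low' (clock3 J))//; ring.
  + by move: zj; rewrite -/(fp _ _) -/(clock1 J) f1 => ?; exfalso; lra.
  + by have := fY_gt0 t; rewrite /fp zj ltxx.
  + by have := ft_gt0 j t t0; rewrite /fp zj ltxx.
  + rewrite n1 nt (low' (clock3 J))// (low' (clock2 J))// (low' (buffer j))//; ring.
  + rewrite n1 (low' (clock3 J))// (low' (clock2 J))// big1; first by ring.
    by move=> j _; rewrite nt mulr0.
Qed.
End Legs.

(** * Whole turns, silent runs and runs with output 1 *)

Section Cycles.
Variables (R : realType) (J : finType) (jy : J) (Q : J -> J -> R) (C : constants J R).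
Local Notation al := (kal C).
Local Notation kr := (kr C).
Local Notation M := (reflection jy Q C).
Local Notation bs := (bias (J := J) R).
Variables (q X gam gp : R).
Hypothesis HC : regime Q C q X gam gp.
Local Notation update := (update Q).
Local Notation state1 := (state1 C gam).
Local Notation state2 := (state2 Q C gam).
Local Notation state3 := (state3 C gp).

(** The turn is cut before leg 3, where the data sit in the buffers alone and all gates are level: a
    load is then a single entry of the state. *)
Lemma cycle_passes h x : 0 < h -> (forall j, 0 <= x j) -> (forall j, x j <= X) ->
  x jy = 0 -> (forall j, 0 <= update x j) ->
  passes bs M (al ^+ 2 * h + (al ^+ 3 * h + al * (al ^+ 3 * h)))
    (state3 h x) (state3 (al ^+ 3 * h) (update x)).
Proof.
move=> h0 x0 xX xjy ux0; have al0 := rg_al_gt0 HC.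
have h3 : 0 < al ^+ 3 * h by rewrite mulr_gt0// exprn_gt0.
apply: passes_trans; first exact: (leg_passes (leg3 jy HC h0 x0 xX)).
apply: passes_trans; first exact: (leg_passes (leg1_low HC h3 x0 xjy)).
exact: (leg_passes (leg2 jy HC h3 x0 xX ux0)).
Qed.

Lemma silent_run_dies h (x : nat -> J -> R) : 0 < h ->
  (forall n j, 0 <= x n j) -> (forall n j, x n j <= X) -> (forall n, x n jy = 0) ->
  (forall n j, x n.+1 j = update (x n) j) ->
  dies bs M (fun=> 0) -> dies bs M (state3 h (x 0%N)).
Proof.
move=> h0 x0 xX xjy ux d0.
have al0 := rg_al_gt0 HC; have al1 := rg_al_lt1 HC.
pose r := al ^+ 3.
have r0 : 0 < r by rewrite exprn_gt0.
have r1 : `|r| < 1 by rewrite gtr0_norm// exprn_ilt1// ltW.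
have {}ux n : x n.+1 = update (x n) by apply: funext => j; rewrite ux.
pose s n := state3 (r ^+ n * h) (x n).
have -> : state3 h (x 0%N) = s 0%N by rewrite /s expr0 mul1r.
pose b := al ^+ 2 * h + (al ^+ 3 * h + al * (al ^+ 3 * h)).
apply: (zeno_dies (tau := fun n => b * r ^+ n) (T := b * (1 - r)^-1)) => //.
- move=> n; rewrite /s exprS ux.
  have -> : b * r ^+ n = al ^+ 2 * (r ^+ n * h) +
      (al ^+ 3 * (r ^+ n * h) + al * (al ^+ 3 * (r ^+ n * h))) by rewrite /b; ring.
  rewrite -mulrA; apply: cycle_passes => //.
    by rewrite mulr_gt0// exprn_gt0.
  by move=> j; rewrite -ux.
- have := @cvg_geometric_series R b r r1.
  by rewrite /series/=; under eq_fun do rewrite big_mkord.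
- move=> j.
  pose B := state3 h (fun=> X) j.
  have X0 : 0 <= X := le_trans (x0 0%N jy) (xX 0%N jy).
  apply: (@squeeze_cvgr nat \oo _ R (cst 0) (geometric B r) (fun n => s n j)).
  + near=> n.
    have rn : 0 <= r ^+ n by rewrite exprn_ge0// ltW.
    have h0' := ltW h0; have al0' := ltW al0; have gp0 := ltW (rg_gp_gt0 HC).
    have kr2 : 0 <= 1 - kr / 2.
      have := rg_krth HC; have := rg_kr_gt0 HC; have := th_gt0 HC; rewrite (rg_thE HC) => t1 t2 t3.
      have : kr * 1 <= kr * (gam + 1) by rewrite ler_pM2l// -subr_ge0; have := gam_gt0 HC; lra.
      by lra.
    rewrite /cst /s /B; clear B; case: j => [[[[]|]|]|[j|[j|i]]] /=; apply/andP; split; rewrite ?mul0r ?mulr0//;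
      rewrite ?mulr_ge0 ?exprn_ge0//.
    * by rewrite le_eqVlt; apply/orP; left; apply/eqP; ring.
    * by rewrite le_eqVlt; apply/orP; left; apply/eqP; ring.
    * by rewrite le_eqVlt; apply/orP; left; apply/eqP; ring.
    * have -> : r ^+ n * h * al ^+ 3 * x n i = h * al ^+ 3 * x n i * r ^+ n by ring.
      by rewrite ler_wpM2r// ler_wpM2l// mulr_ge0// exprn_ge0.
  + exact: cvg_cst.
  + exact: cvg_geometric.
Unshelve. all: by end_near. Qed.

(** The fuse regulator has coefficient 1 in the four rows with drift -1 and 0 in all others, so at
    unit rate it cancels the drift and nothing moves. *)
Lemma frozen_escapes (x : node J -> R) j : (forall j, 0 <= x j) -> x (fuse J) = 0 ->
  x j != 0 -> escapes bs M x.
Proof.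
move=> x0 xf xj.
exists (fun j t => if j is inl None then t else 0), (fun j _ => x j).
split; last by exists j, (x j), 0.
split => //.
- by move=> [[[[]|]|]|[k|[k|k]]] t; first [exact: cvg_id|exact: cvg_cst].
- by move=> k t; exact: cvg_cst.
- move=> k t t0; rewrite reflectionE.
  move: k => [[[[]|]|]|[k|[k|k]]] /=; rewrite ?xf; try ring.
  by rewrite big1 => [|? _]; [ring|rewrite mulr0].
- by move=> [[[[]|]|]|[k|[k|k]]].
- by move=> [[[[]|]|]|[k|[k|k]]] s t _ st.
- move=> [[[[]|]|]|[k|[k|k]]] s t s0 st pos //.
  by have := pos s (lexx _) st; rewrite xf ltxx.
Qed.

(** At output 1 and scale [h'] the output gate holds [th h'], enough for the whole leg 1, so nothing
    feeds the fuse. It is empty at time [(1 - kr / 2) h'], while [clock2] is still positive. *)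
Lemma loud_cycle_escapes h x : 0 < h -> (forall j, 0 <= x j) -> (forall j, x j <= X) ->
  x jy = 1 -> escapes bs M (state3 h x).
Proof.
move=> h0 x0 xX xjy; have al0 := rg_al_gt0 HC.
have h3 : 0 < al ^+ 3 * h by rewrite mulr_gt0// exprn_gt0.
apply: leg_escapes (leg3 jy HC h0 x0 xX) _.
set h' := al ^+ 3 * h in h3 *.
have th1 : 1 < kth C by rewrite (rg_thE HC) ltrDr (gam_gt0 HC).
have kr2 : kr < 1.
  apply: le_lt_trans (rg_krth HC).
  by rewrite -[X in X <= _]mulr1 ler_pM2l ?(rg_kr_gt0 HC)// ltW.
have kr0 := rg_kr_gt0 HC.
have tau0 : 0 < (1 - kr / 2) * h' by rewrite mulr_gt0//; lra.
have tauh : (1 - kr / 2) * h' < h'.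
  by rewrite gtr_pMl//; lra.
have reg0 t : t <= h' -> reg1 C gam h' x (gate jy) t = 0.
  move=> th'; rewrite /= xjy -(rg_thE HC) max_l// subr_le0 mulrC ler_wpM2r//.
  exact: ltW (th_gt0 HC).
have Lg := @leg1 _ _ jy _ _ _ _ _ _ HC h' _ x tau0 (ltW tauh) x0.
apply: leg_escapes (Lg _ _) _.
- move=> t t0 tt; rewrite reg0 ?mulr0 ?addr0 ?subr_gt0//.
  exact: ltW (lt_trans tt tauh).
- by rewrite reg0 ?mulr0 ?addr0 ?subrr// ltW.
apply: (@frozen_escapes _ (clock2 J)).
- move=> j; apply: (leg_ge0 (Lg _ _)) => //; last exact: ltW.
  + move=> t t0 tt; rewrite reg0 ?mulr0 ?addr0 ?subr_gt0//.
    exact: ltW (lt_trans tt tauh).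
  + by rewrite reg0 ?mulr0 ?addr0 ?subrr// ltW.
- rewrite free_pathE /=; have := reg0 _ (ltW tauh); rewrite /= => ->; ring.
- by rewrite free_pathE /= gt_eqF//; move: tauh; lra.
Qed.

Lemma loud_run_escapes h (x : nat -> J -> R) N : 0 < h ->
  (forall n j, 0 <= x n j) -> (forall n j, x n j <= X) ->
  (forall n, (n < N)%N -> x n jy = 0) -> x N jy = 1 ->
  (forall n j, x n.+1 j = update (x n) j) ->
  escapes bs M (state3 h (x 0%N)).
Proof.
elim: N h x => [|N IH] h x h0 x0 xX xjy xN ux; first exact: loud_cycle_escapes.
have al0 := rg_al_gt0 HC.
have h3 : 0 < al ^+ 3 * h by rewrite mulr_gt0// exprn_gt0.
have uxE : x 1%N = update (x 0%N) by apply: funext => j; rewrite ux.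
apply: leg_escapes (leg3 jy HC h0 (x0 0%N) (xX 0%N)) _.
apply: leg_escapes (leg1_low HC h3 (x0 0%N) (xjy 0%N _)) _ => //.
apply: leg_escapes (leg2 jy HC h3 (x0 0%N) (xX 0%N) _) _.
  by move=> j; rewrite -uxE.
rewrite -uxE; apply: (IH _ (fun n => x n.+1)) => // n nN; exact: xjy.
Qed.
End Cycles.

(** * The state 0 is absorbing *)

Section Spans.
Variables (R : realType) (N : finType) (th : N -> R) (M : N -> N -> R).
Variables (x0 : N -> R) (y z : N -> R -> R).
Hypothesis S : solution th M x0 y z.

(** A regulator rests before the first and after the last zero of its node in the interval. Its
    increments can thus be estimated between two times where the node is 0, where the equation of
    the node gives them explicitly. *)
Lemma regulator_span j s t : 0 <= s -> s <= t -> y j s = y j t \/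
  exists r r', [/\ s <= r, r <= r', r' <= t, z j r = 0 & z j r' = 0 /\
    y j t - y j s = y j r' - y j r].
Proof.
move=> s0 st.
have z0 r : s <= r -> z j r <= 0 -> z j r = 0.
  by move=> sr zr; apply/eqP; rewrite eq_le zr (sol_z_ge0 S)// (le_trans s0).
have [|nz] := pselect (forall r, s <= r -> r <= t -> 0 < z j r).
  by left; apply: (sol_cp S).
have [p [sp pt zp]] : exists p, [/\ s <= p, p <= t & z j p <= 0].
  apply/not_existsP => h; apply: nz => r sr rt.
  by rewrite ltNge; apply/negP => zr; apply: (h r).
have [r [sr rp zr rpos]] := first_le0 (sol_zc S j) sp zp.
have [r' [pr' r't zr' r'pos]] := last_le0 (sol_zc S j) pt zp.
right; exists r, r'; split=> //; [exact: le_trans pr'|exact: z0|].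
split; first by apply: z0 => //; exact: le_trans pr'.
congr (_ - _).
  by apply/esym/(sol_cp_open S) => //; apply: le_trans s0 (le_trans sp pr').
move: sr; rewrite le_eqVlt => /predU1P[->//|sr].
(* left-open on the other side: approach [r] from below *)
have cf : continuous (fun q => y j (- q)).
  by move=> q; apply: continuous_comp; [exact: opp_continuous|exact: (sol_yc S)].
have sr' : - r < - s by rewrite ltrN2.
have h v : - r < v -> v <= - s -> y j (- v) = y j (- - s).
  move=> rv vs; rewrite opprK; apply/esym; apply: (sol_cp S) => [//||p' h1 h2].
    by rewrite lerNr.
  by apply: rpos => //; apply: le_lt_trans h2 _; rewrite ltrNl.
by have := eq_left_limit cf sr' h; rewrite !opprK.
Qed.

(** Only excursions matter: after the last zero the regulator rests, and it remains to see that the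
    node does not rise without it. *)
Lemma vanishes j : (forall s t, 0 <= s -> s < t -> z j s = 0 ->
    (forall r, s < r -> r <= t -> 0 < z j r) -> y j s = y j t -> z j t <= z j s) ->
  x0 j = 0 -> forall t, 0 <= t -> z j t = 0.
Proof.
move=> dec x0j t t0; have z0 r : 0 <= r -> z j r <= 0 -> z j r = 0.
  by move=> r0 zr; apply/eqP; rewrite eq_le zr (sol_z_ge0 S).
apply: (z0 _ t0).
have z00 : z j 0 <= 0 by rewrite (sol_init _ S) x0j.
have [s [s0 st zs pos]] := last_le0 (sol_zc S j) t0 z00.
have zs0 := z0 s s0 zs.
move: (st); rewrite le_eqVlt => /predU1P[<-|st']; first exact: zs.
by rewrite -zs0; apply: dec => //; exact: (sol_cp_open S s0 st).
Qed.
End Spans.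

(* At 0, the fuse regulator [y fz] is 1-Lipschitz, so the clock sees the time
   [tau t = t - y fz t], and the sum of the clock nodes cannot grow.  Hence all
   clock regulators agree, gates and shadows agree, and a bound [E] on the slope
   of the gate regulators improves to a smaller one through the buffers. *)
Section Origin.
Variables (R : realType) (J : finType) (jy : J) (Q : J -> J -> R) (C : constants J R).
Local Notation al := (kal C).
Local Notation th := (kth C).
Local Notation M := (reflection jy Q C).
Local Notation bs := (bias (J := J) R).

Record calm (q : R) : Prop := Calm {
  cm_al : 0 < al < 1;
  cm_q : forall i, \sum_j `|Q i j| <= q;
  cm_alq : al ^+ 3 * q <= 16^-1;
  cm_th : 0 < th;
  cm_a'a : forall i, ka' C i - ka C - al ^+ 3 * th * \sum_j Q i j <= th / 4;
  cm_aa' : forall i, ka C - ka' C i <= th / 4;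
  cm_cg : 0 <= kc C - kg C <= th / 4;
  cm_kp : 0 <= kp C;
  cm_kr : 0 <= kr C;
  cm_fuse : kp C + 2 * kr C * th <= al }.

Variable q : R.
Hypothesis HC : calm q.
Variables y z : node J -> R -> R.
Hypothesis S : solution bs M (fun=> 0) y z.

Local Notation c1 := (clock1 J).
Local Notation c2 := (clock2 J).
Local Notation c3 := (clock3 J).
Local Notation fz := (fuse J).

Let tau t := t - y fz t.

Let zE j t : 0 <= t -> z j t = bs j * t + row jy Q C (y^~ t) j.
Proof. by move=> t0; rewrite (sol_eq S)// reflectionE add0r. Qed.

Let nd j s t : 0 <= s -> s <= t -> 0 <= y j t - y j s.
Proof. by move=> s0 st; rewrite subr_ge0 (sol_nd S). Qed.

(** Between two zeros of the fuse its drift -1 is balanced by its own regulator and nonnegative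
    terms from other nodes, so that regulator gains at most the elapsed time. *)
Lemma tau_nd s t : 0 <= s -> s <= t -> tau s <= tau t.
Proof.
move=> s0 st.
have kp0 := cm_kp HC; have kr0 := cm_kr HC.
suff : y fz t - y fz s <= t - s by rewrite /tau; lra.
have [->|[r [r' [sr rr' r't zr [zr' ->]]]]] := regulator_span S fz s0 st.
  by rewrite subrr subr_ge0.
have r0 := le_trans s0 sr; have r'0 := le_trans r0 rr'.
move: zr zr'; rewrite !zE//= => e1 e2.
have h1 := nd c2 r0 rr'; have h2 := nd c3 r0 rr'; have h3 := nd (gate jy) r0 rr'.
have h4 : 0 <= (1 + kp C) * (y c2 r' - y c2 r) by rewrite mulr_ge0// addr_ge0.
have h5 : 0 <= kr C * (y (gate jy) r' - y (gate jy) r) by rewrite mulr_ge0.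
by lra.
Qed.

Let z1E t : 0 <= t -> z c1 t = - tau t + y c1 t + (1 + al) * y c2 t.
Proof. by move=> t0; rewrite zE//= /tau; ring. Qed.
Let z2E t : 0 <= t -> z c2 t = - tau t + y c2 t + (1 + al) * y c3 t.
Proof. by move=> t0; rewrite zE//= /tau; ring. Qed.
Let z3E t : 0 <= t -> z c3 t = - tau t + y c3 t + (1 + al) * y c1 t.
Proof. by move=> t0; rewrite zE//= /tau; ring. Qed.

(** While [c] is positive its regulator rests, so [b] regulates at most the increment of [tau].
    Whatever [b] regulates also enters [a] with factor [1 + al], which lowers the need of [a] by at
    least as much. *)
Lemma clock_pair a b c r s :
  (forall t, 0 <= t -> z a t = - tau t + y a t + (1 + al) * y b t) ->
  (forall t, 0 <= t -> z b t = - tau t + y b t + (1 + al) * y c t) ->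
  0 <= r -> r <= s -> (forall t, r <= t -> t <= s -> 0 < z c t) ->
  y a s - y a r + (y b s - y b r) <= tau s - tau r /\ y c s = y c r.
Proof.
move=> za zb r0 rs zc.
have al0 : 0 < al by have /andP[] := cm_al HC.
have yc p : r <= p -> p <= s -> y c p = y c r.
  move=> rp ps; apply/esym; apply: (sol_cp S) => // t rt tp.
  by apply: zc => //; exact: le_trans ps.
have yb p p' : r <= p -> p <= p' -> p' <= s -> y b p' - y b p <= tau p' - tau p.
  move=> rp pp' p's; have p0 := le_trans r0 rp.
  have [->|[t [t' [pt tt' t'p zt [zt' ->]]]]] := regulator_span S b p0 pp'.
    by rewrite subrr subr_ge0 tau_nd.
  have t0 := le_trans p0 pt; have t'0 := le_trans t0 tt'.
  have rt := le_trans rp pt; have rt' := le_trans rt tt'.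
  have t's := le_trans t'p p's; have ts := le_trans tt' t's.
  move: zt zt'; rewrite !zb// !yc//.
  have := tau_nd p0 pt; have := tau_nd t'0 t'p; lra.
split; last by apply: yc.
have [->|[t [t' [rt tt' t's zt [zt' ->]]]]] := regulator_span S a r0 rs.
  by rewrite subrr add0r; exact: yb.
have t0 := le_trans r0 rt; have t'0 := le_trans t0 tt'.
move: zt zt'; rewrite !za// => e1 e2.
have h1 := yb r t (lexx _) rt (le_trans tt' t's).
have h2 := yb t' s (le_trans rt tt') t's (lexx _).
have h3 : 0 <= al * (y b t' - y b t) by rewrite mulr_ge0 ?(ltW al0)// nd.
by lra.
Qed.

(** As long as some clock is positive, [clock_pair] bounds the total regulation by the increment of
    [tau]. The sum of the clocks then changes by at most [(2 + al) - 3 < 0] times this increment. *)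
Lemma clock_still t : 0 <= t -> z c1 t + z c2 t + z c3 t <= 0.
Proof.
move=> t0; have /andP[al0 al1] := cm_al HC.
pose W s := z c1 s + z c2 s + z c3 s.
have cW : continuous W.
  by move=> s; apply: cvgD; [apply: cvgD|]; exact: (sol_zc S).
rewrite -/(W t) leNgt; apply/negP => Wt.
have W0 : W 0 <= 0 by rewrite /W !(sol_init _ S) !addr0.
have [s [s0 st Ws pos]] := last_le0 cW t0 W0.
have cg : continuous (fun r => W t - W r).
  by move=> r; apply: cvgB; [exact: cvg_cst|exact: cW].
have [|d d0 dpos] := @continuous_gt0_near _ _ s cg.
  by rewrite subr_gt0 (le_lt_trans Ws).
have {}st : s < t.
  rewrite lt_neqAle st andbT; apply/eqP => e; by move: Ws; rewrite leNgt e Wt.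
(* At [s'], just after the last zero of [W], the sum is still below [W t]; that it cannot grow from
   there on is the contradiction. *)
pose s' := Num.min t (s + d / 2).
have ss' : s < s' by rewrite lt_min st ltrDl divr_gt0.
have s't : s' <= t by rewrite ge_min lexx.
suff : W t <= W s'.
  rewrite leNgt -subr_gt0 dpos// gtr0_norm ?subr_gt0//.
  have hs : s' <= s + d / 2 by rewrite ge_min lexx orbT.
  by move: d0; lra.
apply: right_locally_nonincreasing => // r s'r rt.
have sr := lt_le_trans ss' s'r; have r0 := ltW (le_lt_trans s0 sr).
have Wr := pos r sr (ltW rt).
have [k [kc kpos]] : exists k, (k = c1 \/ k = c2 \/ k = c3) /\ 0 < z k r.
  have := sol_z_ge0 S c1 r0; have := sol_z_ge0 S c2 r0; have := sol_z_ge0 S c3 r0.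
  rewrite !le_eqVlt => /predU1P[e3|]; last by exists c3; split=> //; right; right.
  move=> /predU1P[e2|]; last by exists c2; split=> //; right; left.
  move=> /predU1P[e1|]; last by exists c1; split=> //; left.
  by exfalso; move: Wr; rewrite /W -e1 -e2 -e3 !addr0 ltxx.
have [e e0 epos] := continuous_gt0_near (sol_zc S k) kpos.
exists (e / 2); first by rewrite divr_gt0.
move=> p rp pe _; have p0 := le_trans r0 rp.
have zk p' : r <= p' -> p' <= p -> 0 < z k p'.
  by move=> h1 h2; apply: epos; rewrite ger0_norm ?subr_ge0//; lra.
have tt := tau_nd r0 rp.
have key (x : R) : x <= tau p - tau r -> (2 + al) * x <= 3 * (tau p - tau r).
  move=> xt; apply: (@le_trans _ _ ((2 + al) * (tau p - tau r))).
    by rewrite ler_pM2l//; lra.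
  by rewrite ler_wpM2r//; lra.
rewrite /W !z1E// !z2E// !z3E//.
case: kc => [kE|[kE|kE]]; rewrite kE in zk.
- have [/key h1 h2] := clock_pair z2E z3E r0 rp zk; rewrite h2; lra.
- have [/key h1 h2] := clock_pair z3E z1E r0 rp zk; rewrite h2; lra.
- have [/key h1 h2] := clock_pair z1E z2E r0 rp zk; rewrite h2; lra.
Qed.

Lemma clock_zero k t : 0 <= t -> k \in [:: c1; c2; c3] -> z k t = 0.
Proof.
move=> t0; have := clock_still t0.
have := sol_z_ge0 S c1 t0; have := sol_z_ge0 S c2 t0; have := sol_z_ge0 S c3 t0.
by rewrite !inE => h3 h2 h1 h /or3P[]/eqP ->; lra.
Qed.

(** With all clocks at 0 the rows form a cyclic system in [b = 1 + al]. It multiplies the difference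
    of two regulators by [1 - b + b ^+ 2], which is positive. *)
Lemma clock_rate t : 0 <= t ->
  [/\ y c2 t = y c1 t, y c3 t = y c1 t & tau t = (2 + al) * y c1 t].
Proof.
move=> t0; have /andP[al0 al1] := cm_al HC.
have := z1E t0; have := z2E t0; have := z3E t0.
rewrite !clock_zero ?inE ?eqxx ?orbT// => e3 e2 e1.
have b0 : 0 < 1 + al by lra.
set b := 1 + al in e1 e2 e3 b0.
have pos : 0 < 1 - b + b ^+ 2 by rewrite /b; nra.
have p0 : (y c1 t - y c2 t) * (1 - b + b ^+ 2) = 0.
  have h1 : y c3 t - y c1 t = - b * (y c1 t - y c2 t) by lra.
  have h2 : y c1 t - y c2 t = b * (y c3 t - y c2 t) by lra.
  have h3 : y c3 t - y c2 t = (1 - b) * (y c1 t - y c2 t) by lra.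
  by rewrite h3 in h2; rewrite mulrDr mulrBr mulr1 expr2; lra.
move/eqP: p0; rewrite mulf_eq0 (gt_eqF pos) orbF subr_eq0 => /eqP e12.
have e13 : y c3 t = y c1 t by move: e3 e1; rewrite -e12; lra.
by split; [rewrite e12|exact: e13|move: e1; rewrite -e12 /b; lra].
Qed.

Local Notation sg := (y c1).

Lemma gateE j t : 0 <= t -> z (gate j) t =
  y (gate j) t + y (shadow j) t - y (buffer j) t + (kc C - kg C) * sg t.
Proof.
move=> t0; rewrite zE//=; have [-> -> _] := clock_rate t0; ring.
Qed.

(** The two rows differ only in their clock coefficients, which have the same sum [c - g], and the
    clock regulators agree. *)
Lemma shadowE j t : 0 <= t -> z (shadow j) t = z (gate j) t.
Proof.
move=> t0; rewrite gateE// zE//=; have [-> -> _] := clock_rate t0; ring.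
Qed.

Lemma bufferE i t : 0 <= t -> z (buffer i) t =
  y (buffer i) t - al ^+ 3 * (\sum_j Q i j * y (gate j) t)
  - (th + (ka' C i - ka C - al ^+ 3 * th * \sum_j Q i j)) * sg t.
Proof.
move=> t0; rewrite zE//=; have [-> -> _] := clock_rate t0; ring.
Qed.

Lemma fuseE t : 0 <= t -> z fz t = (kp C - al) * sg t + kr C * y (gate jy) t.
Proof.
move=> t0; rewrite zE//=; have [-> -> +] := clock_rate t0; rewrite /tau => e.
have -> : y fz t = t - (2 + al) * sg t by rewrite -e; ring.
by ring.
Qed.

Lemma sumQ_diff i s t B : 0 <= s -> s <= t -> 0 <= B ->
  (forall j, y (gate j) t - y (gate j) s <= B) ->
  `|al ^+ 3 * (\sum_j Q i j * y (gate j) t) - al ^+ 3 * (\sum_j Q i j * y (gate j) s)|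
    <= 16^-1 * B.
Proof.
move=> s0 st B0 hB; have /andP[al0 _] := cm_al HC.
have a3 : 0 <= al ^+ 3 by rewrite exprn_ge0// ltW.
rewrite -mulrBr normrM ger0_norm// -sumrB.
under eq_bigr do rewrite -mulrBr.
apply: (@le_trans _ _ (al ^+ 3 * (q * B))); last first.
  by rewrite mulrA ler_wpM2r// cm_alq.
by rewrite ler_wpM2l//; apply: (weighted_sum_bound (cm_q HC)) => // j; exact: nd.
Qed.

(** Between zeros of a buffer, its regulator gains at most [5 th / 4] per unit of [sg] plus a
    sixteenth of the bound for the gates. Between zeros of a gate, its regulator gains at most what
    that of its buffer does. The round trip leaves [2 th] per unit of [sg] and at most a quarter of
    [E]. *)
Lemma gate_slope_step T E : 0 <= E ->
  (forall j s t, 0 <= s -> s <= t -> t <= T ->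
    y (gate j) t - y (gate j) s <= 2 * th * (sg t - sg s) + E) ->
  forall j s t, 0 <= s -> s <= t -> t <= T ->
    y (gate j) t - y (gate j) s <= 2 * th * (sg t - sg s) + E / 4.
Proof.
move=> E0 hE j s t s0 st tT; have th0 := cm_th HC; have cg := cm_cg HC.
have buf i s' t' : 0 <= s' -> s' <= t' -> t' <= T ->
    y (buffer i) t' - y (buffer i) s' <= 2 * th * (sg t' - sg s') + E / 4.
  move=> s'0 s't' t'T.
  have sgd := nd c1 s'0 s't'.
  have [->|[r [r' [sr rr' r't zr [zr' ->]]]]] := regulator_span S (buffer i) s'0 s't'.
    by rewrite subrr addr_ge0 ?divr_ge0// !mulr_ge0// ltW.
  have r0 := le_trans s'0 sr; have r'0 := le_trans r0 rr'.
  have h1 := nd c1 s'0 sr; have h2 := nd c1 r0 rr'; have h3 := nd c1 r'0 r't.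
  have B0 : 0 <= 2 * th * (sg r' - sg r) + E by rewrite addr_ge0// !mulr_ge0// ltW.
  have := sumQ_diff i r0 rr' B0 (fun j => hE j _ _ r0 rr' (le_trans r't t'T)).
  rewrite ler_norml => /andP[_ hs].
  move: zr zr'; rewrite !bufferE// => e1 e2.
  have ha := cm_a'a HC i.
  set d := ka' C i - ka C - al ^+ 3 * th * \sum_j Q i j in e1 e2 ha.
  have k1 : (th + d) * (sg r' - sg r) <= (th + th / 4) * (sg r' - sg r).
    by rewrite ler_wpM2r// lerD2l.
  have k2 : 0 <= th * (sg t' - sg r') by rewrite mulr_ge0// ltW.
  have k3 : 0 <= th * (sg r - sg s') by rewrite mulr_ge0// ltW.
  have k4 : 0 <= th * (sg r' - sg r) by rewrite mulr_ge0// ltW.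
  by lra.
have sgd := nd c1 s0 st.
have [->|[r [r' [sr rr' r't zr [zr' ->]]]]] := regulator_span S (gate j) s0 st.
  by rewrite subrr addr_ge0 ?divr_ge0// !mulr_ge0// ltW.
have r0 := le_trans s0 sr; have r'0 := le_trans r0 rr'.
have h1 := nd c1 s0 sr; have h2 := nd c1 r0 rr'; have h3 := nd c1 r'0 r't.
have h4 := nd (shadow j) r0 rr'.
have hb := buf j r r' r0 rr' (le_trans r't tT).
move: zr zr'; rewrite !gateE// => e1 e2.
have k1 : 0 <= (kc C - kg C) * (sg r' - sg r) by rewrite mulr_ge0//; case/andP: cg.
have k2 : 0 <= th * (sg t - sg r') by rewrite mulr_ge0// ltW.
have k3 : 0 <= th * (sg r - sg s) by rewrite mulr_ge0// ltW.
by lra.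
Qed.

(** The crude initial excess is the sum of all gate regulators at time [t]; iterating the
    contraction sends it to 0. *)
Lemma gate_slope j s t : 0 <= s -> s <= t ->
  y (gate j) t - y (gate j) s <= 2 * th * (sg t - sg s).
Proof.
move=> s0 st; pose E := \sum_j y (gate j) t.
have y0 k : 0 <= y (gate k) t by exact: (sol_y_ge0 _ S (le_trans s0 st)).
have E0 : 0 <= E by exact: sumr_ge0.
have step n : forall j s' t', 0 <= s' -> s' <= t' -> t' <= t ->
    y (gate j) t' - y (gate j) s' <= 2 * th * (sg t' - sg s') + E * (4^-1) ^+ n.
  elim: n => [|n IH] k s' t' s'0 s't' t't.
    have h1 := nd c1 s'0 s't'; have h2 := nd (gate k) (le_trans s'0 s't') t't.
    have h3 := sol_y_ge0 (gate k) S s'0.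
    have : y (gate k) t <= E by rewrite /E (bigD1 k)//= lerDl sumr_ge0.
    have : 0 <= 2 * th * (sg t' - sg s') by rewrite !mulr_ge0// ltW// (cm_th HC).
    by rewrite expr0; lra.
  rewrite exprSr mulrA; apply: (@gate_slope_step t) => //.
  by rewrite mulr_ge0// exprn_ge0// invr_ge0.
apply/ler_addgt0Pr => e e0.
have h14 : `|4^-1 : R| < 1 by rewrite ger0_norm ?invr_ge0// invf_lt1; lra.
have := @cvg_geometric R E 4^-1 h14; move/cvgrPdist_lt => /(_ e e0)[n _ /(_ n (leqnn n))]/=.
rewrite sub0r normrN ger0_norm; last by rewrite mulr_ge0// exprn_ge0// invr_ge0.
move=> /ltW he; apply: le_trans (step n j s t s0 st (lexx _)) _.
by rewrite lerD2l.
Qed.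

Lemma coef_ge i : - (th / 2) <= ka' C i - ka C - al ^+ 3 * th * \sum_j Q i j.
Proof.
have th0 := cm_th HC.
have := cm_aa' HC i; have := weighted_sum_bound (cm_q HC) i (b := fun=> 1) (B := 1).
move=> /(_ (fun=> ler01) (fun=> lexx _) ler01).
under eq_bigr do rewrite mulr1.
rewrite mulr1 ler_norml => /andP[_ hq].
have /andP[al0 _] := cm_al HC.
have : al ^+ 3 * th * \sum_j Q i j <= th / 16.
  apply: (@le_trans _ _ (al ^+ 3 * th * q)).
    by rewrite ler_wpM2l// mulr_ge0 ?exprn_ge0// ltW.
  by rewrite mulrAC mulrC ler_pM2l// cm_alq.
by lra.
Qed.

(** On an excursion the clocks drain the buffer by at least [th / 2] per unit of [sg], and the gates
    contribute at most [th / 8]. *)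
Lemma buffer_zero i t : 0 <= t -> z (buffer i) t = 0.
Proof.
apply: (vanishes S) => // s r s0 sr zs pos ys; have th0 := cm_th HC.
have srW := ltW sr; have r0 := le_trans s0 srW; have sgd := nd c1 s0 srW.
have k4 : 0 <= th * (sg r - sg s) by rewrite mulr_ge0// ltW.
have B0 : 0 <= 2 * th * (sg r - sg s) by rewrite -mulrA mulr_ge0.
have := sumQ_diff i s0 srW B0 (fun j => gate_slope j s0 srW).
rewrite ler_norml => /andP[hs _].
rewrite !bufferE// ys.
have ha := coef_ge i.
set d := ka' C i - ka C - _ in ha *.
have k1 : - (th / 2) * (sg r - sg s) <= d * (sg r - sg s) by rewrite ler_wpM2r.
by lra.
Qed.

Lemma buffer_slope i s t : 0 <= s -> s <= t ->
  th / 4 * (sg t - sg s) <= y (buffer i) t - y (buffer i) s.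
Proof.
move=> s0 st; have th0 := cm_th HC; have t0 := le_trans s0 st.
have sgd := nd c1 s0 st.
have k4 : 0 <= th * (sg t - sg s) by rewrite mulr_ge0// ltW.
have B0 : 0 <= 2 * th * (sg t - sg s) by rewrite -mulrA mulr_ge0.
have := sumQ_diff i s0 st B0 (fun j => gate_slope j s0 st).
rewrite ler_norml => /andP[hs _].
have := buffer_zero i s0; have := buffer_zero i t0; rewrite !bufferE// => e1 e2.
have ha := coef_ge i.
set d := ka' C i - ka C - _ in ha e1 e2.
have k1 : - (th / 2) * (sg t - sg s) <= d * (sg t - sg s) by rewrite ler_wpM2r.
by lra.
Qed.

(** A gate and its shadow are positive together, so both regulators rest on an excursion. The inflow
    [c - g <= th / 4] is then outweighed by the buffer regulator, which enters with sign -1. *)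
Lemma gate_zero j t : 0 <= t -> z (gate j) t = 0.
Proof.
apply: (vanishes S) => // s r s0 sr zs pos ys; have /andP[cg0 cg] := cm_cg HC.
have srW := ltW sr; have r0 := le_trans s0 srW; have sgd := nd c1 s0 srW.
have ysh : y (shadow j) s = y (shadow j) r.
  apply: (sol_cp_open S) => // p sp pr.
  by rewrite shadowE ?(le_trans s0 (ltW sp))// pos.
have hb := buffer_slope j s0 srW.
rewrite !gateE// ys ysh.
have : (kc C - kg C) * (sg r - sg s) <= th / 4 * (sg r - sg s) by rewrite ler_wpM2r.
by lra.
Qed.

Lemma fuse_zero t : 0 <= t -> z fz t = 0.
Proof.
apply: (vanishes S) => // s r s0 sr zs pos ys.
have srW := ltW sr; have r0 := le_trans s0 srW; have sgd := nd c1 s0 srW.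
have hg := gate_slope jy s0 srW; rewrite !fuseE//.
have k1 : kr C * (y (gate jy) r - y (gate jy) s) <= kr C * (2 * th * (sg r - sg s)).
  by rewrite ler_wpM2l// (cm_kr HC).
have k2 : (kp C + 2 * kr C * th) * (sg r - sg s) <= al * (sg r - sg s).
  by rewrite ler_wpM2r// (cm_fuse HC).
by lra.
Qed.

Lemma origin_still k t : 0 <= t -> z k t = 0.
Proof.
move=> t0; move: k => [[[[]|]|]|[j|[j|j]]].
- by apply: clock_zero => //; rewrite !inE eqxx !orbT.
- by apply: clock_zero => //; rewrite !inE eqxx !orbT.
- by apply: clock_zero => //; rewrite !inE eqxx.
- exact: fuse_zero.
- exact: gate_zero.
- by rewrite -/(shadow j) shadowE// gate_zero.
- exact: buffer_zero.
Qed.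
End Origin.

Lemma origin_dies (R : realType) (J : finType) (jy : J) (Q : J -> J -> R)
    (C : constants J R) q : calm Q C q ->
  dies (bias (J := J) R) (reflection jy Q C) (fun=> 0).
Proof. by move=> HC y z S; exists 0 => j t t0; exact: (origin_still HC S). Qed.

(** * Choice of the constants *)

(* The equations between the constants say that each leg ends in the state in
   which the next one begins; the inequalities needed at 0 hold because [scale]
   is large compared to the row sums of [Q]. *)
Section Tuning.
Variables (F : realFieldType) (J : finType) (Q : J -> J -> F) (q X : F).

Definition scale : F := 16 * (2 * q + 1).
Local Notation K := scale.

(** [gp = 2 X - 1] makes [c] twice [g]. [kmu] solves the linear equation [rg_muE], in which the
    factor [K - 1] cancels. [kr] is fixed by [kr th = al / 4], and [kp] by the balance of the fuse
    over leg 2. *)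
Definition tuned : constants J F :=
  let gp := 2 * X - 1 in
  let al := K^-1 in
  let th := gp * K ^+ 3 + 1 in
  let a := al ^+ 3 * th * (q + 1) in
  let kr := (4 * K * th)^-1 in
  {| kal := al; kth := th; kg := X * K; kc := 2 * X * K;
     kmu := 2 * X * K ^+ 2 - K ^+ 2 - K - 1; ka := a;
     ka' := fun i => K * (a + gp * \sum_j Q i j);
     kp := (al ^+ 3 - kr / 2 * (1 + al ^+ 3)) * K; kr := kr |}.

Hypothesis Qq : forall i, \sum_j `|Q i j| <= q.
Hypotheses (q0 : 0 <= q) (X1 : 1 <= X).

Lemma scale_ge16 : 16 <= K. Proof. by rewrite /scale; move: q0; lra. Qed.
Lemma scale_gt0 : 0 < K. Proof. by have := scale_ge16; lra. Qed.
Lemma scaleV_gt0 : 0 < K^-1. Proof. by rewrite invr_gt0 scale_gt0. Qed.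
Lemma scaleVK : K^-1 * K = 1. Proof. by rewrite mulVf// gt_eqF// scale_gt0. Qed.
Lemma scaleV_le : K^-1 <= 16^-1.
Proof. by rewrite lef_pV2 ?posrE ?scale_gt0 ?scale_ge16. Qed.
Lemma scaleV_q : K^-1 * (2 * q + 1) = 16^-1.
Proof. by rewrite /scale; field; rewrite gt_eqF//; move: q0; lra. Qed.

Lemma tuned_th_gt : K ^+ 3 < kth tuned.
Proof.
rewrite /=; have : 0 < K ^+ 3 by rewrite exprn_gt0 ?scale_gt0.
by move: X1 (K ^+ 3) => h k k0; nra.
Qed.

Lemma tuned_th_gt0 : 0 < kth tuned.
Proof. by apply: lt_trans tuned_th_gt; rewrite exprn_gt0 ?scale_gt0. Qed.

Lemma tuned_kr_th : kr tuned * kth tuned = K^-1 / 4.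
Proof.
have t0 := tuned_th_gt0; have K0 := scale_gt0; rewrite /= in t0 *.
have := gt_eqF t0; have := gt_eqF K0 => k1 k2; by field; rewrite ?k1 ?k2.
Qed.

Lemma tuned_kr_gt0 : 0 < kr tuned.
Proof.
rewrite /= invr_gt0; apply: mulr_gt0; last exact: tuned_th_gt0.
by rewrite mulr_gt0 ?scale_gt0.
Qed.

Lemma tuned_kr_le : kr tuned <= K^-1 ^+ 3 / 4.
Proof.
have K0 := scale_gt0; have t := tuned_th_gt; rewrite -(ler_pM2r tuned_th_gt0) tuned_kr_th.
apply: (@le_trans _ _ (K^-1 ^+ 3 / 4 * K ^+ 3)).
  rewrite -mulrA (mulrC 4^-1) mulrA -exprMn scaleVK expr1n mul1r.
  by have := scaleV_le; move: K^-1 => v; lra.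
by rewrite ler_wpM2l ?(ltW t)// divr_ge0 ?exprn_ge0// ltW// scaleV_gt0.
Qed.

Lemma scaleV3_le : K^-1 ^+ 3 <= K^-1 ^+ 2 / 16.
Proof.
by rewrite (exprSr _ 2) ler_wpM2l ?scaleV_le// exprn_ge0// ltW// scaleV_gt0.
Qed.

Lemma scaleV2_le : K^-1 ^+ 2 <= K^-1 / 16.
Proof. by rewrite expr2 ler_wpM2l ?scaleV_le// ltW// scaleV_gt0. Qed.

Lemma tuned_kp_bounds : 0 <= kp tuned <= K^-1 ^+ 2.
Proof.
have v0 := scaleV_gt0; have v30 : 0 < K^-1 ^+ 3 by rewrite exprn_gt0.
have := tuned_kr_gt0; have := tuned_kr_le; rewrite /=.
set k := (_ * _)^-1 => k1 k0.
have v1 : K^-1 ^+ 3 <= 1.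
  by have := scaleV3_le; have := scaleV2_le; have := scaleV_le; lra.
apply/andP; split.
  apply: mulr_ge0; last by rewrite ltW// scale_gt0.
  move: (K^-1 ^+ 3) k v1 v30 k0 k1 => u k u1 u0 k0 ku.
  have h : 0 <= k * (1 - u) by apply: mulr_ge0; lra.
  lra.
have -> : K^-1 ^+ 2 = K^-1 ^+ 3 * K by rewrite (exprSr _ 2) -mulrA scaleVK mulr1.
apply: ler_wpM2r; first by rewrite ltW// scale_gt0.
move: (K^-1 ^+ 3) k v1 v30 k0 k1 => u k u1 u0 k0 ku.
have h : 0 <= k * u by apply: mulr_ge0; lra.
lra.
Qed.
End Tuning.

Section TunedDynamics.
Variables (R : realType) (J : finType) (Q : J -> J -> R) (q X : R).
Hypothesis Qq : forall i, \sum_j `|Q i j| <= q.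
Hypotheses (q0 : 0 <= q) (X1 : 1 <= X).
Local Notation K := (scale q).
Local Notation C := (tuned Q q X).

Lemma tuned_regime : regime Q C q X (kth C - 1) (2 * X - 1).
Proof.
have K0 := scale_gt0 q0; have K16 := scale_ge16 q0; have KV := scaleVK q0.
have K2 : 16 * K <= K ^+ 2 by rewrite expr2 ler_wpM2r// ltW.
have K2X : K ^+ 2 <= X * K ^+ 2 by rewrite -[leLHS]mul1r ler_wpM2r// exprn_ge0// ltW.
have Kn0 : K != 0 by rewrite gt_eqF.
split=> //=.
- exact: scaleV_gt0.
- by have := scaleV_le q0; lra.
- by move: X1; lra.
- by move: Kn0; generalize K => k k0; field.
- by ring.
- by rewrite ?mulfK ?mulfVK.
- by rewrite mulfK//; ring.
- by rewrite ltr_pM2r//; move: X1; lra.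
- by move: K2 K2X K16; lra.
- by move: Kn0; generalize K => k k0; field.
- by move=> i; rewrite mulrC mulrA KV mul1r.
- have gp1 : 1 <= 2 * X - 1 by move: X1; lra.
  have K31 : 1 <= K ^+ 3 by apply: exprn_ege1; lra.
  have XV : K^-1 * X <= X by rewrite ler_piMl//; [move: X1|have := scaleV_le q0]; lra.
  have : 2 * X - 1 <= (2 * X - 1) * K ^+ 3 by rewrite ler_peMr//; lra.
  by move: ((2 * X - 1) * K ^+ 3) => u; move: X1; lra.
- by have /= := tuned_kr_gt0 Q q0 X1.
- by have := tuned_kr_th Q q0 X1 => /= ->; have := scaleV_le q0; lra.
- by have /andP[] := tuned_kp_bounds Q q0 X1.
- by rewrite ?mulfK ?mulfVK.
Qed.

Lemma sumQ_le i : `|\sum_j Q i j| <= q.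
Proof. exact: le_trans (ler_norm_sum _ _ _) (Qq i). Qed.

(** Everything is measured against [th]: from [th - 1 = gp K ^+ 3] one gets
    [gp K = v ^+ 2 (th - 1)], and [v (2 q + 1) = 1 / 16] makes the remaining factors small. *)
Lemma tuned_calm : calm Q C q.
Proof.
have K0 := scale_gt0 q0; have K16 := scale_ge16 q0; have KV := scaleVK q0.
have v0 := scaleV_gt0 q0; have v1 := scaleV_le q0; have vq := scaleV_q q0.
have t0 := tuned_th_gt0 Q q0 X1; have tK := tuned_th_gt Q q0 X1.
have v2 := scaleV2_le q0; have v3 := scaleV3_le q0.
set v := K^-1 in v0 v1 vq v2 v3 KV *; have vq0 : 0 <= v * q by rewrite mulr_ge0// ltW.
have vq1 : v * q <= 32^-1 by move: vq v0; lra.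
have v3E u : v ^+ 3 * u = v ^+ 2 * (v * u) by rewrite (exprSr _ 2) -mulrA.
have v20 : 0 < v ^+ 2 by rewrite exprn_gt0.
have v2th0 : 0 < v ^+ 2 * kth C by rewrite mulr_gt0.
have aE : ka C = v ^+ 2 * kth C * (v * (q + 1)) by rewrite /= -/v; ring.
have vK3 : v ^+ 2 * K ^+ 3 = K by rewrite (exprSr K 2) mulrA -exprMn KV expr1n mul1r.
have gpK : (2 * X - 1) * K = v ^+ 2 * (kth C - 1) by rewrite /= addrK [RHS]mulrCA vK3.
have Ka : K * ka C = v ^+ 2 * kth C * (q + 1).
  rewrite aE; move: (kth C) => t.
  have -> (k u : R) : k * (u ^+ 2 * t * (u * (q + 1))) = u * k * (u ^+ 2 * t * (q + 1)).
    by ring.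
  by rewrite KV mul1r.
have a'E i : ka' C i = v ^+ 2 * kth C * (q + 1) + v ^+ 2 * (kth C - 1) * \sum_j Q i j.
  by rewrite -gpK -Ka [(2 * X - 1) * K]mulrC -[K * _ * _]mulrA -mulrDr.
have th1 : 1 <= kth C by rewrite (le_trans _ (ltW tK))// exprn_ege1//; lra.
split=> //.
- by rewrite /= -/v v0; lra.
- rewrite [kal C]/= -/v v3E; have v2l : v ^+ 2 <= 1 by lra.
  by have := ler_pM (ltW v20) vq0 v2l vq1; lra.
- move=> i; have := sumQ_le i; rewrite ler_norml => /andP[S1 S2].
  rewrite a'E aE [kal C]/= -/v exprSr.
  move: (kth C) (\sum_j Q i j) t0 th1 v2th0 S1 S2 => t S t0 t1 w0 S1 S2.
  have A : v ^+ 2 * (t - 1) * S <= v ^+ 2 * t * q.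
    apply: (@le_trans _ _ (v ^+ 2 * (t - 1) * q)).
      by rewrite ler_wpM2l// mulr_ge0//; [exact: ltW|lra].
    by rewrite ler_wpM2r// ler_wpM2l ?ltW//; lra.
  have B : v ^+ 2 * t * (2 * q + 1) = v * t / 16 by rewrite -vq; ring.
  have D : 0 <= v ^+ 2 * t * (v * (q + S)).
    by apply: mulr_ge0; [exact: ltW|apply: mulr_ge0; [exact: ltW|lra]].
  have E : v * t <= 16^-1 * t by rewrite ler_wpM2r// ltW.
  have G : 0 < v ^+ 2 * t * v by rewrite mulr_gt0.
  lra.
- move=> i; have := sumQ_le i; rewrite ler_norml => /andP[S1 S2].
  rewrite a'E aE.
  move: (kth C) (\sum_j Q i j) t0 th1 v2th0 S1 S2 => t S t0 t1 w0 S1 S2.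
  have A : - (v ^+ 2 * t * q) <= v ^+ 2 * (t - 1) * S.
    rewrite lerNl -mulrN; apply: (@le_trans _ _ (v ^+ 2 * (t - 1) * q)).
      by rewrite ler_wpM2l//; [apply: mulr_ge0; [exact: ltW|lra]|lra].
    by rewrite ler_wpM2r// ler_wpM2l ?ltW//; lra.
  have B : v * (q + 1) <= 4^-1 by lra.
  have D : v ^+ 2 * t * (v * (q + 1)) <= t * 4^-1.
    apply: ler_pM => //; [exact: ltW|apply: mulr_ge0; lra|].
    by rewrite ler_piMl ?ltW//; lra.
  lra.
- rewrite /=; apply/andP; split.
    by have : 0 <= X * K; [rewrite mulr_ge0//; move: X1 K0; lra|lra].
  have A : 256 * K <= K ^+ 3.
    rewrite (exprSr K 2); apply: ler_wpM2r; first exact: ltW.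
    by have := ler_pM (ler0n _ 16) (ler0n _ 16) K16 K16; rewrite -expr2; lra.
  have B : 256 * (X * K) <= X * K ^+ 3 by rewrite mulrCA ler_wpM2l//; move: X1; lra.
  have D : X * K ^+ 3 <= (2 * X - 1) * K ^+ 3.
    by rewrite ler_wpM2r//; [rewrite exprn_ge0// ltW|move: X1; lra].
  have E : 0 <= X * K by rewrite mulr_ge0//; move: X1 K0; lra.
  lra.
- by have /andP[] := tuned_kp_bounds Q q0 X1.
- exact/ltW/tuned_kr_gt0.
- have := tuned_kr_th Q q0 X1; have /andP[_] := tuned_kp_bounds Q q0 X1.
  rewrite -/v -(mulrA 2) => kp1 ->; rewrite [kal C]/= -/v; move: (kp C) kp1 => w kp1.
  by have := v2; lra.
Qed.
End TunedDynamics.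

(** * Rational instances of the fluid model *)

Section NodeMatrices.
Variables (F : Type) (N : finType).

Definition node_mx (M : N -> N -> F) : 'M[F]_#|N| := \matrix_(k, l) M (enum_val k) (enum_val l).
Definition node_cv (x : N -> F) : 'cV[F]_#|N| := \col_k x (enum_val k).
End NodeMatrices.

Section PositiveWeights.
Variables (R : realType) (N : finType) (M : N -> N -> R).

(** One weight vector serves all principal submatrices, each time restricted to the chosen index
    set. *)
Lemma completely_S_weights (w : N -> R) : (forall k, 0 <= w k) ->
  (forall (B : {set N}) j, j \in B -> 0 < \sum_k M j k * (if k \in B then w k else 0)) ->
  completely_S (node_mx M).
Proof.
move=> w0 h A; exists (\col_i w (enum_val (enum_val i))); split=> i; first by rewrite mxE.
pose B : {set N} := [set k | enum_rank k \in A]%SET.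
have := h B (enum_val (enum_val i)); rewrite inE enum_valK enum_valP => /(_ isT).
move=> h0; rewrite mxE (lt_le_trans h0)// le_eqVlt; apply/orP; left; apply/eqP.
transitivity (\sum_(k in B) M (enum_val (enum_val i)) k * w k).
  by rewrite [RHS]big_mkcond; apply: eq_bigr => k _; case: ifP; rewrite ?mulr0.
rewrite (reindex (@enum_val N predT)); last by apply: onW_bij; exact: enum_val_bij.
rewrite (reindex_onto (@enum_val _ (mem A)) (fun k => enum_rank_in (enum_valP i) k)) /=.
  by apply: eq_big => k; rewrite ?mxE// inE enum_valK enum_valP enum_valK_in eqxx.
by move=> k; rewrite inE enum_valK => kA; rewrite enum_rankK_in.
Qed.
End PositiveWeights.

Section NetworkWeights.
Variables (R : realType) (J : finType) (jy : J) (Q : J -> J -> R) (C : constants J R) (q : R).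
Hypothesis HC : calm Q C q.

(** Clock and fuse rows have nonnegative coefficients. In the others, weight [W] on gates and
    shadows beats [W / 2] on buffers, the gates cost a buffer row at most [W / 16], and [W] is large
    compared to all clock coefficients. *)
Lemma reflection_completely_S : completely_S (node_mx (reflection jy Q C)).
Proof.
have /andP[al0 al1] := cm_al HC; have q1 := cm_alq HC; have Qq := cm_q HC.
have kp0 := cm_kp HC; have kr0 := cm_kr HC; have t0 := cm_th HC.
set al := kal C in al0 al1 q1; set th := kth C in t0.
pose S1 i : R := `|al ^+ 3 * th * \sum_j Q i j + ka C| + `|ka' C i|.
pose S : R := \sum_i S1 i.
have S1S i : S1 i <= S.
  by rewrite /S (bigD1 i)//= lerDl sumr_ge0// => k _; rewrite /S1 addr_ge0.
pose W : R := 8 * (1 + th + `|kc C - kg C| + `|kmu C + th| + `|kg C| +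
  `|kc C + kmu C + th| + S).
have S0 : 0 <= S by apply: sumr_ge0 => i _; rewrite /S1 addr_ge0.
have W0 : 0 < W.
  rewrite /W; have := normr_ge0 (kc C - kg C); have := normr_ge0 (kmu C + th).
  by have := normr_ge0 (kg C); have := normr_ge0 (kc C + kmu C + th); lra.
pose w (k : node J) : R := match k with inl _ => 1 | inr (inl _) => W
  | inr (inr (inl _)) => W | inr (inr (inr _)) => W / 2 end.
have w0 k : 0 < w k by case: k => [k|[k|[k|k]]] /=; lra.
apply: (@completely_S_weights _ _ _ w) => [k|B j jB]; first exact: ltW.
rewrite reflectionE; set u := (fun k => if k \in B then _ else _).
have u0 k : 0 <= u k by rewrite /u; case: ifP => // _; exact: ltW.
have uw k : u k <= w k by rewrite /u; case: ifP => // _; exact: ltW.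
have uj : u j = w j by rewrite /u jB.
move: u u0 uw uj => u u0 uw uj; have uc (x : R) c : - `|x| <= x * u (inl c).
  have := u0 (inl c); have := uw (inl c); move: (u (inl c)) => v /= v1 v0.
  apply: (@le_trans _ _ (- (`|x| * v))); first by rewrite lerN2 ler_piMr.
  by rewrite -mulNr ler_wpM2r// lerNl -normrN ler_norm.
case: j uj {jB} => [[[[]|]|]|[j|[j|i]]] /= uj; rewrite -?/al -?/th.
- have a0 : 0 <= (1 + al) * u (clock1 J) by rewrite mulr_ge0//; lra.
  by rewrite uj; have := u0 (fuse J); lra.
- have a0 : 0 <= (1 + al) * u (clock3 J) by rewrite mulr_ge0//; lra.
  by rewrite uj; have := u0 (fuse J); lra.
- have a0 : 0 <= (1 + al) * u (clock2 J) by rewrite mulr_ge0//; lra.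
  by rewrite uj; have := u0 (fuse J); lra.
- have a0 : 0 <= (1 + kp C) * u (clock2 J) by rewrite mulr_ge0//; lra.
  have a1 : 0 <= kr C * u (gate jy) by rewrite mulr_ge0.
  by rewrite uj; have := u0 (clock3 J); lra.
- rewrite uj.
  have := uc th (Some (Some true)); have := uc (- th) (Some None).
  have := uc (kc C - kg C) (Some (Some false)); have := u0 (shadow j).
  have := uw (buffer j); rewrite normrN (gtr0_norm t0) /= /clock1 /clock2 /clock3.
  have := normr_ge0 (kmu C + th); have := normr_ge0 (kg C).
  have := normr_ge0 (kc C - kg C).
  by have := normr_ge0 (kc C + kmu C + th); rewrite /W; lra.
- rewrite uj.
  have := uc (kc C + kmu C + th) (Some (Some true)); have := uc (- (kmu C + th)) (Some None).
  have := uc (- kg C) (Some (Some false)); have := u0 (gate j).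
  have := uw (buffer j); rewrite !normrN /= /clock1 /clock2 /clock3.
  have := normr_ge0 (kc C - kg C); have := normr_ge0 (kmu C + th); have := normr_ge0 (kg C).
  by have := normr_ge0 (kc C + kmu C + th); rewrite /W; lra.
- rewrite uj.
  have := uc (al ^+ 3 * th * \sum_j Q i j + ka C) (Some None).
  have := uc (- th) (Some (Some true)); have := uc (- ka' C i) (Some (Some false)).
  have : al ^+ 3 * \sum_j Q i j * u (gate j) <= W / 16.
    have := weighted_sum_bound Qq i (fun j => u0 (gate j)) (fun j => uw (gate j)) (ltW W0).
    rewrite ler_norml => /andP[_ b]; rewrite (mulrC W).
    apply: (@le_trans _ _ (al ^+ 3 * (q * W))); last by rewrite mulrA ler_wpM2r// ltW.
    by rewrite ler_wpM2l// exprn_ge0// ltW.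
  have := S1S i; rewrite !normrN (gtr0_norm t0) /S1 /= /clock1 /clock2 /clock3.
  have := normr_ge0 (kc C - kg C); have := normr_ge0 (kmu C + th); have := normr_ge0 (kg C).
  have := normr_ge0 (al ^+ 3 * th * \sum_j Q i j + ka C); have := normr_ge0 (ka' C i).
  by have := normr_ge0 (kc C + kmu C + th); rewrite -/al -/th /W; lra.
Qed.
End NetworkWeights.

(** * Passage between indexed families and column vectors *)

Section Columns.
Variables (R : realType) (N : finType) (th : N -> R) (M : N -> N -> R).

Lemma node_cv_continuous (x : N -> R -> R) : (forall j, continuous (x j)) ->
  continuous (fun t => node_cv (x^~ t)).
Proof.
move=> cx t; apply/cvg_ballP => e e0.
have h (k : N) : \forall s \near t, ball (x k t) e (x k s).
  by have /cvg_ballP/(_ e e0) := cx k t.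
have hh := filter_forall (nbhs_filter t) h.
near=> s; have hs : forall k, ball (x k t) e (x k s) by near: s; exact: hh.
by split=> // k l; rewrite !mxE; exact: hs.
Unshelve. all: by end_near. Qed.

Lemma node_mx_mulE (v : 'cV[R]_#|N|) k :
  (node_mx M *m v) k 0 = \sum_j M (enum_val k) j * v (enum_rank j) 0.
Proof.
rewrite mxE [RHS](reindex (@enum_val N predT)); last by apply: onW_bij; exact: enum_val_bij.
by apply: eq_bigr => l _; rewrite !mxE enum_valK.
Qed.

Lemma node_coord_continuous (f : R -> 'cV[R]_#|N|) k :
  {within `[0, +oo[, continuous f} -> {within `[0, +oo[, continuous (fun t => f t k 0)}.
Proof.
move=> /subspace_continuousP cf; apply/subspace_continuousP => t t0.
exact: cvg_comp (cf t t0) (@coord_continuous R _ _ k 0 (f t)).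
Qed.

Lemma dies_stable x0 : dies th M x0 ->
  stable (node_cv x0) (node_cv th) (node_mx M).
Proof.
move=> D y z [cy cz y0 z0 eqn yi nd cp].
have mx (t : R) : 0 <= t -> Num.max 0 t = t by move=> t0; apply/max_idPr.
(* Clamping at 0 supplies the continuity on the whole line that [solution] asks for. *)
have [|T zT] := D (fun j t => y (Num.max 0 t) (enum_rank j) 0)
  (fun j t => z (Num.max 0 t) (enum_rank j) 0).
  split.
  - by move=> j; apply: (clamp_continuous (f := fun t => y t (enum_rank j) 0)); exact: node_coord_continuous.
  - by move=> j; apply: (clamp_continuous (f := fun t => z t (enum_rank j) 0)); exact: node_coord_continuous.
  - by move=> j t t0; rewrite mx// z0.
  - move=> j t t0; rewrite mx// eqn// [LHS]mxE node_mx_mulE !mxE enum_rankK mulrC.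
    by congr (_ + _).
  - by move=> j; rewrite mx// yi mxE.
  - by move=> j s t s0 st; rewrite !mx//; [exact: nd|exact: le_trans st].
  - move=> j s t s0 st zp; have t0 := le_trans s0 st; rewrite !mx//.
    have /stieltjes_complementarityP := cp (enum_rank j); apply=> //.
    + exact: node_coord_continuous.
    + exact: node_coord_continuous.
    + by move=> ? ?; exact: nd.
    + by move=> r r0; exact: z0.
    + by move=> r sr rt; have := zp r sr rt; rewrite mx// (le_trans s0).
apply: cvg_near_cst; exists (Num.max 0 T); split; first exact: num_real.
move=> t; rewrite gt_max => /andP[t0 Tt].
apply/matrixP => k l; rewrite ord1 mxE; have := zT (enum_val k) t (ltW Tt).
by rewrite mx ?ltW// enum_valK.
Qed.

Lemma escapes_unstable x0 : escapes th M x0 ->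
  ~ stable (node_cv x0) (node_cv th) (node_mx M).
Proof.
move=> [y [z [S [j [v [T [v0 zv]]]]]]] st.
have cvg0 : node_cv (z^~ t) @[t --> +oo] --> (0 : 'cV[R]_#|N|).
  apply: (st (fun t => node_cv (y^~ t))); split.
  - by apply: continuous_subspaceT; exact: node_cv_continuous (sol_yc S).
  - by apply: continuous_subspaceT; exact: node_cv_continuous (sol_zc S).
  - by move=> t t0 k; rewrite mxE (sol_y_ge0 _ S).
  - by move=> t t0 k; rewrite mxE (sol_z_ge0 S).
  - move=> t t0; apply/matrixP => k l; rewrite ord1 mxE (sol_eq S)// [RHS]mxE node_mx_mulE !mxE mulrC.
    by congr (_ + _); apply: eq_bigr => i _; rewrite mxE enum_rankK.
  - by apply/matrixP => k l; rewrite !mxE (sol_y0 S).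
  - by move=> k s t s0 st'; rewrite !mxE (sol_nd S).
  - move=> k; have h x : (fun t => node_cv (x^~ t) k 0) = x (enum_val k).
      by apply: funext => t; rewrite mxE.
    rewrite !h; apply/stieltjes_complementarityP.
    + by apply: continuous_subspaceT; exact: (sol_yc S).
    + by apply: continuous_subspaceT; exact: (sol_zc S).
    + by move=> ? ?; exact: (sol_nd S).
    + by move=> ?; exact: (sol_z_ge0 S).
    + by move=> ? ?; exact: (sol_cp S).
have : z j t @[t --> +oo] --> (0 : R).
  have := cvg_comp _ _ cvg0 (@coord_continuous R _ _ (enum_rank j) 0 0).
  rewrite mxE; apply: cvg_trans; apply: near_eq_cvg; near=> t.
  by rewrite /= mxE enum_rankK.
move=> /cvg_lim - /(_ (@Rhausdorff R)) l0; case/eqP: v0; rewrite -l0.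
apply/esym/cvg_lim; first exact: Rhausdorff.
apply: cvg_near_cst; exists T; split; first exact: num_real.
by move=> t Tt; apply: zv; exact: ltW.
Unshelve. all: by end_near. Qed.
End Columns.

Section Instance.
Variables (F : realFieldType) (J : finType) (jy : J) (Q : J -> J -> F) (q X : F).

(* [state3] at the scale that makes the buffers equal to [x]. *)
Definition start (x : J -> F) (j : node J) : F :=
  match j with
  | inl (Some None) => scale q
  | inl (Some (Some _)) => 0
  | inl None => 1 - kr (tuned Q q X) / 2
  | inr (inl _) => scale q ^+ 3 * (2 * X - 1)
  | inr (inr (inl _)) => 0
  | inr (inr (inr i)) => x i
  end.

Lemma start_ge0 (x : J -> F) j : 0 <= q -> 1 <= X -> (forall i, 0 <= x i) -> 0 <= start x j.
Proof.
move=> q0 X1 x0; have s0 := scale_gt0 q0; case: j => [[[[]|]|]|[j|[j|i]]] //=; first exact: ltW.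
  have := tuned_kr_le Q q0 X1; have := scaleV3_le q0; have := scaleV2_le q0; have := scaleV_le q0.
  by rewrite /=; lra.
by rewrite mulr_ge0 ?exprn_ge0//; [exact: ltW|lra].
Qed.

Definition network : node J -> node J -> F := reflection jy Q (tuned Q q X).
End Instance.

(** * Transport of the rational network to the reals *)

Section Transfer.
Variables (F F' : realFieldType) (f : {rmorphism F -> F'}).
Variables (J : finType) (jy : J) (Q : J -> J -> F) (q X : F).
Local Notation Q' := (fun i j => f (Q i j)).

Lemma rmorph_scale : f (scale q) = scale (f q).
Proof. by rewrite /scale rmorphM rmorph_nat rmorphD rmorphM rmorph_nat rmorph1. Qed.

Let morphE := (rmorph_nat f, rmorphM f, rmorphXn f, fmorphV f, rmorph1 f, rmorph0 f,
  rmorph_scale, rmorphN f, rmorphD f).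

Lemma rmorph_start (x : J -> F) j : f (start Q q X x j) = start Q' (f q) (f X) (f \o x) j.
Proof.
by case: j => [[[[]|]|]|[j|[j|i]]] /=; rewrite ?morphE.
Qed.

Definition map_constants (C : constants J F) : constants J F' :=
  Constants (f (kal C)) (f (kth C)) (f (kg C)) (f (kc C)) (f (kmu C)) (f (ka C))
    (f \o ka' C) (f (kp C)) (f (kr C)).

Lemma rmorph_tuned : map_constants (tuned Q q X) = tuned Q' (f q) (f X).
Proof.
have sumQ i : f (\sum_j Q i j) = \sum_j f (Q i j) by rewrite rmorph_sum.
rewrite /map_constants /tuned /= !morphE; congr Constants.
by apply: funext => i; rewrite /= ?(sumQ, morphE).
Qed.

Lemma rmorph_row C u j : f (row jy Q C u j) = row jy Q' (map_constants C) (f \o u) j.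
Proof.
have sumM i v : f (\sum_j Q i j * v j) = \sum_j f (Q i j) * f (v j).
  by rewrite rmorph_sum; apply: eq_bigr => k _; rewrite rmorphM.
by case: j => [[[[]|]|]|[j|[j|i]]] /=; rewrite ?(sumM, rmorph_sum, morphE).
Qed.

Lemma rmorph_network j k : f (network jy Q q X j k) = network jy Q' (f q) (f X) j k.
Proof.
rewrite /network /reflection rmorph_row rmorph_tuned; congr (row _ _ _ _ j).
by apply: funext => i; rewrite /= /unit_vec rmorph_nat.
Qed.
End Transfer.

(** * Stability of the network read off from a run of its update map *)

Section Simulation.
Variables (R : realType) (J : finType) (jy : J) (Q : J -> J -> rat) (q X : rat).
Hypothesis Qq : forall i, \sum_j `|Q i j| <= q.
Hypotheses (q0 : 0 <= q) (X1 : 1 <= X).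
Local Notation toR := (ratr : rat -> R).
Local Notation QR := (fun i j => toR (Q i j)).

Lemma ratr_Qq i : \sum_j `|QR i j| <= toR q.
Proof.
apply: le_trans (_ : toR (\sum_j `|Q i j|) <= _); last by rewrite ler_rat.
rewrite rmorph_sum; apply: ler_sum => j _ /=.
by rewrite ratr_norm.
Qed.

Let q0R : 0 <= toR q. Proof. by rewrite ler0q. Qed.
Let X1R : 1 <= toR X. Proof. by rewrite -[1](rmorph1 toR) ler_rat. Qed.

Let networkE : map_mx toR (node_mx (network jy Q q X)) = node_mx (network jy QR (toR q) (toR X)).
Proof. by apply/matrixP => k l; rewrite !mxE; exact: rmorph_network. Qed.

Lemma network_completely_S : completely_S (map_mx toR (node_mx (network jy Q q X))).
Proof.
rewrite networkE.
exact: reflection_completely_S (tuned_calm ratr_Qq q0R X1R).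
Qed.

Variable x : nat -> J -> rat.
Hypothesis x0 : forall n j, 0 <= x n j.
Hypothesis xX : forall n j, x n j <= X.
Hypothesis ux : forall n j, x n.+1 j = update Q (x n) j.
Local Notation xR := (fun n j => toR (x n j)).

Let ux' n j : xR n.+1 j = update QR (xR n) j.
Proof.
rewrite -[LHS]/(toR (x n.+1 j)) ux /update rmorph_sum; apply: eq_bigr => k _.
rewrite -[LHS]/(toR (Q j k * _)) rmorphM; congr (_ * _).
have t1 : toR 1 = 1 by exact: (rmorph1 toR).
by rewrite !minEle -t1 ler_rat; case: ifP.
Qed.

Let startE : start QR (toR q) (toR X) (xR 0%N) =1
  state3 (tuned QR (toR q) (toR X)) (2 * toR X - 1) (scale (toR q) ^+ 3) (xR 0%N).
Proof.
have KV := scaleVK q0R; have K0 := scale_gt0 q0R.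
have V2 : (scale (toR q))^-1 ^+ 2 * scale (toR q) ^+ 3 = scale (toR q).
  by rewrite (exprSr _ 2) mulrA -exprMn KV expr1n mul1r.
have V3 : (scale (toR q))^-1 ^+ 3 * scale (toR q) ^+ 3 = 1 by rewrite -exprMn KV expr1n.
move=> [[[[]|]|]|[j|[j|i]]] //; rewrite [LHS]/= [RHS]/=.
  by rewrite -[RHS]mulrA V3 mulr1.
by rewrite [_ ^+ 3 * _]mulrC V3 mul1r.
Qed.

Let startE' : map_mx toR (node_cv (start Q q X (x 0%N))) =
  node_cv (state3 (tuned QR (toR q) (toR X)) (2 * toR X - 1) (scale (toR q) ^+ 3) (xR 0%N)).
Proof. by apply/matrixP => k l; rewrite !mxE -startE; exact: rmorph_start. Qed.

Let biasE : map_mx toR (node_cv (bias (J := J) rat)) = node_cv (bias (J := J) R).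
Proof.
by apply/matrixP => k l; rewrite !mxE /bias; case: (enum_val k) => _; rewrite ?rmorphN ?rmorph1 ?rmorph0.
Qed.

Let HC := tuned_regime ratr_Qq q0R X1R.
Let h0 : 0 < scale (toR q) ^+ 3. Proof. by rewrite exprn_gt0// scale_gt0. Qed.
Let x0R n j : 0 <= xR n j. Proof. by rewrite ler0q. Qed.
Let xXR n j : xR n j <= toR X. Proof. by rewrite ler_rat. Qed.

Lemma network_stable : (forall n, x n jy = 0) ->
  stable (map_mx toR (node_cv (start Q q X (x 0%N)))) (map_mx toR (node_cv (bias (J := J) rat)))
    (map_mx toR (node_mx (network jy Q q X))).
Proof.
move=> xy; rewrite startE' biasE networkE; apply: dies_stable.
apply: (silent_run_dies HC h0 x0R xXR _ ux') => [n|]; first by rewrite xy rmorph0.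
exact: origin_dies (tuned_calm ratr_Qq q0R X1R).
Qed.

Lemma network_unstable m : (forall n, (n < m)%N -> x n jy = 0) -> x m jy = 1 ->
  ~ stable (map_mx toR (node_cv (start Q q X (x 0%N)))) (map_mx toR (node_cv (bias (J := J) rat)))
    (map_mx toR (node_mx (network jy Q q X))).
Proof.
move=> xy xN; rewrite startE' biasE networkE; apply: escapes_unstable.
apply: (loud_run_escapes (N := m) HC h0 x0R xXR _ _ ux') => [n nN|]; first by rewrite xy// rmorph0.
by rewrite xN rmorph1.
Qed.
End Simulation.

(** * Stack programs as saturated linear networks *)

Section StackValues.
Variable Gam : finType.
Implicit Types (a : Gam) (s w : seq Gam).

(* Odd digits separate the fractions of distinct stacks, so that the top can be
   read off with finitely many truncations [min(u, k)]. *)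
Definition base : rat := (2 ^ #|Gam|.+1)%:R.
Definition digit a : rat := (2 * enum_rank a).+1%:R.

Fixpoint value s : rat := if s is a :: s' then (digit a + value s') / base else 0.

Lemma base_gt0 : 0 < base.
Proof. by rewrite ltr0n expn_gt0. Qed.

Lemma value_bounds s : 0 <= value s < 1.
Proof.
elim: s => [|a s /andP[v0 v1]] /=; first by rewrite ltr01.
have b0 := base_gt0; rewrite ltr_pdivrMr// mul1r.
have -> : 0 <= (digit a + value s) / base by rewrite divr_ge0 ?ler0n// addr_ge0 ?ler0n.
apply: (@lt_le_trans _ _ (digit a + 1)); first by rewrite ltrD2l.
rewrite /digit /base natr1 ler_nat.
have ra : (enum_rank a < #|Gam|)%N := ltn_ord _.
rewrite expnS; have := ltn_expl #|Gam| (isT : 1 < 2)%N; lia.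
Qed.

Lemma base_value a s : base * value (a :: s) = digit a + value s.
Proof. by rewrite /= mulrC divfK// gt_eqF// base_gt0. Qed.

Lemma base_value_ge0 s : 0 <= base * value s.
Proof. by rewrite mulr_ge0 ?ler0n//; case/andP: (value_bounds s). Qed.

Lemma value_cat w s : value (w ++ s) = base ^- size w * value s + value w.
Proof.
elim: w => [|a w IH] /=; first by rewrite expr0 invr1 mul1r addr0.
by rewrite IH exprS invfM; ring.
Qed.

(** The trapezoid that is 1 on [[2 r + 1, 2 r + 2]] and 0 outside []2 r, 2 r + 3[]. For a nonempty
    stack, [base * value s] lies within 1 above an odd digit, so it never meets a slope. *)
Definition tent (u : rat) (r : nat) : rat :=
  Num.min u (2 * r).+1%:R - Num.min u (2 * r)%:R -
  Num.min u (2 * r).+3%:R + Num.min u (2 * r).+2%:R.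

Lemma tent_top s a : tent (base * value s) (enum_rank a) = (ohead s == Some a)%:R.
Proof.
case: s => [|b s].
  rewrite /tent /= mulr0.
  have m0 k : Num.min 0 k%:R = 0 :> rat by apply/min_idPl; rewrite ler0n.
  by rewrite !m0 /=; ring.
rewrite base_value /=; have /andP[] := value_bounds s; move: (value s) => v v0 v1.
have -> : (Some b == Some a) = (enum_rank b == enum_rank a :> nat).
  by apply/eqP/eqP => [[->]//|/val_inj/enum_rank_inj ->].
rewrite /digit /tent; move: (nat_of_ord (enum_rank b)) (nat_of_ord (enum_rank a)) => m n.
have E k j : (2 * k + j)%:R = 2 * k%:R + j%:R :> rat by rewrite natrD natrM.
have := E n 1%N; have := E n 2%N; have := E n 3%N; have := E m 1%N.
have := E n 0%N; rewrite !addnS !addn0 => -> -> -> -> ->.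
have [mn|mn|->] := ltngtP m n.
- have : m.+1%:R <= n%:R :> rat by rewrite ler_nat.
  rewrite -natr1; move: (m%:R) (n%:R) => x y xy.
  have h k : 0 <= k -> Num.min (2 * x + 1 + v) (2 * y + k) = 2 * x + 1 + v.
    by move=> k0; rewrite min_l//; lra.
  by rewrite !h// subrr sub0r addNr.
- have : n.+1%:R <= m%:R :> rat by rewrite ler_nat.
  rewrite -natr1; move: (m%:R) (n%:R) => x y xy.
  have h k : k <= 3 -> Num.min (2 * x + 1 + v) (2 * y + k) = 2 * y + k.
    by move=> k0; rewrite min_r//; lra.
  by rewrite !h//=; ring.
- move: (n%:R) => x; rewrite (min_r (y := 2 * x + 1)); last by lra.
  rewrite (min_r (y := 2 * x + 0)); last by lra.
  rewrite (min_l (y := 2 * x + 3)); last by lra.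
  rewrite (min_l (y := 2 * x + 2)); last by lra.
  by rewrite /=; ring.
Qed.

Lemma value_behead s :
  base * value s - \sum_a digit a * (ohead s == Some a)%:R = value (behead s).
Proof.
case: s => [|b s]; first by rewrite /= mulr0 big1 ?subr0// => a _; rewrite mulr0.
rewrite base_value (bigD1 b)//= eqxx mulr1 big1 ?addr0; first by ring.
by move=> a ab; case: eqP => [[/esym/eqP]|]; rewrite ?(negbTE ab)// mulr0.
Qed.
End StackValues.

(** * Linear layers that execute stack programs *)

Section LinearForms.
Variables (F : fieldType) (N : finType).
Implicit Types (f g : (N -> F) -> F).

Definition linear_form f := forall a u v, f (fun i => a * u i + v i) = a * f u + f v.

Lemma linear_form0 : linear_form (fun=> 0).
Proof. by move=> a u v; rewrite mulr0 addr0. Qed.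
Lemma linear_formD f g : linear_form f -> linear_form g -> linear_form (fun u => f u + g u).
Proof. by move=> lf lg a u v; rewrite lf lg; ring. Qed.
Lemma linear_formB f g : linear_form f -> linear_form g -> linear_form (fun u => f u - g u).
Proof. by move=> lf lg a u v; rewrite lf lg; ring. Qed.
Lemma linear_formZ c f : linear_form f -> linear_form (fun u => c * f u).
Proof. by move=> lf a u v; rewrite lf; ring. Qed.
Lemma linear_formZr c f : linear_form f -> linear_form (fun u => f u * c).
Proof. by move=> lf a u v; rewrite lf; ring. Qed.
Lemma linear_form_sum (K : finType) (f : K -> (N -> F) -> F) :
  (forall k, linear_form (f k)) -> linear_form (fun u => \sum_k f k u).
Proof.
by move=> lf a u v; under eq_bigr do rewrite lf; rewrite big_split/= mulr_sumr.
Qed.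
End LinearForms.

Section Program.
Variables (St I Gam : finType).

Variant instr :=
| Push of I & seq Gam & St
| Pop of I & (option Gam -> St).

Variables (prog : St -> instr) (q0 : St) (I0 : pred I).
Implicit Types (q : St) (i : I) (a : Gam) (st : I -> seq Gam) (p : St * (I -> seq Gam)).

Definition set_stack st i s j := if j == i then s else st j.

Definition pstep p :=
  match prog p.1 with
  | Push i w q => (q, set_stack p.2 i (w ++ p.2 i))
  | Pop i f => (f (ohead (p.2 i)), set_stack p.2 i (behead (p.2 i)))
  end.

Definition loaded (s : seq Gam) := (q0, fun i => if I0 i then s else [::]).

(* A step of the program takes two updates: from [stored], which represents the
   configuration, to [decoded], which also holds the tops and tails of the stacks,
   and back.  Truncations are written [min(u, k) = k * min(u / k, 1)], and
   products of a bit [e] with [0 <= s <= 1] are [e + s - min(e + s, 1)]. *)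
Definition signal : finType := (I + (I + I * Gam))%type.
Definition coord : finType :=
  ((St + (I + I * 'I_(2 * #|Gam|).+2)) + ((St + (signal + St * signal)) + bool))%type.

Definition signal_value st (s : signal) : rat :=
  match s with
  | inl i => value (st i)
  | inr (inl i) => value (behead (st i))
  | inr (inr (i, a)) => (ohead (st i) == Some a)%:R
  end.

(* At [k = 0] the quotient is [0], and its product with [k] is harmlessly [0]. *)
Definition stored p (c : coord) : rat :=
  match c with
  | inl (inl q) => (q == p.1)%:R
  | inl (inr (inl i)) => value (p.2 i)
  | inl (inr (inr (i, k))) => base Gam * value (p.2 i) / k%:R
  | inr _ => 0
  end.

Definition decoded p (c : coord) : rat :=
  match c with
  | inr (inl (inl q)) => (q == p.1)%:R
  | inr (inl (inr (inl s))) => signal_value p.2 s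
  | inr (inl (inr (inr (q, s)))) => (q == p.1)%:R + signal_value p.2 s
  | _ => 0
  end.

(** A constant flag and the load; the first update copies the load to every stack in [I0] and turns
    the flag into the state [q0]. The word thus occupies one coordinate only. *)
Definition boot (v : rat) (c : coord) : rat :=
  match c with inr (inr true) => 1 | inr (inr false) => v | _ => 0 end.

Section Form.
Variable u : coord -> rat.

Definition uval i := u (inl (inr (inl i))).
(** The index type has [2 * #|Gam| + 2] elements, so [inord] is faithful up to [(2 * r).+3] for the
    largest rank [r = #|Gam| - 1]. *)
Definition ucap i (k : nat) := k%:R * u (inl (inr (inr (i, inord k)))).
Definition utop i a := let r := enum_rank a in
  ucap i (2 * r).+1 - ucap i (2 * r) - ucap i (2 * r).+3 + ucap i (2 * r).+2.
Definition usignal (s : signal) :=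
  match s with
  | inl i => uval i
  | inr (inl i) => base Gam * uval i - \sum_a digit a * utop i a
  | inr (inr (i, a)) => utop i a
  end.
Definition ustate q := u (inr (inl (inl q))).
Definition uprod q s := ustate q + u (inr (inl (inr (inl s)))) - u (inr (inl (inr (inr (q, s))))).
Definition ustate' q' := (q' == q0)%:R * u (inr (inr true)) + \sum_q
  match prog q with
  | Push _ _ q2 => (q' == q2)%:R * ustate q
  | Pop i f => (q' == f None)%:R * (ustate q - \sum_a uprod q (inr (inr (i, a)))) +
      \sum_a (q' == f (Some a))%:R * uprod q (inr (inr (i, a)))
  end.
(** The first summand loads the stack at boot and the second carries its value over; the sum adds
    the change caused by the active state. *)
Definition uval' i := (I0 i)%:R * u (inr (inr false)) + u (inr (inl (inr (inl (inl i))))) + \sum_q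
  match prog q with
  | Push j w _ => (j == i)%:R *
      ((base Gam ^- size w - 1) * uprod q (inl i) + value w * ustate q)
  | Pop j _ => (j == i)%:R * (uprod q (inr (inl i)) - uprod q (inl i))
  end.

(** One linear map does both half steps: [inl] outputs depend on [inr] inputs only, and
    conversely. *)
Definition layer (c : coord) : rat :=
  match c with
  | inl (inl q) => ustate' q
  | inl (inr (inl i)) => uval' i
  | inl (inr (inr (i, k))) => base Gam * uval' i / k%:R
  | inr (inl (inl q)) => u (inl (inl q))
  | inr (inl (inr (inl s))) => usignal s
  | inr (inl (inr (inr (q, s)))) => u (inl (inl q)) + usignal s
  | inr (inr _) => 0
  end.
End Form.

Lemma layer_linear c : linear_form (layer^~ c).
Proof.
have top i a : linear_form (fun u => utop u i a).
  apply: linear_formD; last exact: linear_formZ.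
  by do 2![apply: linear_formB; last exact: linear_formZ]; exact: linear_formZ.
have sig s : linear_form (fun u => usignal u s).
  case: s => [i|[i|[i a]]] //=; apply: linear_formB; first exact: linear_formZ.
  by apply: linear_form_sum => a; exact: linear_formZ.
have prod q s : linear_form (fun u => uprod u q s).
  by apply: linear_formB => //; exact: linear_formD.
have st' q' : linear_form (fun u => ustate' u q').
  apply: linear_formD; first exact: linear_formZ.
  apply: linear_form_sum => q; case: (prog q) => [i w q2|i f]; first exact: linear_formZ.
  apply: linear_formD; last by apply: linear_form_sum => a; exact: linear_formZ.
  by apply: linear_formZ; apply: linear_formB => //; exact: linear_form_sum.
have v' i : linear_form (fun u => uval' u i).
  apply: linear_formD; first by apply: linear_formD => //; exact: linear_formZ.
  apply: linear_form_sum => q; case: (prog q) => [j w q2|j f]; apply: linear_formZ.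
    by apply: linear_formD; exact: linear_formZ.
  exact: linear_formB.
case: c => [[q|[i|[i k]]]|[[q|[s|[q s]]]|b]] //=.
- by apply: linear_formZr; exact: linear_formZ.
- exact: linear_formD.
- exact: linear_form0.
Qed.

Definition weights (c c' : coord) : rat := layer (unit_vec rat c') c.

Lemma update_weights x c : update weights x c = layer (fun c' => Num.min (x c') 1) c.
Proof. by rewrite /update -(row_linearE (layer_linear c)). Qed.

Local Notation clip x := (fun c => Num.min (x c) 1).

Lemma min1_nat (b : bool) : Num.min b%:R 1 = b%:R :> rat.
Proof. by case: b; apply/min_idPl. Qed.

Lemma min1_value (s : seq Gam) : Num.min (value s) 1 = value s.
Proof. by apply/min_idPl/ltW; case/andP: (value_bounds s). Qed.

Lemma signal_bounds st s : 0 <= signal_value st s <= 1.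
Proof.
case: s => [i|[i|[i a]]] /=; last by case: eqP.
  by have /andP[-> /ltW] := value_bounds (st i).
by have /andP[-> /ltW] := value_bounds (behead (st i)).
Qed.

Lemma scaled_min x k : 0 <= x -> k%:R * Num.min (x / k%:R) 1 = Num.min x k%:R :> rat.
Proof.
case: k => [|k] x0; first by rewrite mul0r; apply/esym/min_idPr.
by rewrite minr_pMr ?ler0n// mulr1 mulrC divfK// pnatr_eq0.
Qed.

Lemma layer_inl0 u c : (forall c, u (inr c) = 0) -> layer u (inl c) = 0.
Proof.
move=> u0; have p0 q s : uprod u q s = 0 by rewrite /uprod /ustate !u0 addr0 subr0.
have s0 q : ustate' u q = 0.
  rewrite /ustate' u0 mulr0 add0r big1// => q' _; rewrite /ustate u0.
  case: (prog q') => [i w q2|i f]; first by rewrite mulr0.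
  by rewrite !big1 ?subr0 ?mulr0 ?addr0// => a _; rewrite p0 ?mulr0.
have v0 i : uval' u i = 0.
  rewrite /uval' !u0 mulr0 !add0r big1// => q' _; rewrite /ustate u0.
  by case: (prog q') => [j w q2|j f]; rewrite !p0 !(mulr0, subrr, addr0).
by case: c => [q|[i|[i k]]] //=; rewrite v0 mulr0 mul0r.
Qed.

Lemma layer_inr0 u c : (forall c, u (inl c) = 0) -> layer u (inr c) = 0.
Proof.
move=> u0; have c0 i k : ucap u i k = 0 by rewrite /ucap u0 mulr0.
have t0 i a : utop u i a = 0 by rewrite /utop !c0; ring.
have s0 s : usignal u s = 0.
  case: s => [i|[i|[i a]]] //=; first by rewrite /uval u0.
  by rewrite /uval u0 mulr0 big1 ?subr0// => a _; rewrite t0 mulr0.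
by case: c => [[q|[s|[q s]]]|b] //=; rewrite u0 s0 addr0.
Qed.

Lemma layer_stored p c : layer (clip (stored p)) c = decoded p c.
Proof.
case: c => c; first by rewrite layer_inl0// => c'; apply/min_idPl.
set u := clip (stored p).
have val i : uval u i = value (p.2 i) by exact: min1_value.
have top i a : utop u i a = (ohead (p.2 i) == Some a)%:R.
  have cap k : (k < (2 * #|Gam|).+2)%N -> ucap u i k = Num.min (base Gam * value (p.2 i)) k%:R.
    by move=> k1; rewrite /ucap /u /= inordK// scaled_min// base_value_ge0.
  have ra : (enum_rank a < #|Gam|)%N := ltn_ord _.
  rewrite -tent_top /utop /tent; move: (nat_of_ord (enum_rank a)) ra => r ra.
  by rewrite !cap//; lia.
have sig s : usignal u s = signal_value p.2 s.
  case: s => [i|[i|[i a]]] //=.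
  by rewrite val -value_behead; congr (_ - _); apply: eq_bigr => a _; rewrite top.
have e q : u (inl (inl q)) = (q == p.1)%:R by exact: min1_nat.
by case: c => [[q|[s|[q s]]]|b] //=; rewrite ?sig ?e.
Qed.

Lemma layer_decoded p c : layer (clip (decoded p)) c = stored (pstep p) c.
Proof.
case: c => c; last by rewrite layer_inr0// => c'; apply/min_idPl.
set u := clip (decoded p).
have e q : ustate u q = (q == p.1)%:R by exact: min1_nat.
have pr q s : uprod u q s = (q == p.1)%:R * signal_value p.2 s.
  rewrite /uprod e /u /=; have /andP[s0 s1] := signal_bounds p.2 s.
  rewrite (min_idPl s1); case: eqP => _ /=; last by rewrite !add0r (min_idPl s1) subrr mul0r.
  by rewrite (min_idPr _) ?lerDl// mul1r addrC addKr.
have b0 b : u (inr (inr b)) = 0 by apply/min_idPl.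
have st' q : ustate' u q = (q == (pstep p).1)%:R.
  rewrite /ustate' b0 mulr0 add0r (bigD1 p.1)//= big1 ?addr0; last first.
    move=> q' /negbTE qp; rewrite e qp; case: (prog q') => [i w q2|i f]; first by rewrite mulr0.
    by rewrite !big1 ?subr0 ?mulr0 ?addr0// => a _; rewrite pr qp mul0r ?mulr0.
  rewrite e eqxx /pstep; case: (prog p.1) => [i w q2|i f]; first by rewrite mulr1.
  under eq_bigr do rewrite pr eqxx mul1r /=.
  under [X in _ + X]eq_bigr do rewrite pr eqxx mul1r /=.
  case: (p.2 i) => [|b s] /=.
    by rewrite !big1 ?subr0 ?mulr1 ?addr0// => a _; rewrite mulr0.
  rewrite (bigD1 b)//= eqxx big1 ?addr0 ?subrr ?mulr0 ?add0r; last first.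
    by move=> a /negbTE ab; rewrite (_ : Some b == Some a = false)// eq_sym; exact: ab.
  rewrite (bigD1 b)//= eqxx mulr1 big1 ?addr0// => a /negbTE ab.
  by rewrite (_ : Some b == Some a = false) ?mulr0// eq_sym; exact: ab.
have v' i : uval' u i = value ((pstep p).2 i).
  rewrite /uval' b0 mulr0 add0r (bigD1 p.1)//= big1 ?addr0; last first.
    move=> q' /negbTE qp; rewrite e; case: (prog q') => [j w q2|j f]; rewrite !pr qp;
      by rewrite !(mul0r, mulr0, addr0, subrr).
  have -> : u (inr (inl (inr (inl (inl i))))) = value (p.2 i) by exact: min1_value.
  rewrite /pstep; case: (prog p.1) => [j w q2|j f]; rewrite !pr ?e !eqxx !mul1r /= /set_stack
    (eq_sym i); case: eqP => [->|_]; rewrite ?mul1r ?mul0r ?addr0//.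
    by rewrite value_cat; ring.
  by ring.
by case: c => [q|[i|[i k]]] //=; rewrite v'.
Qed.

Lemma layer_boot (s : seq Gam) c : layer (clip (boot (value s))) c = stored (loaded s) c.
Proof.
case: c => c; last by rewrite layer_inr0// => c'; apply/min_idPl.
set u := clip (boot (value s)).
have u0 c' : u (inr (inl c')) = 0 by apply/min_idPl.
have pr q s' : uprod u q s' = 0 by rewrite /uprod /ustate !u0 addr0 subr0.
have u1 : u (inr (inr true)) = 1 by apply/min_idPl.
have uv : u (inr (inr false)) = value s by exact: min1_value.
have st' q : ustate' u q = (q == q0)%:R.
  rewrite /ustate' u1 mulr1 big1 ?addr0// => q' _; rewrite /ustate u0.
  case: (prog q') => [i w q2|i f]; first by rewrite mulr0.
  by rewrite !big1 ?subr0 ?mulr0 ?addr0// => a _; rewrite pr ?mulr0.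
have v' i : uval' u i = value ((loaded s).2 i).
  rewrite /uval' uv u0 addr0 big1 ?addr0.
    by rewrite /=; case: ifP => _; rewrite ?mul1r ?mul0r.
  by move=> q' _; rewrite /ustate u0; case: (prog q') => [j w q2|j f];
    rewrite !pr !(mulr0, subrr, addr0).
by case: c => [q|[i|[i k]]] //=; rewrite v'.
Qed.

Lemma stored_bounds p c : 0 <= stored p c <= base Gam + 2.
Proof.
have b0 : 0 <= base Gam by rewrite ler0n.
have b2 : 0 <= base Gam + 2 by lra.
case: c => [[q|[i|[i k]]]|c] /=; rewrite ?lexx ?b2//.
- by case: eqP => _; rewrite ?ler01 ?lexx//=; lra.
- by have /andP[v0 v1] := value_bounds (p.2 i); apply/andP; split; lra.
have v0 := base_value_ge0 (p.2 i); rewrite divr_ge0//=.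
apply: (@le_trans _ _ (base Gam * value (p.2 i))); last first.
  apply: (@le_trans _ _ (base Gam)); last by rewrite lerDl.
  by rewrite ler_piMr//; have /andP[_ /ltW] := value_bounds (p.2 i).
case: (nat_of_ord k) => [|m]; first by rewrite invr0 mulr0.
by rewrite ler_piMr// invf_le1// ?ler1n// ltr0n.
Qed.

Lemma decoded_bounds p c : 0 <= decoded p c <= base Gam + 2.
Proof.
have b0 : 0 <= base Gam by rewrite ler0n.
have b2 : 0 <= base Gam + 2 by lra.
have b01 (b : bool) : (0 <= b%:R :> rat) && (b%:R <= 1 :> rat) by case: b; rewrite ?ler01 ?lexx.
case: c => [c|[[q|[s|[q s]]]|b]] /=; rewrite ?lexx ?b2//.
- by have /andP[h0 h1] := b01 (q == p.1); apply/andP; split; lra.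
- by have /andP[h0 h1] := signal_bounds p.2 s; apply/andP; split; lra.
- have /andP[h0 h1] := signal_bounds p.2 s; have /andP[g0 g1] := b01 (q == p.1).
  by apply/andP; split; lra.
Qed.

Lemma boot_bounds (s : seq Gam) c : 0 <= boot (value s) c <= base Gam + 2.
Proof.
have b0 : 0 <= base Gam by rewrite ler0n.
have b2 : 0 <= base Gam + 2 by lra.
have /andP[v0 v1] := value_bounds s.
case: c => [c|[c|[|]]] //; rewrite [boot _ _]/=.
  by apply/andP; split; lra.
by apply/andP; split; lra.
Qed.

Variables (R : realType) (yes : St).
Local Notation output := (inl (inl yes) : coord).
Local Notation toR := (map_mx (ratr : rat -> R)).

Definition total_weight : rat := \sum_c \sum_c' `|weights c c'|.
Definition start_cv v := node_cv (start weights total_weight (base Gam + 2) (boot v)).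
Definition drift_cv : 'cV[rat]_#|node coord| := node_cv (bias (J := coord) rat).
Definition routing_mx := node_mx (network output weights total_weight (base Gam + 2)).

(** After [boot] at index 0, the configuration after [m] steps is [stored] at index [2 m + 1] and
    [decoded] at [2 m + 2]. *)
Definition trace (s : seq Gam) n : coord -> rat :=
  if n is m.+1 then
    let p := iter m./2 pstep (loaded s) in if odd m then decoded p else stored p
  else boot (value s).

Lemma traceS s n c : trace s n.+1 c = update weights (trace s n) c.
Proof.
rewrite update_weights; case: n => [|n]; first by apply: esym; exact: layer_boot.
have -> : trace s n.+2 = let p := iter (uphalf n) pstep (loaded s) in
  if odd n then stored p else decoded p by rewrite /trace /= if_neg.
have -> : trace s n.+1 = let p := iter n./2 pstep (loaded s) in
  if odd n then decoded p else stored p by [].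
rewrite /= uphalf_half; case: (odd n); first by rewrite layer_decoded.
by rewrite layer_stored.
Qed.

Lemma trace_bounds s n c : 0 <= trace s n c <= base Gam + 2.
Proof.
by case: n => [|n] /=; [exact: boot_bounds|case: ifP => _; [exact: decoded_bounds|exact: stored_bounds]].
Qed.

Lemma total_weightP c : \sum_c' `|weights c c'| <= total_weight.
Proof. by rewrite /total_weight [leRHS](bigD1 c)//= lerDl !sumr_ge0// => k _; rewrite sumr_ge0. Qed.

Lemma total_weight_ge0 : 0 <= total_weight.
Proof. by rewrite sumr_ge0// => k _; rewrite sumr_ge0. Qed.

Lemma base_ge1 : 1 <= base Gam + 2.
Proof. by have : 0 <= base Gam; [rewrite ler0n|lra]. Qed.

Lemma routing_completely_S : completely_S (toR routing_mx).
Proof. exact: network_completely_S total_weightP total_weight_ge0 base_ge1. Qed.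

Lemma start_cv_ge0 (s : seq Gam) k : 0 <= start_cv (value s) k 0.
Proof.
rewrite mxE; apply: start_ge0 total_weight_ge0 base_ge1 _ => c.
by case/andP: (boot_bounds s c).
Qed.

Definition load_index : 'I_#|node coord| := enum_rank (buffer (inr (inr false)) : node coord).

Lemma start_cv_load v : start_cv v load_index 0 = v.
Proof. by rewrite mxE enum_rankK. Qed.

Lemma start_cv_const v v' k : k != load_index -> start_cv v k 0 = start_cv v' k 0.
Proof.
rewrite !mxE => kl; have : enum_val k != buffer (inr (inr false)) :> node coord.
  by apply: contra kl => /eqP e; rewrite /load_index -e enum_valK.
by case: (enum_val k) => [[[[]|]|]|[j|[j|[c|[c|[]]]]]].
Qed.

Lemma program_stable s : (forall n, (iter n pstep (loaded s)).1 != yes) ->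
  stable (toR (start_cv (value s))) (toR drift_cv) (toR routing_mx).
Proof.
move=> no; apply: (network_stable total_weightP total_weight_ge0 base_ge1 (x := trace s)).
- by move=> n j; case/andP: (trace_bounds s n j).
- by move=> n j; case/andP: (trace_bounds s n j).
- exact: traceS.
- by case=> [|n] //=; case: ifP => //= _; rewrite eq_sym (negbTE (no _)).
Qed.

Lemma program_unstable s n : (iter n pstep (loaded s)).1 = yes ->
  ~ stable (toR (start_cv (value s))) (toR drift_cv) (toR routing_mx).
Proof.
(* The minimal time is taken since the output must be 0 in all earlier turns. *)
move=> en; have ex : exists n, (iter n pstep (loaded s)).1 == yes by exists n; apply/eqP.
case: (ex_minnP ex) => m /eqP em mmin.
apply: (network_unstable total_weightP total_weight_ge0 base_ge1 (x := trace s) _ _ _ (m := m.*2.+1)).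
- by move=> k j; case/andP: (trace_bounds s k j).
- by move=> k j; case/andP: (trace_bounds s k j).
- exact: traceS.
- case=> [|k] //=; rewrite ltnS => km; case: ifP => //= ok; case: eqP => // /esym/eqP/mmin mk.
  by have := odd_double_half k; rewrite ok add0n; lia.
- by rewrite /trace odd_double doubleK; rewrite [LHS]/= em eqxx.
Qed.
End Program.

(** * The encoding of an instance *)

Section BinaryNotation.

Definition bit (b : bool) : letter := if b then One else Zero.

Fixpoint block (k d : nat) : seq letter :=
  if k is k'.+1 then rcons (block k' d./2) (bit (odd d)) else [::].

Lemma encode_nat_double m (b : bool) : (0 < m)%N ->
  encode_nat (m.*2 + b) = rcons (encode_nat m) (bit b).
Proof.
case: m => // m _; rewrite /encode_nat.
have : nat_of_bin (bin_of_nat m.+1) = m.+1 by rewrite bin_of_natK.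
case: (bin_of_nat m.+1) => [|p] // pm; rewrite [nat_of_bin _]/= in pm.
case: b.
  have -> : (m.+1.*2 + true)%N = nat_of_bin (BinNums.Npos (BinNums.xI p)).
    by rewrite -pm /= NatTrec.doubleE addn1.
  by rewrite nat_of_binK.
have -> : (m.+1.*2 + false)%N = nat_of_bin (BinNums.Npos (BinNums.xO p)).
  by rewrite -pm /= NatTrec.doubleE addn0.
by rewrite nat_of_binK.
Qed.

(** Appending [k] bits multiplies by [2 ^ k] and adds [d]; with [m] positive the word still begins
    with a nonzero digit. *)
Lemma encode_nat_block k m d : (0 < m)%N -> (d < 2 ^ k)%N ->
  encode_nat (m * 2 ^ k + d) = encode_nat m ++ block k d.
Proof.
elim: k m d => [|k IH] m d m0 dk.
  by move: dk; rewrite expn0 ltnS leqn0 => /eqP ->; rewrite muln1 addn0 cats0.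
have -> : (m * 2 ^ k.+1 + d = (m * 2 ^ k + d./2).*2 + odd d)%N.
  by have := odd_double_half d; rewrite expnS; lia.
rewrite encode_nat_double; last by rewrite addn_gt0 muln_gt0 m0 expn_gt0.
rewrite IH//=; first by rewrite rcons_cat.
by move: dk; have := odd_double_half d; rewrite expnS; lia.
Qed.

Lemma encode_nat_exp k : encode_nat (2 ^ k) = One :: nseq k Zero.
Proof.
have := @encode_nat_block k 1 0 isT (expn_gt0 _ _); rewrite mul1n addn0 => -> /=.
congr cons; elim: k => //= k ->; rewrite -cats1.
by rewrite (_ : [:: bit false] = nseq 1 Zero)// cat_nseq; elim: k => //= k ->.
Qed.
End BinaryNotation.

(** * Spelling the numerator and the denominator of a load *)

Section EncodedValues.
Variable Gam : finType.
Implicit Types (a : Gam) (s : seq Gam).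
Local Notation width := #|Gam|.+1.

Definition digit_nat a : nat := (2 * enum_rank a).+1.

Fixpoint numerator s : nat :=
  if s is a :: s' then (digit_nat a * 2 ^ (width * size s') + numerator s')%N else 0%N.

Lemma digit_nat_lt a : (digit_nat a < 2 ^ width)%N.
Proof.
have ra : (enum_rank a < #|Gam|)%N := ltn_ord _.
by rewrite /digit_nat expnS; have := ltn_expl #|Gam| (isT : 1 < 2)%N; lia.
Qed.

Lemma value_numerator s : value s = (numerator s)%:R / (2 ^ (width * size s))%:R.
Proof.
elim: s => [|a s IH] /=; first by rewrite mul0r.
rewrite IH mulnS expnD natrD !natrM /base invfM.
have k0 : (2 ^ (width * size s))%:R != 0 :> rat by rewrite pnatr_eq0 -lt0n expn_gt0.
have b0 : (2 ^ width)%:R != 0 :> rat by rewrite pnatr_eq0 -lt0n expn_gt0.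
rewrite /digit -/(digit_nat a); move: (_%:R) k0 (_%:R) b0 => k k0 b b0.
by field; rewrite k0 b0.
Qed.

(** The last digit is odd and the others carry even weights. The fraction over a power of 2 is
    therefore in lowest terms, and its encoding can be spelled from the stack. *)
Lemma odd_numerator a s : odd (numerator (a :: s)).
Proof.
elim: s a => [|b s IH] a; first by rewrite /= muln0 expn0 muln1 addn0 /digit_nat /= mul2n odd_double.
have := IH b; rewrite [numerator (a :: _)]/= oddD -/(numerator (b :: s)) => ->.
by rewrite oddM oddX/= andbF.
Qed.

Definition code (s : seq Gam) : seq letter := flatten [seq block width (digit_nat b) | b <- s].

Lemma encode_numerator m s : (0 < m)%N ->
  encode_nat (m * 2 ^ (width * size s) + numerator s) = encode_nat m ++ code s.
Proof.
elim: s m => [|a s IH] m m0; first by rewrite /= muln0 expn0 muln1 addn0 cats0.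
have -> : (m * 2 ^ (width * size (a :: s)) + numerator (a :: s) =
    (m * 2 ^ width + digit_nat a) * 2 ^ (width * size s) + numerator s)%N.
  by rewrite [size _]/= [numerator (a :: s)]/= mulnS expnD mulnDl mulnA addnA.
rewrite IH; last by rewrite addn_gt0 muln_gt0 m0 expn_gt0.
by rewrite encode_nat_block ?digit_nat_lt// -catA.
Qed.

Lemma encode_rat_value a s : encode_rat (value (a :: s)) =
  (encode_nat (digit_nat a) ++ code s) ++ Slash :: One :: nseq (width * (size s).+1) Zero.
Proof.
have odd_n := odd_numerator a s.
have cop : coprime `|(numerator (a :: s))%:Z| `|(2 ^ (width * size (a :: s)))%:Z|.
  by rewrite /= coprime_sym coprimeXl// coprime2n.
rewrite value_numerator /encode_rat.
have -> : (numerator (a :: s))%:R / (2 ^ (width * size (a :: s)))%:R =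
  (numerator (a :: s))%:Z%:~R / (2 ^ (width * size (a :: s)))%:Z%:~R :> rat by [].
have p0 : (0 < 2 ^ (width * size (a :: s)))%N by rewrite expn_gt0.
rewrite coprimeq_num// coprimeq_den//; move: p0 (encode_nat_exp (width * size (a :: s))).
case: (2 ^ _)%N => // k _ /= ->; rewrite -(encode_numerator s (isT : 0 < digit_nat a)%N).
by rewrite mul1n.
Qed.
End EncodedValues.

(** The order of the quantifiers is the point: [pre] and [post] serve every [v], so [v] may
    afterwards be built from them. *)
Lemma encode_input_split (d : nat) (z : rat -> 'cV[rat]_d) (theta : 'cV[rat]_d) (A : 'M[rat]_d)
    (i0 : 'I_d) : (forall v, z v i0 0 = v) ->
  (forall v v' i, i != i0 -> z v i 0 = z v' i 0) ->
  exists pre post, forall v,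
    encode_input (z v) theta A = pre ++ encode_rat v ++ Comma :: post.
Proof.
move=> zi0 zc; rewrite /encode_input.
set f := fun q => rcons (encode_rat q) Comma.
set rest := map (fun i => theta i 0) _ ++ _.
have [e1 [e2 eE]] : exists e1 e2, enum 'I_d = e1 ++ i0 :: e2.
  have : i0 \in enum 'I_d by rewrite mem_enum.
  by case/splitPr => e1 e2; exists e1, e2.
have := enum_uniq 'I_d; rewrite eE cat_uniq /= negb_or -andbA => /and4P[_ n1 _ /andP[n2 _]].
have cst e v : i0 \notin e -> [seq z v i 0 | i <- e] = [seq z 0 i 0 | i <- e].
  by move=> ne; apply/eq_in_map => i ie; apply: zc; apply: contraNneq ne => <-.
exists (encode_nat d ++ Comma :: flatten (map f [seq z 0 i 0 | i <- e1])).
exists (flatten (map f ([seq z 0 i 0 | i <- e2] ++ rest))) => v.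
rewrite [map _ (e1 ++ _)]map_cat [map _ (i0 :: e2)]/= (cst e1 v)// (cst e2 v)// zi0.
rewrite -(catA (map _ e1)) map_cat flatten_cat -[RHS]catA; congr (_ ++ Comma :: (_ ++ _)).
by rewrite [LHS]/= {1}/f cat_rcons.
Qed.

(** * From Turing machines to stack programs *)

Variant phase := Before | Numerator | Solidus | Denominator | Zeros | Separator | After | Rewind.

Definition phase_code p : bool * bool * bool :=
  match p with
  | Before => (false, false, false) | Numerator => (false, false, true)
  | Solidus => (false, true, false) | Denominator => (false, true, true)
  | Zeros => (true, false, false) | Separator => (true, false, true)
  | After => (true, true, false) | Rewind => (true, true, true)
  end.

Definition phase_decode (c : bool * bool * bool) : phase :=
  match c with
  | (false, false, false) => Before | (false, false, true) => Numerator
  | (false, true, false) => Solidus | (false, true, true) => Denominator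
  | (true, false, false) => Zeros | (true, false, true) => Separator
  | (true, true, false) => After | (true, true, true) => Rewind
  end.

Lemma phase_codeK : cancel phase_code phase_decode. Proof. by case. Qed.
HB.instance Definition _ := Finite.copy phase (can_type phase_codeK).

Definition stack : finType := (option bool + bool)%type.
Definition stk1 : stack := inl None.
Definition stk2 : stack := inl (Some false).
Definition stk3 : stack := inl (Some true).
Definition stkl : stack := inr false.
Definition stkr : stack := inr true.

Section Compiler.
Variable M : turing_machine letter.
Local Notation sym := (@tm_input _ M).

(* [inr true] heads the data, and its digit leads the numerator of the load;
   [inr false] marks the place of the load. *)
Definition gamma : finType := (tm_symbol M + bool)%type.
Local Notation width := #|gamma|.+1.

Definition core : finType := (phase + (tm_state M + tm_state M))%type.
(** An instruction either pops or pushes, so a symbol in transit is kept in the state: [putting]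
    with its target and continuation, [spelling] as a digit of the numerator. *)
Definition pstate : finType := (core + (stack * gamma * core + gamma))%type.

Definition at_phase (p : phase) : core := inl p.
Definition running (q : tm_state M) : core := inr (inl q).
Definition pulling (q : tm_state M) : core := inr (inr q).
Definition putting i g k : pstate := inr (inl (i, g, k)).
Definition spelling g : pstate := inr (inr g).

Definition read_symbol (o : option gamma) : tm_symbol M :=
  if o is Some (inl a) then a else tm_blank M.

Definition on_tape (w : seq letter) : seq gamma := [seq inl (sym x) | x <- w].

(** The leading digit is printed without leading zeros and the others at fixed width; [inr true]
    occurs in the data only at the head. *)
Definition spell (g : gamma) : seq letter :=
  if g == inr true then encode_nat (digit_nat g) else block width (digit_nat g).

(* The tape is written on [stkl] in reverse: the letters of the first stack up to
   [inr false], the numerator of the load from the second, its denominator from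
   the size of the third, and the rest of the first. *)
Definition compiled (s : pstate) : instr pstate stack gamma :=
  match s with
  | inl (inl Before) => Pop stk1 (fun o : option gamma => match o with
      | Some (inl a) => putting stkl (inl a) (at_phase Before)
      | Some (inr true) => inl (at_phase Before)
      | _ => inl (at_phase Numerator)
      end)
  | inl (inl Numerator) => Pop stk2 (fun o : option gamma =>
      if o is Some g then spelling g else inl (at_phase Solidus))
  | inl (inl Solidus) => Push stkl (on_tape [:: One; Slash]) (inl (at_phase Denominator))
  | inl (inl Denominator) => Pop stk3 (fun o : option gamma =>
      inl (at_phase (if o is Some _ then Zeros else Separator)))
  | inl (inl Zeros) => Push stkl (on_tape (nseq width Zero)) (inl (at_phase Denominator))
  | inl (inl Separator) => Push stkl (on_tape [:: Comma]) (inl (at_phase After))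
  | inl (inl After) => Pop stk1 (fun o : option gamma =>
      if o is Some g then putting stkl g (at_phase After) else inl (at_phase Rewind))
  | inl (inl Rewind) => Pop stkl (fun o : option gamma =>
      if o is Some g then putting stkr g (at_phase Rewind) else inl (running (tm_start M)))
  | inl (inr (inl q)) =>
      if (q == tm_yes M) || (q == tm_no M) then Push stkl [::] s
      else Pop stkr (fun o => match tm_trans q (read_symbol o) with
        | (q', a, MoveLeft) => putting stkr (inl a) (pulling q')
        | (q', a, Stay) => putting stkr (inl a) (running q')
        | (q', a, MoveRight) => putting stkl (inl a) (running q')
        end)
  | inl (inr (inr q)) => Pop stkl (fun o => putting stkr (inl (read_symbol o)) (running q))
  | inr (inl (i, g, k)) => Push i [:: g] (inl k)
  | inr (inr g) => Push stkl (rev (on_tape (spell g))) (inl (at_phase Numerator))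
  end.

Definition conf (s : pstate) (a b c l r : seq gamma) : pstate * (stack -> seq gamma) :=
  (s, fun i => match i with
    | inl None => a | inl (Some false) => b | inl (Some true) => c
    | inr false => l | inr true => r end).

Local Notation advance := (pstep compiled).

Ltac by_stack h := by rewrite /pstep /= h; congr pair; apply: funext => -[[[]|]|[]].

Lemma pop1 s f a b c l r : compiled s = Pop stk1 f ->
  advance (conf s a b c l r) = conf (f (ohead a)) (behead a) b c l r.
Proof. by move=> h; by_stack h. Qed.
Lemma pop2 s f a b c l r : compiled s = Pop stk2 f ->
  advance (conf s a b c l r) = conf (f (ohead b)) a (behead b) c l r.
Proof. by move=> h; by_stack h. Qed.
Lemma pop3 s f a b c l r : compiled s = Pop stk3 f ->
  advance (conf s a b c l r) = conf (f (ohead c)) a b (behead c) l r.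
Proof. by move=> h; by_stack h. Qed.
Lemma popl s f a b c l r : compiled s = Pop stkl f ->
  advance (conf s a b c l r) = conf (f (ohead l)) a b c (behead l) r.
Proof. by move=> h; by_stack h. Qed.
Lemma popr s f a b c l r : compiled s = Pop stkr f ->
  advance (conf s a b c l r) = conf (f (ohead r)) a b c l (behead r).
Proof. by move=> h; by_stack h. Qed.
Lemma pushl s w s' a b c l r : compiled s = Push stkl w s' ->
  advance (conf s a b c l r) = conf s' a b c (w ++ l) r.
Proof. by move=> h; by_stack h. Qed.
Lemma pushr s w s' a b c l r : compiled s = Push stkr w s' ->
  advance (conf s a b c l r) = conf s' a b c l (w ++ r).
Proof. by move=> h; by_stack h. Qed.

Definition reaches p p' := exists n, iter n advance p = p'.

Lemma reaches_refl p : reaches p p. Proof. by exists 0%N. Qed.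
Lemma reaches_step p p' : reaches (advance p) p' -> reaches p p'.
Proof. by case=> n h; exists n.+1; rewrite iterSr. Qed.
Lemma reaches_trans p2 p1 p3 : reaches p1 p2 -> reaches p2 p3 -> reaches p1 p3.
Proof. by case=> m h [n h']; exists (n + m)%N; rewrite iterD h. Qed.

Lemma copy_before w a b c l r :
  reaches (conf (inl (at_phase Before)) (on_tape w ++ inr false :: a) b c l r)
    (conf (inl (at_phase Numerator)) a b c (rev (on_tape w) ++ l) r).
Proof.
elim: w l => [|x w IH] l.
  by apply: reaches_step; rewrite (pop1 (s := inl (at_phase Before)) _ _ _ _ _ erefl); exact: reaches_refl.
do 2 apply: reaches_step; rewrite (pop1 (s := inl (at_phase Before)) _ _ _ _ _ erefl) /=.
rewrite (pushl (s := putting _ _ _) _ _ _ _ _ erefl) rev_cons cat_rcons; exact: IH.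
Qed.

Lemma spell_numerator a b c l r :
  reaches (conf (inl (at_phase Numerator)) a b c l r)
    (conf (inl (at_phase Solidus)) a [::] c
      (rev (on_tape (flatten (map spell b))) ++ l) r).
Proof.
elim: b l => [|g b IH] l.
  by apply: reaches_step; rewrite (pop2 (s := inl (at_phase Numerator)) _ _ _ _ _ erefl); exact: reaches_refl.
do 2 apply: reaches_step; rewrite (pop2 (s := inl (at_phase Numerator)) _ _ _ _ _ erefl) [ohead _]/= [behead _]/=.
rewrite (pushl (s := spelling _) _ _ _ _ _ erefl) /= /on_tape map_cat rev_cat -catA; exact: IH.
Qed.

Lemma spell_zeros a b c l r :
  reaches (conf (inl (at_phase Denominator)) a b c l r)
    (conf (inl (at_phase Separator)) a b [::] (on_tape (nseq (width * size c) Zero) ++ l) r).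
Proof.
elim: c l => [|g c IH] l.
  by rewrite muln0; apply: reaches_step; rewrite (pop3 (s := inl (at_phase Denominator)) _ _ _ _ _ erefl); exact: reaches_refl.
do 2 apply: reaches_step; rewrite (pop3 (s := inl (at_phase Denominator)) _ _ _ _ _ erefl) [ohead _]/= [behead _]/=.
rewrite (pushl (s := inl (at_phase Zeros)) _ _ _ _ _ erefl) [size _]/= mulnSr nseqD /on_tape map_cat -catA; exact: IH.
Qed.

Lemma copy_after a b c l r :
  reaches (conf (inl (at_phase After)) a b c l r)
    (conf (inl (at_phase Rewind)) [::] b c (rev a ++ l) r).
Proof.
elim: a l => [|x a IH] l.
  by apply: reaches_step; rewrite (pop1 (s := inl (at_phase After)) _ _ _ _ _ erefl); exact: reaches_refl.
do 2 apply: reaches_step; rewrite (pop1 (s := inl (at_phase After)) _ _ _ _ _ erefl) /=.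
rewrite (pushl (s := putting _ _ _) _ _ _ _ _ erefl) rev_cons cat_rcons; exact: IH.
Qed.

Lemma rewind a b c l r :
  reaches (conf (inl (at_phase Rewind)) a b c l r)
    (conf (inl (running (tm_start M))) a b c [::] (rev l ++ r)).
Proof.
elim: l r => [|x l IH] r.
  by apply: reaches_step; rewrite (popl (s := inl (at_phase Rewind)) _ _ _ _ _ erefl); exact: reaches_refl.
do 2 apply: reaches_step; rewrite (popl (s := inl (at_phase Rewind)) _ _ _ _ _ erefl) /=.
rewrite (pushr (s := putting _ _ _) _ _ _ _ _ erefl) rev_cons cat_rcons; exact: IH.
Qed.

Local Notation at_run q := (inl (running q) : pstate).

(** The head cell is the top of [stkr]; an empty stack also stands for a blank cell with nothing to
    its right. *)
Definition tape_right (c : config M) (r : seq gamma) : Prop :=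
  r = map inl (cf_head c :: cf_right c) \/
  [/\ r = [::], cf_head c = tm_blank M & cf_right c = [::]].

Lemma tape_rightP (h : tm_symbol M) rs q ls r : tape_right (Config q ls h rs) r ->
  read_symbol (ohead r) = h /\ behead r = map inl rs.
Proof. by case=> [->//|[-> /= -> ->]]. Qed.

Lemma tape_right_seq q ls (rs : seq (tm_symbol M)) :
  tape_right (Config q ls (head (tm_blank M) rs) (behead rs)) (map inl rs).
Proof. by case: rs => [|h rs]; [right|left]. Qed.

Lemma simulate_step (f : config M) a b c r : tape_right f r ->
  exists r', tape_right (step f) r' /\
    reaches (conf (at_run (cf_state f)) a b c (map inl (cf_left f)) r)
      (conf (at_run (cf_state (step f))) a b c (map inl (cf_left (step f))) r').
Proof.
rewrite /step; case: ifPn => [_ fr|nh]; first by exists r; split=> //; exact: reaches_refl.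
case: f nh => q ls h rs; rewrite /halted /= => nh /tape_rightP[rh rr].
have hs : advance (conf (at_run q) a b c (map inl ls) r) =
    conf (match tm_trans q h with
        | (q', x, MoveLeft) => putting stkr (inl x) (pulling q')
        | (q', x, Stay) => putting stkr (inl x) (running q')
        | (q', x, MoveRight) => putting stkl (inl x) (running q')
        end) a b c (map inl ls) (map inl rs).
  rewrite -rr -rh (popr (s := at_run q) (f := fun o => match tm_trans q (read_symbol o) with
        | (q', a, MoveLeft) => putting stkr (inl a) (pulling q')
        | (q', a, Stay) => putting stkr (inl a) (running q')
        | (q', a, MoveRight) => putting stkl (inl a) (running q')
        end))//=.
  by rewrite (negbTE nh).
case: (tm_trans q h) hs => -[q' x] [] hs.
- exists (inl (head (tm_blank M) ls) :: inl x :: map inl rs); split; first by left.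
  apply: reaches_step; rewrite hs; apply: reaches_step.
  rewrite (pushr (s := putting _ _ _) _ _ _ _ _ erefl); apply: reaches_step.
  rewrite (popl (s := inl (pulling _)) _ _ _ _ _ erefl); apply: reaches_step.
  rewrite (pushr (s := putting _ _ _) _ _ _ _ _ erefl).
  by case: ls {hs nh} => [|l ls]; exact: reaches_refl.
- exists (inl x :: map inl rs); split; first by left.
  apply: reaches_step; rewrite hs; apply: reaches_step.
  by rewrite (pushr (s := putting _ _ _) _ _ _ _ _ erefl); exact: reaches_refl.
- exists (map inl rs); split; first exact: tape_right_seq.
  apply: reaches_step; rewrite hs; apply: reaches_step.
  by rewrite (pushl (s := putting _ _ _) _ _ _ _ _ erefl); exact: reaches_refl.
Qed.

Lemma simulate w a b c n : exists l r,
  reaches (conf (at_run (tm_start M)) a b c [::] (on_tape w))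
    (conf (at_run (cf_state (iter n (@step _ M) (initial M w)))) a b c l r).
Proof.
suff [r [_ h]] : exists r, tape_right (iter n (@step _ M) (initial M w)) r /\
    reaches (conf (at_run (tm_start M)) a b c [::] (on_tape w))
      (conf (at_run (cf_state (iter n (@step _ M) (initial M w)))) a b c
        (map inl (cf_left (iter n (@step _ M) (initial M w)))) r).
  by do 2 eexists; exact: h.
elim: n => [|n [r [tr h]]].
  exists (on_tape w); split; last exact: reaches_refl.
  by rewrite /on_tape (map_comp inl sym); exact: tape_right_seq.
have [r' [tr' h']] := simulate_step a b c tr.
by exists r'; split=> //; exact: reaches_trans h h'.
Qed.

Lemma halted_fixed q p n : (q == tm_yes M) || (q == tm_no M) -> p.1 = at_run q ->
  (iter n advance p).1 = at_run q.
Proof.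
move=> hq pq; elim: n => //= n IH.
by rewrite /pstep IH /= hq.
Qed.

Definition data (pre post : seq letter) : seq gamma :=
  inr true :: on_tape pre ++ inr false :: on_tape post.

Local Notation load pre post :=
  (loaded (inl (at_phase Before) : pstate) (fun i : stack => if i is inl _ then true else false)
    (data pre post)).

(** As in a self-reproducing program, [data pre post] is used both as text and as number. Hence the
    word on the tape contains the encoding of the very load that produced it. *)
Lemma assemble pre post : exists a b c,
  reaches (load pre post) (conf (at_run (tm_start M)) a b c [::]
    (on_tape (pre ++ encode_rat (value (data pre post)) ++ Comma :: post))).
Proof.
have -> : load pre post =
    conf (inl (at_phase Before)) (data pre post) (data pre post) (data pre post) [::] [::].
  by congr pair; apply: funext => -[[[]|]|[]].
do 3 eexists; apply: reaches_step.
rewrite (pop1 (s := inl (at_phase Before)) _ _ _ _ _ erefl) /=.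
apply: reaches_trans; first exact: copy_before.
apply: reaches_trans; first exact: spell_numerator.
apply: reaches_step; rewrite (pushl (s := inl (at_phase Solidus)) _ _ _ _ _ erefl).
apply: reaches_trans; first exact: spell_zeros.
apply: reaches_step; rewrite (pushl (s := inl (at_phase Separator)) _ _ _ _ _ erefl).
apply: reaches_trans; first exact: copy_after.
apply: reaches_trans; first exact: rewind.
rewrite encode_rat_value.
have -> : flatten (map spell (data pre post)) =
    encode_nat (digit_nat (inr true : gamma)) ++ code (behead (data pre post)).
  rewrite /= {1}/spell eqxx; congr (_ ++ flatten _); apply/eq_in_map => g; rewrite /spell.
  have nm w : inr true \notin on_tape w by elim: w.
  by case: eqP => // ->; rewrite mem_cat in_cons !(negbTE (nm _)).
have tapeD u v : on_tape (u ++ v) = on_tape u ++ on_tape v by exact: map_cat.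
rewrite -[size (data pre post)]/(size (behead (data pre post))).+1.
move: (encode_nat _) (code _) (_ * _)%N => u v k.
have tapeN : rev (on_tape (nseq k Zero)) = on_tape (nseq k Zero).
  by rewrite /on_tape map_nseq rev_nseq.
have -> : pre ++ ((u ++ v) ++ [:: Slash, One & nseq k Zero]) ++ Comma :: post =
    ((((pre ++ (u ++ v)) ++ [:: Slash; One]) ++ nseq k Zero) ++ [:: Comma]) ++ post.
  by rewrite -!catA.
rewrite !tapeD !rev_cat !revK tapeN !cats0; exact: reaches_refl.
Qed.

Lemma halting_run pre post q : (q == tm_yes M) || (q == tm_no M) ->
  (exists n, cf_state (iter n (@step _ M) (initial M
     (pre ++ encode_rat (value (data pre post)) ++ Comma :: post))) = q) ->
  exists n, (iter n advance (load pre post)).1 = at_run q.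
Proof.
move=> hq [n hn]; have [a [b [c ra]]] := assemble pre post.
have [l [r]] := simulate (pre ++ encode_rat (value (data pre post)) ++ Comma :: post) a b c n.
by rewrite hn => /(reaches_trans ra)[m hm]; exists m; rewrite hm.
Qed.

(** Both halting states are fixed by the program, so a run that reached both would be in both at a
    common later time. *)
Lemma rejecting_run pre post :
  outputs_no M (pre ++ encode_rat (value (data pre post)) ++ Comma :: post) ->
  forall n, (iter n advance (load pre post)).1 != at_run (tm_yes M).
Proof.
move=> no n; have hn : (tm_no M == tm_yes M) || (tm_no M == tm_no M) by rewrite eqxx orbT.
have hy : (tm_yes M == tm_yes M) || (tm_yes M == tm_no M) by rewrite eqxx.
have [m hm] := halting_run hn no; apply/eqP => yes.
have := halted_fixed n hn hm; rewrite -iterD addnC iterD (halted_fixed m hy yes).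
by case=> /eqP; rewrite (negbTE (tm_yes_neq_no M)).
Qed.
End Compiler.

(** * The diagonal argument *)

Theorem theorem5 (R : realType) :
  ~ exists M : turing_machine letter,
      forall (d : nat) (z0 theta : 'cV[rat]_d) (A : 'M[rat]_d),
        (0 < d)%N ->
        (forall i, 0 <= z0 i 0) ->
        completely_S (map_mx (ratr : rat -> R) A) ->
        let is_stable :=
          stable (map_mx (ratr : rat -> R) z0) (map_mx (ratr : rat -> R) theta)
                 (map_mx (ratr : rat -> R) A) in
        (is_stable -> outputs_yes M (encode_input z0 theta A)) /\
        (~ is_stable -> outputs_no M (encode_input z0 theta A)).
Proof.
move=> [M decides].
pose prog := @compiled M; pose q0 : pstate M := inl (at_phase M Before).
pose I0 (i : stack) := if i is inl _ then true else false.
pose yes : pstate M := inl (running (tm_yes M)).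
pose z := start_cv prog q0 I0.
pose theta := drift_cv (pstate M) stack (gamma M).
pose A := routing_mx prog q0 I0 yes.
pose i0 := load_index (pstate M) stack (gamma M).
have [pre [post word]] := encode_input_split theta A (start_cv_load prog q0 I0 : forall v, z v i0 0 = v)
  (start_cv_const prog q0 I0).
have := decides _ (z (value (data M pre post))) theta A.
rewrite word => /(_ (leq_ltn_trans (leq0n _) (ltn_ord i0)) (start_cv_ge0 _ _ _ _)
  (routing_completely_S _ _ _ _ _))[yes_of_stable no_of_unstable].
(* Stability makes [M] accept, which makes the network unstable; instability makes [M] reject, which
   makes it stable. *)
have [st|unst] := pselect (stable (map_mx (ratr : rat -> R) (z (value (data M pre post))))
  (map_mx (ratr : rat -> R) theta) (map_mx (ratr : rat -> R) A)).
  have hy : (tm_yes M == tm_yes M) || (tm_yes M == tm_no M) by rewrite eqxx.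
  have [n hn] := halting_run hy (yes_of_stable st).
  exact: (program_unstable hn st).
apply: (unst); apply: program_stable.
exact: rejecting_run (no_of_unstable unst).
Qed.
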